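(* Let $(E,\phi)$ be a uniformizable Anderson $A$-module over $L$ with $A$-motive $\mathcal M$, $r=\mathrm{rk}(\mathcal M)$, and $\mathfrak p\neq0$ a prime ideal of $A$ such that $\mathcal M$ is free at $\mathfrak p$. Let $\mathbf m=(m_1,\dots,m_r)^{\mathsf T}$ be an $(A\otimes L)_{(\mathfrak p)}$-basis of $\mathcal M_{(\mathfrak p)}$, $\Theta$ the matrix with $\tau(\mathbf m)=\Theta\mathbf m$, $\Upsilon\in\mathrm{GL}_r(\mathbb T_{(\mathfrak p)})$ a rigid analytic trivialization (i.e. $\tau(\Upsilon\mathbf m)=\Upsilon\mathbf m$), and $\Psi=\Upsilon^{-1}$, so $\tau(\Psi)=\Theta\Psi$. Then for every $\gamma\in\mathrm{Gal}(L^{\mathrm{sep}}/L)$, the matrix $\Upsilon\cdot\gamma(\Upsilon)^{-1}\in\mathrm{GL}_r(A_\mathfrak p)$ (computed in $\mathrm{GL}_r((A\otimes\mathbb C_\infty)_\mathfrak p)$ via $\mathbb T_{(\mathfrak p)}\hookrightarrow(A\otimes\mathbb C_\infty)_\mathfrak p$) lies in $\Gamma_\Psi(K_\mathfrak p)\subseteq\mathrm{GL}_r(K_\mathfrak p)$. That is, the image of the $\mathfrak p$-adic Galois representation $\gamma\mapsto\Upsilon\gamma(\Upsilon)^{-1}$ lies in $\Gamma_\Psi(K_\mathfrak p)$.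
   Context: $\mathbb F_q$ finite field, $C$ smooth projective geometrically irreducible curve over $\mathbb F_q$, $\infty\in C$ closed point, $A=H^0(C\setminus\{\infty\},\mathcal O_C)$, $K=\mathrm{Frac}(A)$, $\mathbb C_\infty$ the completion at a place above $\infty$ of an algebraic closure of $K$. Unlabeled tensors over $\mathbb F_q$. $K\subseteq L\subseteq\mathbb C_\infty$, $\ell:K\to L$ inclusion, $L^{\mathrm{sep}}$ the separable closure of $L$ in $\mathbb C_\infty$. Anderson $A$-module $(E,\phi)$ over $L$: $E\cong\mathbb G_{a,L}^d$ as $\mathbb F_q$-vector space schemes, $\phi:A\to\mathrm{End}_{\mathbb F_q\text{-v.s.}}(E)$ ring homomorphism with $d\phi_a-\ell(a)$ nilpotent on $\mathrm{Lie}\,E$; uniformizable means the exponential (unique $\mathbb F_q$-linear $\exp_E:\mathrm{Lie}\,E\to E(\mathbb C_\infty)$ with $\phi_a\exp_E=\exp_Ed\phi_a$, $d\exp_E=\mathrm{id}$) is surjective. $A$-motive $\mathcal M=\mathrm{Hom}_{\mathbb F_q\text{-v.s.}}(E,\mathbb G_{a,L})$ ($A\otimes L$-module via $m\mapsto m\circ\phi_a$ and scalars on $\mathbb G_{a,L}$, with $\tau$-semilinear $m\mapsto\mathrm{Frob}_q\circ m$, $\tau(a\otimes l)=a\otimes l^q$); $\mathrm{rk}(\mathcal M)=\dim_{Q}Q\otimes_{A\otimes L}\mathcal M$ with $Q=\mathrm{Quot}(A\otimes L)$. For a domain $S\supseteq A$, $S_{(\mathfrak p)}=\bigcap_{\mathfrak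 q\supseteq\mathfrak pS}S_\mathfrak q$; $\mathcal M_{(\mathfrak p)}=(A\otimes L)_{(\mathfrak p)}\otimes\mathcal M$, and $\mathcal M$ is free at $\mathfrak p$ if this is free finitely generated. $\mathbb T$ is the Gauss-norm completion of $A\otimes\mathbb C_\infty$ (a domain, $\tau$ extended continuously), $\mathbb L=\mathrm{Quot}(\mathbb T)$; $(A\otimes F)_\mathfrak p=\varprojlim_n(A/\mathfrak p^{n+1})\otimes F$, and $\mathbb T_{(\mathfrak p)}$ embeds naturally in $(A\otimes\mathbb C_\infty)_\mathfrak p$. $A_\mathfrak p$ is the $\mathfrak p$-adic completion, $K_\mathfrak p=\mathrm{Quot}(A_\mathfrak p)$. $\mathrm{Gal}(L^{\mathrm{sep}}/L)$ acts on $(A\otimes L^{\mathrm{sep}})_\mathfrak p$ via the second factor (continuously), entrywise on matrices; the entries of $\Upsilon$ lie in $(A\otimes L^{\mathrm{sep}})_\mathfrak p$. Difference Galois group: let $P=Q[\Psi,\det(\Psi)^{-1}]\subseteq\mathbb L$ with $\tau$ restricted from $\mathbb L$; for a $K$-algebra $\mathsf A$, $\Gamma_\Psi(\mathsf A)=\{\alpha\in\mathrm{Aut}_{Q\otimes_K\mathsf A}(P\otimes_K\mathsf A):(\tau\otimes\mathrm{id})\circ\alpha=\alpha\circ(\tau\otimes\mathrm{id})\}$, embedded into $\mathrm{GL}_r(\mathsf A)$ by $\alpha\mapsto\Psi^{-1}\alpha(\Psi)$. Equivalently, with $I=\{h\in Q[Y_{ij},\det(Y)^{-1}]:h(\Psi)=0\}$,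 a matrix $C\in\mathrm{GL}_r(\mathsf A)$ lies in $\Gamma_\Psi(\mathsf A)$ iff $h(\Psi\otimes C)=0$ in $P\otimes_K\mathsf A$ for all $h\in I$, where $\Psi\otimes C=(\sum_l\Psi_{il}\otimes C_{lj})_{ij}$. *)

(* Defs.v *)
From HB Require Import structures.
From mathcomp Require Import all_boot all_order all_algebra all_field.
From mathcomp Require Import boolp classical_sets reals topology normedtype.
From mathcomp Require Import sequences.
Set Implicit Arguments.
Unset Strict Implicit.
Unset Printing Implicit Defensive.
Import Order.TTheory GRing.Theory Num.Theory.
Import numFieldNormedType.Exports.
Local Open Scope ring_scope.
Local Open Scope quotient_scope.
Local Open Scope classical_set_scope.

(** [tens aM aN] is M ⊗_S N, where S acts on M and N through the functions
    aM and aN: formal sums of pairs modulo the bilinearity relations. *)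

Section Tensor.
Context (S : Type) (M N : zmodType) (aM : S -> M -> M) (aN : S -> N -> N).

Inductive teq : seq (M * N) -> seq (M * N) -> Prop :=
| teq_refl s : teq s s
| teq_sym s t : teq s t -> teq t s
| teq_trans s t u : teq s t -> teq t u -> teq s u
| teq_cat s s' t : teq s s' -> teq (s ++ t) (s' ++ t)
| teq_catC s t : teq (s ++ t) (t ++ s)
| teq_addl m m' n : teq [:: (m + m', n)] [:: (m, n); (m', n)]
| teq_addr m n n' : teq [:: (m, n + n')] [:: (m, n); (m, n')]
| teq_zerol n : teq [:: (0, n)] [::]
| teq_bal s m n : teq [:: (aM s m, n)] [:: (m, aN s n)].

Definition teqb s t := `[< teq s t >].

Lemma teqb_refl : reflexive teqb.
Proof. by move=> s; apply/asboolP; exact: teq_refl. Qed.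

Lemma teqb_sym : symmetric teqb.
Proof. by move=> s t; apply/asboolP/asboolP => /teq_sym. Qed.

Lemma teqb_trans : transitive teqb.
Proof.
by move=> t s u /asboolP st /asboolP tu; apply/asboolP/(teq_trans st tu).
Qed.

Canonical teqb_equiv := EquivRel teqb teqb_refl teqb_sym teqb_trans.

Definition tens := {eq_quot teqb}.
HB.instance Definition _ := EqQuotient.on tens.
HB.instance Definition _ := Choice.on tens.

Definition tensor (m : M) (n : N) : tens := \pi_tens [:: (m, n)].

Lemma tens_eqP s t : teq s t <-> \pi_tens s = \pi_tens t.
Proof.
by split=> [st|/eqmodP/asboolP//]; apply/eqmodP/asboolP.
Qed.

Let repr_teq s : teq (repr (\pi_tens s)) s.
Proof. by apply/tens_eqP; rewrite reprK. Qed.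

Lemma teq_cat2 s s' t t' : teq s s' -> teq t t' -> teq (s ++ t) (s' ++ t').
Proof.
move=> ss tt; apply: teq_trans (teq_cat _ ss) _.
apply: teq_trans (teq_catC _ _) _; apply: teq_trans (teq_cat _ tt) _.
exact: teq_catC.
Qed.

Definition tens_add (x y : tens) : tens := \pi_tens (repr x ++ repr y).
Definition tens_opp (x : tens) : tens :=
  \pi_tens [seq (- p.1, p.2) | p <- repr x].

Lemma tens_addE s t : tens_add (\pi_tens s) (\pi_tens t) = \pi_tens (s ++ t).
Proof. by apply/tens_eqP; apply: teq_cat2. Qed.

Fact tens_addA : associative tens_add.
Proof.
elim/quotW => s; elim/quotW => t; elim/quotW => u.
by rewrite (tens_addE t u) (tens_addE s t) (tens_addE s) (tens_addE _ u) catA.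
Qed.

Fact tens_addC : commutative tens_add.
Proof.
elim/quotW => s; elim/quotW => t; rewrite (tens_addE s t) (tens_addE t s).
by apply/tens_eqP; exact: teq_catC.
Qed.

Fact tens_add0 : left_id (\pi_tens [::]) tens_add.
Proof. by elim/quotW => s; rewrite tens_addE. Qed.

Fact tens_addN : left_inverse (\pi_tens [::]) tens_opp tens_add.
Proof.
move=> x; rewrite -{2}(reprK x) tens_addE; apply/tens_eqP.
elim: (repr x) => [|[m n] s IH] /=; first exact: teq_refl.
set t := map _ _ in IH *.
apply: (@teq_trans _ ([:: (- m, n); (m, n)] ++ (t ++ s))).
  change (teq ([:: (- m, n)] ++ (t ++ ([:: (m, n)] ++ s)))
              ([:: (- m, n)] ++ ([:: (m, n)] ++ (t ++ s)))).
  apply: teq_cat2; first exact: teq_refl.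
  by rewrite !catA; apply: teq_cat; exact: teq_catC.
rewrite -[[::]]cats0; apply: teq_cat2 => //.
apply: teq_trans (teq_sym (teq_addl _ _ _)) _.
by rewrite addNr; exact: teq_zerol.
Qed.

HB.instance Definition _ :=
  GRing.isZmodule.Build tens tens_addA tens_addC tens_add0 tens_addN.

Definition tens_class (s : seq (M * N)) : tens := \pi_tens s.

Lemma tens_class_cat s t : tens_class (s ++ t) = tens_class s + tens_class t.
Proof. by rewrite [RHS](tens_addE s t). Qed.

Lemma tens_classP (x : tens) : exists s, x = tens_class s.
Proof. by exists (repr x); rewrite /tens_class reprK. Qed.

End Tensor.

Arguments tensor {S M N aM aN} m n.

(** The additive map on M ⊗_S N induced by a balanced biadditive map b. *)
Definition tens_lift S (M N V : zmodType) (aM : S -> M -> M) (aN : S -> N -> N)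
    (b : M -> N -> V) (x : tens aM aN) : V :=
  \sum_(p <- repr x) b p.1 p.2.

Section TensorLift.
Context (S : Type) (M N : zmodType) (aM : S -> M -> M) (aN : S -> N -> N).

Lemma tens_ind (P : tens aM aN -> Prop) :
  P 0 -> (forall m n x, P x -> P (tensor m n + x)) -> forall x, P x.
Proof.
move=> P0 PD x; have [s ->] := tens_classP x.
elim: s => [|[m n] s IH]; first exact: P0.
by rewrite -cat1s tens_class_cat; exact: PD.
Qed.

Lemma tensorDl m m' n :
  tensor (m + m') n = tensor m n + tensor m' n :> tens aM aN.
Proof.
rewrite -(tens_class_cat aM aN [:: (m, n)] [:: (m', n)]).
by apply/tens_eqP; exact: teq_addl.
Qed.

Lemma tensorDr m n n' :
  tensor m (n + n') = tensor m n + tensor m n' :> tens aM aN.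
Proof.
rewrite -(tens_class_cat aM aN [:: (m, n)] [:: (m, n')]).
by apply/tens_eqP; exact: teq_addr.
Qed.

Lemma tensor_bal s m n : tensor (aM s m) n = tensor m (aN s n) :> tens aM aN.
Proof. by apply/tens_eqP; exact: teq_bal. Qed.

Definition balanced (V : zmodType) (b : M -> N -> V) :=
  [/\ forall m m' n, b (m + m') n = b m n + b m' n,
      forall m n n', b m (n + n') = b m n + b m n' &
      forall s m n, b (aM s m) n = b m (aN s n)].

Context (V : zmodType) (b : M -> N -> V) (bP : balanced b).

Lemma teq_sum s t : teq aM aN s t ->
  \sum_(p <- s) b p.1 p.2 = \sum_(p <- t) b p.1 p.2.
Proof.
have [bDl bDr bb] := bP.
elim=> {s t} [s|s t _ ->|s t u _ -> _ ->|s s' t _ e|s t|m m' n|m n n'|n|s m n] //.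
- by rewrite !big_cat /= e.
- by rewrite !big_cat /= addrC.
- by rewrite !big_cons big_nil /= bDl !addr0.
- by rewrite !big_cons big_nil /= bDr !addr0.
- rewrite big_cons big_nil /= addr0.
  by apply: (addrI (b 0 n)); rewrite -bDl !addr0.
- by rewrite !big_cons big_nil /= bb.
Qed.

Let lift_pi s : tens_lift b (tens_class aM aN s) = \sum_(p <- s) b p.1 p.2.
Proof. by apply: teq_sum; apply/tens_eqP; rewrite reprK. Qed.

Lemma tens_lift_tensor m n :
  tens_lift b (tensor m n : tens aM aN) = b m n.
Proof. by rewrite lift_pi big_cons big_nil addr0. Qed.

Lemma tens_liftD (x y : tens aM aN) :
  tens_lift b (x + y) = tens_lift b x + tens_lift b y.
Proof.
have [s ->] := tens_classP x; have [t ->] := tens_classP y.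
by rewrite -tens_class_cat !lift_pi big_cat.
Qed.

Lemma tens_lift0 : tens_lift b (0 : tens aM aN) = 0.
Proof. by apply: (addrI (tens_lift b (0 : tens aM aN))); rewrite -tens_liftD !addr0. Qed.

Lemma tens_liftN (x : tens aM aN) : tens_lift b (- x) = - tens_lift b x.
Proof.
by apply: (addrI (tens_lift b x)); rewrite -tens_liftD !subrr tens_lift0.
Qed.

End TensorLift.

Definition tens_map S S' (M N M' N' : zmodType)
    (aM : S -> M -> M) (aN : S -> N -> N)
    (aM' : S' -> M' -> M') (aN' : S' -> N' -> N')
    (u : M -> M') (v : N -> N') : tens aM aN -> tens aM' aN' :=
  tens_lift (fun m n => tensor (u m) (v n)).
Arguments tens_map {S S' M N M' N' aM aN aM' aN'} u v x.

(** R ⊗_S R' for S-algebras given by their structure maps. *)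
Definition scal_by S (R : comPzRingType) (f : S -> R) (s : S) (x : R) : R :=
  f s * x.

Definition talg S (R R' : comPzRingType) (f : S -> R) (g : S -> R') : Type :=
  tens (scal_by f) (scal_by g).

Section TensorAlgebra.
Context (S : Type) (R R' : comPzRingType) (f : S -> R) (g : S -> R').
Local Notation T := (talg f g).
HB.instance Definition _ := GRing.Zmodule.on T.

Let mul1 (x : R) (y : R') : T -> T :=
  tens_lift (fun x' y' => tensor (x * x') (y * y')).

Let mul1P x y : balanced (scal_by f) (scal_by g)
  (fun x' y' => tensor (x * x') (y * y') : T).
Proof.
split=> [m m' n|m n n'|s m n]; rewrite ?mulrDr ?tensorDl ?tensorDr //.
by rewrite /scal_by mulrCA (mulrCA y) -/(scal_by f _ _) tensor_bal.
Qed.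

Definition talg_mul (a b : T) : T := tens_lift (fun x y => mul1 x y b) a.
Definition talg_one : T := tensor 1 1.

Let talg_mulP b : balanced (scal_by f) (scal_by g) (fun x y => mul1 x y b).
Proof.
by split=> [m m' n|m n n'|s m n]; rewrite /mul1; elim/tens_ind: b => [|x y b IH];
  rewrite ?(tens_lift0 (mul1P _ _)) ?addr0 //
    !(tens_liftD (mul1P _ _)) !(tens_lift_tensor (mul1P _ _)) IH;
  rewrite ?mulrDl ?tensorDl ?tensorDr 1?addrACA // /scal_by -!mulrA
    -/(scal_by f _ _) tensor_bal.
Qed.

Lemma talg_mul_tensor x y x' y' :
  talg_mul (tensor x y) (tensor x' y') = tensor (x * x') (y * y').
Proof.
by rewrite /talg_mul (tens_lift_tensor (talg_mulP _)) /mul1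
           (tens_lift_tensor (mul1P _ _)).
Qed.

Fact talg_mulDl : left_distributive talg_mul +%R.
Proof. by move=> a b c; rewrite /talg_mul (tens_liftD (talg_mulP _)). Qed.

Fact talg_mulDr : right_distributive talg_mul +%R.
Proof.
move=> a b c; rewrite /talg_mul [in RHS]/tens_lift -big_split.
by apply: eq_bigr => p _; exact: (tens_liftD (mul1P _ _)).
Qed.

Let mul1C x y b : mul1 x y b = talg_mul b (tensor x y).
Proof.
rewrite /mul1; elim/tens_ind: b => [|x' y' b IH].
  by rewrite (tens_lift0 (mul1P _ _)) /talg_mul (tens_lift0 (talg_mulP _)).
rewrite (tens_liftD (mul1P _ _)) IH talg_mulDl talg_mul_tensor.
by rewrite (tens_lift_tensor (mul1P _ _)) mulrC (mulrC y).
Qed.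

Fact talg_mulC : commutative talg_mul.
Proof.
move=> a b; elim/tens_ind: a => [|x y a IH].
  rewrite {1}/talg_mul (tens_lift0 (talg_mulP _)).
  rewrite /talg_mul /tens_lift big1 // => p _.
  by rewrite -/(tens_lift _ _) /mul1 (tens_lift0 (mul1P _ _)).
rewrite talg_mulDl IH {1}/talg_mul (tens_lift_tensor (talg_mulP _)) mul1C.
by rewrite -talg_mulDr.
Qed.

Fact talg_mulA : associative talg_mul.
Proof.
have mul0 a : talg_mul 0 a = 0 by rewrite /talg_mul (tens_lift0 (talg_mulP _)).
have mulr0 a : talg_mul a 0 = 0 by rewrite talg_mulC mul0.
move=> a b c; elim/tens_ind: a => [|x y a IH]; first by rewrite !mul0.
rewrite !talg_mulDl -IH; congr (_ + _) => {a IH}.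
elim/tens_ind: b => [|x' y' b IH]; first by rewrite !(mulr0, mul0).
rewrite !(talg_mulDl, talg_mulDr) IH; congr (_ + _) => {b IH}.
elim/tens_ind: c => [|x'' y'' c IH]; first by rewrite !mulr0.
by rewrite !talg_mulDr IH !talg_mul_tensor !mulrA.
Qed.

Fact talg_mul1 : left_id talg_one talg_mul.
Proof.
move=> a; elim/tens_ind: a => [|x y a IH].
  by rewrite talg_mulC /talg_mul (tens_lift0 (talg_mulP _)).
rewrite talg_mulC talg_mulDl talg_mul_tensor !mulr1.
by rewrite (talg_mulC a) IH.
Qed.

HB.instance Definition _ := GRing.Zmodule_isComPzRing.Build T
  talg_mulA talg_mulC talg_mul1 talg_mulDl.

Lemma mul_tensor x y x' y' :
  (tensor x y : T) * (tensor x' y' : T) = tensor (x * x') (y * y').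
Proof. exact: talg_mul_tensor. Qed.

Lemma tensorBl x x' y : tensor (x - x') y = (tensor x y : T) - (tensor x' y : T).
Proof. by apply/eqP; rewrite -subr_eq opprK -tensorDl subrK. Qed.

Fact tensor1r_zmod : zmod_morphism (fun x : R => tensor x 1 : T).
Proof. by move=> x x'; exact: tensorBl. Qed.

Fact tensor1r_monoid : monoid_morphism (fun x : R => tensor x 1 : T).
Proof. by split=> // x x'; rewrite mul_tensor mulr1. Qed.

(** The structure map R → R ⊗_S R'. *)
Definition tensl (x : R) : T := tensor x 1.
HB.instance Definition _ := GRing.isZmodMorphism.Build R T tensl tensor1r_zmod.
HB.instance Definition _ :=
  GRing.isMonoidMorphism.Build R T tensl tensor1r_monoid.

End TensorAlgebra.

Section TensorAlgebraMap.
Context (S : Type) (R R' R1 R1' : comPzRingType).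
Context (f : S -> R) (g : S -> R') (f1 : S -> R1) (g1 : S -> R1').
Context (u : {rmorphism R -> R1}) (v : {rmorphism R' -> R1'}).

(** u ⊗ v for morphisms of S-algebras u and v. *)
Definition talg_map of (forall s, u (f s) = f1 s) & (forall s, v (g s) = g1 s) :
  talg f g -> talg f1 g1 := tens_map u v.

Context (uf : forall s, u (f s) = f1 s) (vg : forall s, v (g s) = g1 s).
Local Notation uv := (talg_map uf vg).

Lemma talg_map_balanced : balanced (scal_by f) (scal_by g)
  (fun x y => tensor (u x) (v y) : talg f1 g1).
Proof.
split=> [m m' n|m n n'|s m n]; rewrite ?rmorphD ?tensorDl ?tensorDr //.
by rewrite /scal_by !rmorphM uf vg -/(scal_by f1 _ _) tensor_bal.
Qed.

Lemma talg_map_tensor x y : uv (tensor x y) = tensor (u x) (v y).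
Proof. exact: (tens_lift_tensor talg_map_balanced). Qed.

Fact talg_map_zmod : zmod_morphism uv.
Proof.
by move=> x y; rewrite /talg_map /tens_map (tens_liftD talg_map_balanced)
                       (tens_liftN talg_map_balanced).
Qed.

Fact talg_map_monoid : monoid_morphism uv.
Proof.
have D x y : uv (x + y) = uv x + uv y.
  exact: (tens_liftD talg_map_balanced).
have Z : uv 0 = 0 by exact: (tens_lift0 talg_map_balanced).
split=> [|a b]; first by rewrite talg_map_tensor !rmorph1.
elim/tens_ind: a => [|x y a IH]; first by rewrite mul0r Z mul0r.
rewrite mulrDl !D IH mulrDl; congr (_ + _) => {a IH}.
elim/tens_ind: b => [|x' y' b IH]; first by rewrite mulr0 Z mulr0.
rewrite mulrDr !D IH mulrDr; congr (_ + _).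
by rewrite mul_tensor !talg_map_tensor mul_tensor !rmorphM.
Qed.

HB.instance Definition _ :=
  GRing.isZmodMorphism.Build (talg f g) (talg f1 g1) uv talg_map_zmod.
HB.instance Definition _ :=
  GRing.isMonoidMorphism.Build (talg f g) (talg f1 g1) uv talg_map_monoid.

End TensorAlgebraMap.

(** The extension of scalars R ⊗_S M along f : S → R, an R-module. *)
Definition scext S (R : comPzRingType) (M : zmodType) (f : S -> R)
    (aM : S -> M -> M) : Type := tens (scal_by f) aM.

Section ScalarExtension.
Context (S : Type) (R : comPzRingType) (M : zmodType).
Context (f : S -> R) (aM : S -> M -> M).
Local Notation T := (scext f aM).
HB.instance Definition _ := GRing.Zmodule.on T.

Definition scext_scale (r : R) : T -> T :=
  tens_lift (fun x m => tensor (r * x) m).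

Let scaleP r : balanced (scal_by f) aM (fun x m => tensor (r * x) m : T).
Proof.
split=> [m m' n|m n n'|s m n]; rewrite ?mulrDr ?tensorDl ?tensorDr //.
by rewrite /scal_by mulrCA -/(scal_by f _ _) tensor_bal.
Qed.

Lemma scext_scale_tensor r x m :
  scext_scale r (tensor x m) = tensor (r * x) m.
Proof. exact: (tens_lift_tensor (scaleP r)). Qed.

Let scaleD r (x y : T) :
  scext_scale r (x + y) = scext_scale r x + scext_scale r y.
Proof. exact: (tens_liftD (scaleP r)). Qed.

Let scale0 r : scext_scale r 0 = 0.
Proof. exact: (tens_lift0 (scaleP r)). Qed.

Fact scext_scaleA r s (x : T) :
  scext_scale r (scext_scale s x) = scext_scale (r * s) x.
Proof.
elim/tens_ind: x => [|a m x IH]; first by rewrite !scale0.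
by rewrite !scaleD IH !scext_scale_tensor mulrA.
Qed.

Fact scext_scale1 : left_id 1 scext_scale.
Proof.
elim/tens_ind => [|a m x IH]; first by rewrite scale0.
by rewrite scaleD IH scext_scale_tensor mul1r.
Qed.

Fact scext_scaleDr : right_distributive scext_scale +%R.
Proof. by move=> r x y; rewrite scaleD. Qed.

Fact scext_scaleDl (x : T) : {morph scext_scale^~ x : r s / r + s}.
Proof.
move=> r s; elim/tens_ind: x => [|a m x IH]; first by rewrite !scale0 addr0.
by rewrite !scaleD IH !scext_scale_tensor mulrDl tensorDl addrACA.
Qed.

HB.instance Definition _ := GRing.Zmodule_isLmodule.Build R T
  scext_scaleA scext_scale1 scext_scaleDr scext_scaleDl.

End ScalarExtension.

Definition gen_ideal (A : comPzRingType) (X : set A) : set A :=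
  [set x | exists2 s : seq (A * A),
     (forall p, p \in s -> X p.2) & x = \sum_(p <- s) p.1 * p.2].

(** X^n; for n = 0 this is the unit ideal. *)
Definition ideal_pow (A : comPzRingType) (X : set A) (n : nat) : set A :=
  gen_ideal [set x | exists2 a : 'I_n -> A,
     (forall i, X (a i)) & x = \prod_i a i].

Record prime_ideal (A : comPzRingType) (P : set A) : Prop := PrimeIdeal {
  prime_ideal0 : P 0;
  prime_idealD : forall x y, P x -> P y -> P (x + y);
  prime_idealM : forall a x, P x -> P (a * x);
  prime_ideal1 : ~ P 1;
  prime_ideal_prime : forall x y, P (x * y) -> P x \/ P y }.

(** [quot I] is the quotient of A by the ideal generated by I. *)
Section Quotient.
Context (A : comPzRingType) (I : set A).

Lemma gen_ideal_sub X : X `<=` gen_ideal (A := A) X.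
Proof.
move=> x Xx; exists [:: (1, x)]; last by rewrite big_seq1 mul1r.
by move=> p; rewrite inE => /eqP ->.
Qed.

Lemma gen_ideal0 X : gen_ideal (A := A) X 0.
Proof. by exists [::]; rewrite ?big_nil. Qed.

Lemma gen_idealD X x y :
  gen_ideal X x -> gen_ideal X y -> gen_ideal (A := A) X (x + y).
Proof.
move=> [s sX ->] [t tX ->]; exists (s ++ t); last by rewrite big_cat.
by move=> p; rewrite mem_cat => /orP[/sX|/tX].
Qed.

Lemma gen_idealM X a x : gen_ideal X x -> gen_ideal (A := A) X (a * x).
Proof.
move=> [s sX ->]; exists [seq (a * p.1, p.2) | p <- s].
  by move=> p /mapP[q /sX Xq ->].
by rewrite big_map mulr_sumr; apply: eq_bigr => p _; rewrite mulrA.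
Qed.

Lemma gen_idealN X x : gen_ideal X x -> gen_ideal (A := A) X (- x).
Proof. by move=> /(gen_idealM (-1)); rewrite mulN1r. Qed.

Definition eq_mod (x y : A) := `[< gen_ideal I (x - y) >].

Lemma eq_mod_refl : reflexive eq_mod.
Proof. by move=> x; apply/asboolP; rewrite subrr; exact: gen_ideal0. Qed.

Lemma eq_mod_sym : symmetric eq_mod.
Proof.
by move=> x y; apply/asboolP/asboolP => /gen_idealN; rewrite opprB.
Qed.

Lemma eq_mod_trans : transitive eq_mod.
Proof.
move=> y x z /asboolP xy /asboolP yz; apply/asboolP.
by rewrite -(subrKA y); exact: gen_idealD.
Qed.

Canonical eq_mod_equiv := EquivRel eq_mod eq_mod_refl eq_mod_sym eq_mod_trans.

Definition quot : Type := {eq_quot eq_mod}.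
HB.instance Definition _ := EqQuotient.on quot.
HB.instance Definition _ := Choice.on quot.

Definition quot_pi (x : A) : quot := \pi_({eq_quot eq_mod}) x.

Lemma quot_piP x y : quot_pi x = quot_pi y <-> gen_ideal I (x - y).
Proof.
by split=> [/eqmodP/asboolP|xy]; last by apply/eqmodP/asboolP.
Qed.

Definition quot_repr (x : quot) : A := repr (x : {eq_quot eq_mod}).

Lemma quot_reprK x : quot_pi (quot_repr x) = x.
Proof. exact: reprK. Qed.

Definition quot_add x y := quot_pi (quot_repr x + quot_repr y).
Definition quot_opp x := quot_pi (- quot_repr x).
Definition quot_mul x y := quot_pi (quot_repr x * quot_repr y).

Let repr_pi x : gen_ideal I (quot_repr (quot_pi x) - x).
Proof. by apply/quot_piP; rewrite quot_reprK. Qed.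

Lemma quot_addE x y : quot_add (quot_pi x) (quot_pi y) = quot_pi (x + y).
Proof.
apply/quot_piP; rewrite opprD addrACA.
by apply: gen_idealD; exact: repr_pi.
Qed.

Lemma quot_oppE x : quot_opp (quot_pi x) = quot_pi (- x).
Proof. by apply/quot_piP; rewrite -opprD; apply/gen_idealN/repr_pi. Qed.

Lemma quot_mulE x y : quot_mul (quot_pi x) (quot_pi y) = quot_pi (x * y).
Proof.
apply/quot_piP; set x' := quot_repr _; set y' := quot_repr _.
rewrite (_ : _ - _ = x' * (y' - y) + y * (x' - x)).
  by apply: gen_idealD; apply/gen_idealM/repr_pi.
by rewrite !mulrBr (mulrC y x') addrA subrK (mulrC y).
Qed.

Let quot_ind (P : quot -> Prop) : (forall x, P (quot_pi x)) -> forall x, P x.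
Proof. by move=> H x; rewrite -(quot_reprK x). Qed.

Fact quot_addA : associative quot_add.
Proof.
elim/quot_ind => x; elim/quot_ind => y; elim/quot_ind => z.
by rewrite (quot_addE y z) (quot_addE x y) (quot_addE x) (quot_addE _ z) addrA.
Qed.

Fact quot_addC : commutative quot_add.
Proof. by move=> x y; rewrite /quot_add addrC. Qed.

Fact quot_add0 : left_id (quot_pi 0) quot_add.
Proof. by elim/quot_ind => x; rewrite quot_addE add0r. Qed.

Fact quot_addN : left_inverse (quot_pi 0) quot_opp quot_add.
Proof. by elim/quot_ind => x; rewrite quot_oppE quot_addE addNr. Qed.

HB.instance Definition _ :=
  GRing.isZmodule.Build quot quot_addA quot_addC quot_add0 quot_addN.

Fact quot_mulA : associative quot_mul.
Proof.
elim/quot_ind => x; elim/quot_ind => y; elim/quot_ind => z.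
by rewrite (quot_mulE y z) (quot_mulE x y) (quot_mulE x) (quot_mulE _ z) mulrA.
Qed.

Fact quot_mulC : commutative quot_mul.
Proof. by move=> x y; rewrite /quot_mul mulrC. Qed.

Fact quot_mul1 : left_id (quot_pi 1) quot_mul.
Proof. by elim/quot_ind => x; rewrite quot_mulE mul1r. Qed.

Fact quot_mulDl : left_distributive quot_mul quot_add.
Proof.
elim/quot_ind => x; elim/quot_ind => y; elim/quot_ind => z.
rewrite (quot_addE x y) (quot_mulE x z) (quot_mulE y z) quot_mulE.
by rewrite quot_addE mulrDl.
Qed.

HB.instance Definition _ := GRing.Zmodule_isComPzRing.Build quot
  quot_mulA quot_mulC quot_mul1 quot_mulDl.

Fact quot_pi_zmod : zmod_morphism quot_pi.
Proof. by move=> x y; rewrite -quot_addE -quot_oppE. Qed.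

Fact quot_pi_monoid : monoid_morphism quot_pi.
Proof. by split=> // x y; rewrite -quot_mulE. Qed.

HB.instance Definition _ :=
  GRing.isZmodMorphism.Build A quot quot_pi quot_pi_zmod.
HB.instance Definition _ :=
  GRing.isMonoidMorphism.Build A quot quot_pi quot_pi_monoid.

End Quotient.

Section QuotientTransition.
Context (A : comPzRingType) (I J : set A).

(** The projection A/(I) → A/(J) for I ⊆ J. *)
Definition quot_proj of (I `<=` gen_ideal J) : quot I -> quot J :=
  fun x => quot_pi J (quot_repr x).

Context (IJ : I `<=` gen_ideal J).

Lemma quot_proj_pi x : quot_proj IJ (quot_pi I x) = quot_pi J x.
Proof.
apply/quot_piP; set z := _ - x.
have : gen_ideal I z by apply/quot_piP; rewrite quot_reprK.
case=> s; elim: s z => [|p s IH] z sI ->; first by rewrite big_nil; exact: gen_ideal0.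
rewrite big_cons; apply: gen_idealD; last first.
  by apply: IH => // q qs; apply: sI; rewrite inE qs orbT.
by apply/gen_idealM/IJ/sI; rewrite mem_head.
Qed.

Let quot_ind (P : quot I -> Prop) :
  (forall x, P (quot_pi I x)) -> forall x, P x.
Proof. by move=> H x; rewrite -(quot_reprK x). Qed.

Fact quot_proj_zmod : zmod_morphism (quot_proj IJ).
Proof.
elim/quot_ind => x; elim/quot_ind => y.
by rewrite -rmorphB !quot_proj_pi rmorphB.
Qed.

Fact quot_proj_monoid : monoid_morphism (quot_proj IJ).
Proof.
split; first exact: (quot_proj_pi 1).
elim/quot_ind => x; elim/quot_ind => y.
by rewrite -rmorphM !quot_proj_pi rmorphM.
Qed.

HB.instance Definition _ :=
  GRing.isZmodMorphism.Build (quot I) (quot J) (quot_proj IJ) quot_proj_zmod.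
HB.instance Definition _ := GRing.isMonoidMorphism.Build (quot I) (quot J)
  (quot_proj IJ) quot_proj_monoid.

End QuotientTransition.

Section ProjectiveLimit.
Context (R : nat -> comPzRingType) (f : forall n, {rmorphism R n.+1 -> R n}).

Record plim : Type := PLim {
  plim_coord : forall n, R n;
  plim_compat : forall n, f n (plim_coord n.+1) = plim_coord n }.

Lemma plimP (x y : plim) : (forall n, plim_coord x n = plim_coord y n) -> x = y.
Proof.
case: x y => [x xP] [y yP] /= xy.
have {xy} xy : x = y by exact: functional_extensionality_dep.
by case: _ / xy yP => yP; congr PLim; exact: Prop_irrelevance.
Qed.

HB.instance Definition _ := gen_eqMixin plim.
HB.instance Definition _ := gen_choiceMixin plim.

Definition plim0 : plim := PLim (fun n => rmorph0 (f n)).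
Definition plim1 : plim := PLim (fun n => rmorph1 (f n)).

Definition plim_add (x y : plim) : plim.
Proof.
exists (fun n => plim_coord x n + plim_coord y n) => n.
by rewrite rmorphD !plim_compat.
Defined.

Definition plim_opp (x : plim) : plim.
Proof.
by exists (fun n => - plim_coord x n) => n; rewrite rmorphN plim_compat.
Defined.

Definition plim_mul (x y : plim) : plim.
Proof.
exists (fun n => plim_coord x n * plim_coord y n) => n.
by rewrite rmorphM !plim_compat.
Defined.

Fact plim_addA : associative plim_add.
Proof. by move=> x y z; apply: plimP => n; exact: addrA. Qed.
Fact plim_addC : commutative plim_add.
Proof. by move=> x y; apply: plimP => n; exact: addrC. Qed.
Fact plim_add0 : left_id plim0 plim_add.
Proof. by move=> x; apply: plimP => n; exact: add0r. Qed.
Fact plim_addN : left_inverse plim0 plim_opp plim_add.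
Proof. by move=> x; apply: plimP => n; exact: addNr. Qed.

HB.instance Definition _ :=
  GRing.isZmodule.Build plim plim_addA plim_addC plim_add0 plim_addN.

Fact plim_mulA : associative plim_mul.
Proof. by move=> x y z; apply: plimP => n; exact: mulrA. Qed.
Fact plim_mulC : commutative plim_mul.
Proof. by move=> x y; apply: plimP => n; exact: mulrC. Qed.
Fact plim_mul1 : left_id plim1 plim_mul.
Proof. by move=> x; apply: plimP => n; exact: mul1r. Qed.
Fact plim_mulDl : left_distributive plim_mul plim_add.
Proof. by move=> x y z; apply: plimP => n; exact: mulrDl. Qed.

HB.instance Definition _ := GRing.Zmodule_isComPzRing.Build plim
  plim_mulA plim_mulC plim_mul1 plim_mulDl.

Definition plim_diag S (g : forall n, S -> R n)
    (gf : forall n x, f n (g n.+1 x) = g n x) (x : S) : plim :=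
  PLim (gf^~ x).

End ProjectiveLimit.

Definition plim_map (R R' : nat -> comPzRingType)
    (f : forall n, {rmorphism R n.+1 -> R n})
    (f' : forall n, {rmorphism R' n.+1 -> R' n})
    (g : forall n, R n -> R' n)
    (gf : forall n x, f' n (g n.+1 x) = g n (f n x)) (x : plim f) : plim f'.
Proof.
by exists (fun n => g n (plim_coord x n)) => n; rewrite gf plim_compat.
Defined.

Structure frac_field (S : comPzRingType) := FracField {
  frac_sort :> fieldType;
  to_frac : {rmorphism S -> frac_sort};
  to_frac_inj : injective to_frac;
  to_fracP : forall x, exists a b,
    to_frac b != 0 /\ x = to_frac a / to_frac b }.

Arguments to_frac {S} f.

(** The extension to fractions, a/b ↦ g a/g b, of a map g; it is well defined
    when g is an injective ring morphism. *)
Definition frac_ext (S : comPzRingType) (E E' : fieldType)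
    (i : S -> E) (g : S -> E') (x : E) : E' :=
  let ab := xget (0, 1)
    [set ab : S * S | i ab.2 != 0 /\ x = i ab.1 / i ab.2] in
  g ab.1 / g ab.2.

(** S_(X), the intersection of the local rings S_q over the primes q of S
    containing X, as a subring of Quot(S). *)
Section SemiLocalization.
Context (S : comPzRingType) (Q : frac_field S) (X : set S).

Definition semiloc_pred : {pred Q} := fun x => `[< forall q : set S,
  prime_ideal q -> X `<=` q ->
  exists a s, ~ q s /\ x = to_frac Q a / to_frac Q s >].

Record semiloc : Type := SemiLoc {
  semiloc_val : Q;
  _ : semiloc_val \in semiloc_pred }.

HB.instance Definition _ := [isSub for semiloc_val].
HB.instance Definition _ := [Choice of semiloc by <:].

Fact semiloc_closed : subring_closed semiloc_pred.
Proof.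
have nz q s : prime_ideal q -> ~ q s -> to_frac Q s != 0.
  move=> qP; apply: contra_notN; rewrite -(rmorph0 (to_frac Q)).
  by move=> /eqP/to_frac_inj ->; exact: prime_ideal0.
have stable q s t : prime_ideal q -> ~ q s -> ~ q t -> ~ q (s * t).
  by move=> qP qs qt /(prime_ideal_prime qP)[].
split.
- apply/asboolP => q qP _; exists 1, 1; split; first exact: prime_ideal1.
  by rewrite rmorph1 divr1.
- move=> x y /asboolP xS /asboolP yS; apply/asboolP => q qP Xq.
  have [a [s [qs ->]]] := xS q qP Xq; have [b [t [qt ->]]] := yS q qP Xq.
  exists (a * t - b * s), (s * t); split; first exact: stable.
  by rewrite -mulNr addf_div ?(nz q)// rmorphB !rmorphM mulNr.
- move=> x y /asboolP xS /asboolP yS; apply/asboolP => q qP Xq.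
  have [a [s [qs ->]]] := xS q qP Xq; have [b [t [qt ->]]] := yS q qP Xq.
  exists (a * b), (s * t); split; first exact: stable.
  by rewrite mulf_div !rmorphM.
Qed.

HB.instance Definition _ :=
  GRing.isSubringClosed.Build Q semiloc_pred semiloc_closed.
HB.instance Definition _ := [SubChoice_isSubComNzRing of semiloc by <:].

End SemiLocalization.

Lemma to_semiloc_subproof (S : comPzRingType) (Q : frac_field S) (X : set S) x :
  to_frac Q x \in semiloc_pred X.
Proof.
apply/asboolP => q qP _; exists x, 1; split; first exact: prime_ideal1.
by rewrite rmorph1 divr1.
Qed.

Definition to_semiloc (S : comPzRingType) (Q : frac_field S) (X : set S)
    (x : S) : semiloc Q X :=
  SemiLoc (to_semiloc_subproof Q X x).

(** The extension to Quot(S) of an endomorphism tau of S, and its restriction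
    to S_(X), which tau preserves as soon as tau X ⊆ X. *)
Definition frac_endo (S : comPzRingType) (Q : frac_field S) (tau : S -> S) :
  Q -> Q := frac_ext (to_frac Q) (to_frac Q \o tau).

Definition semiloc_endo (S : comPzRingType) (Q : frac_field S) (X : set S)
    (tau : S -> S) (x : semiloc Q X) : semiloc Q X :=
  insubd 0 (frac_endo tau (semiloc_val x)).

Section FractionLemmas.
Context (S : comPzRingType).

Lemma frac_extE (E E' : fieldType) (i : {rmorphism S -> E})
    (g : {rmorphism S -> E'}) a b :
  injective i -> injective g -> i b != 0 ->
  frac_ext i g (i a / i b) = g a / g b.
Proof.
move=> i_inj g_inj ib; rewrite /frac_ext.
case: xgetP => [[c d] _ /= [id e]|/(_ (a, b))/=]; last by case.
have nz x : i x != 0 -> g x != 0.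
  by apply: contra_neq; rewrite -(rmorph0 g) => /g_inj ->; rewrite rmorph0.
have cb : c * b = a * d.
  by apply: i_inj; apply/eqP; rewrite !rmorphM -eqr_div// -e.
by apply/eqP; rewrite eqr_div ?nz// -!rmorphM cb.
Qed.

Lemma semiloc_endoE (Q : frac_field S) (X : set S) (tau : {rmorphism S -> S})
    (x : semiloc Q X) :
  injective tau -> (forall t, X t -> X (tau t)) ->
  semiloc_val (semiloc_endo tau x) = frac_endo tau (semiloc_val x).
Proof.
move=> tau_inj tauX; rewrite /semiloc_endo -[LHS]/(val _) insubdK //.
apply/asboolP => q qP Xq; case: x => x /= /asboolP/(_ (tau @^-1` q))[].
- split=> /= [|y z|a y|/=|y z]; rewrite ?rmorph0 ?rmorphD ?rmorphM ?rmorph1.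
  + exact: prime_ideal0.
  + exact: prime_idealD.
  + exact: prime_idealM.
  + exact: prime_ideal1.
  + exact: prime_ideal_prime.
- by move=> t /tauX /Xq.
move=> a [s [/= qs ->]]; exists (tau a), (tau s); split=> //.
rewrite /frac_endo (frac_extE (g := to_frac Q \o tau)) //=.
- exact: to_frac_inj.
- by move=> y z /= /to_frac_inj /tau_inj.
apply: contra_notN qs; rewrite -(rmorph0 (to_frac Q)) => /eqP/to_frac_inj ->.
by rewrite rmorph0; exact: prime_ideal0.
Qed.

End FractionLemmas.

Definition is_basis (R : comPzRingType) (V : lmodType R) (r : nat)
    (b : 'I_r -> V) : Prop :=
  forall v, exists! c : 'rV[R]_r, v = \sum_i c 0 i *: b i.

Definition free_fg (R : comPzRingType) (V : lmodType R) : Prop :=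
  exists r (b : 'I_r -> V), is_basis b.

Definition mx_inverse (R : pzRingType) (r : nat) (X Y : 'M[R]_r) : Prop :=
  X *m Y = 1%:M /\ Y *m X = 1%:M.

(** The smooth projective geometrically irreducible curve C over F is given by
    its function field K, and its closed points by the valuation rings of K
    over F; F being perfect, geometric irreducibility means that F is
    algebraically closed in K. The point Oinf being the point at infinity, A
    is the ring of functions regular at all other points. *)

Section Curve.
Context (F : finFieldType) (K : fieldType) (iF : {rmorphism F -> K}).

Record function_field : Prop := FunctionField {
  function_field_fin : exists2 t : K, ~ algebraicOver iF t &
    exists n (b : 'I_n -> K), forall x : K,
    exists (g : {poly F}) (c : 'I_n -> {poly F}), g != 0 /\
      (map_poly iF g).[t] * x = \sum_i (map_poly iF (c i)).[t] * b i;
  function_field_const : forall x, algebraicOver iF x -> exists c, x = iF c }.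

Record closed_point (O : set K) : Prop := ClosedPoint {
  closed_point_const : forall c, O (iF c);
  closed_pointB : forall x y, O x -> O y -> O (x - y);
  closed_pointM : forall x y, O x -> O y -> O (x * y);
  closed_point_proper : O <> setT;
  closed_point_val : forall x, O x \/ O x^-1 }.

Context (Oinf : set K).

Definition ringA_pred : {pred K} :=
  fun x => `[< forall O, closed_point O -> O <> Oinf -> O x >].

Record ringA : Type := RingA { ringA_val : K; _ : ringA_val \in ringA_pred }.

HB.instance Definition _ := [isSub for ringA_val].
HB.instance Definition _ := [Choice of ringA by <:].

Fact ringA_closed : subring_closed ringA_pred.
Proof.
split.
- by apply/asboolP => O OP _; rewrite -(rmorph1 iF); exact: closed_point_const.
- move=> x y /asboolP xA /asboolP yA; apply/asboolP => O OP OO.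
  by apply: closed_pointB OP _ _ (xA O OP OO) (yA O OP OO).
- move=> x y /asboolP xA /asboolP yA; apply/asboolP => O OP OO.
  by apply: closed_pointM OP _ _ (xA O OP OO) (yA O OP OO).
Qed.

HB.instance Definition _ :=
  GRing.isSubringClosed.Build K ringA_pred ringA_closed.
HB.instance Definition _ := [SubChoice_isSubComNzRing of ringA by <:].

Fact constA_subproof c : iF c \in ringA_pred.
Proof. by apply/asboolP => O OP _; exact: closed_point_const. Qed.

Definition constA (c : F) : ringA := RingA (constA_subproof c).

(** A ⊗ E for an F-algebra E, with τ(a ⊗ x) = a ⊗ x^q. *)
Definition tensA (E : comPzRingType) (iE : F -> E) : Type := talg constA iE.

HB.instance Definition _ (E : comPzRingType) (iE : F -> E) :=
  GRing.ComPzRing.on (tensA iE).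

Definition tensA_tau (E : comPzRingType) (iE : F -> E) :
  tensA iE -> tensA iE := tens_map id (fun x => x ^+ #|F|).

Definition ideal_tensA (E : comPzRingType) (iE : F -> E) (p : set ringA) :
  set (tensA iE) := [set tensor a 1 | a in p].

Definition tensA_map (E E' : comPzRingType) (iE : F -> E) (iE' : F -> E')
    (u : {rmorphism E -> E'}) (uE : forall c, u (iE c) = iE' c) :
    tensA iE -> tensA iE' :=
  talg_map (f := constA) (f1 := constA) (u := idfun) (fun _ => erefl) uE.

Section PadicCompletion.
Context (p : set ringA).

Definition residue n : Type := quot (ideal_pow p n.+1).
HB.instance Definition _ n := GRing.ComPzRing.on (residue n).

Lemma ideal_powS n : ideal_pow p n.+1 `<=` gen_ideal (ideal_pow p n).
Proof.
move=> x [s sP ->]; elim: s sP => [|[a y] s IH] sP.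
  by rewrite big_nil; exact: gen_ideal0.
rewrite big_cons; apply: gen_idealD; last first.
  by apply: IH => t ts; apply: sP; rewrite inE ts orbT.
have [b bp /= ->] := sP _ (mem_head _ _).
rewrite big_ord_recl; do 2!apply: gen_idealM.
apply/gen_ideal_sub/gen_ideal_sub; exists (b \o lift ord0) => //.
by move=> i; exact: bp.
Qed.

Definition residue_proj n : residue n.+1 -> residue n :=
  quot_proj (@ideal_powS n.+1).
HB.instance Definition _ n := GRing.RMorphism.on (@residue_proj n).

Definition padicA : Type := plim (fun n => @residue_proj n).
HB.instance Definition _ := GRing.ComPzRing.on padicA.

Definition to_padicA : ringA -> padicA :=
  plim_diag (f := fun n => @residue_proj n)
    (fun n x => quot_proj_pi (@ideal_powS n.+1) x).

Section Coefficients.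
Context (E : comPzRingType) (iE : F -> E).

Definition residue_const n (c : F) : residue n :=
  quot_pi (ideal_pow p n.+1) (constA c).

Definition residueT n : Type := talg (@residue_const n) iE.
HB.instance Definition _ n := GRing.ComPzRing.on (residueT n).

Definition residueT_proj n : residueT n.+1 -> residueT n :=
  talg_map (u := @residue_proj n) (v := idfun)
    (fun c => quot_proj_pi (@ideal_powS n.+1) (constA c)) (fun c => erefl).
HB.instance Definition _ n := GRing.RMorphism.on (@residueT_proj n).

Definition padicT : Type := plim (fun n => @residueT_proj n).
HB.instance Definition _ := GRing.ComPzRing.on padicT.

Definition to_residueT n : tensA iE -> residueT n :=
  talg_map (f := constA) (g := iE) (f1 := @residue_const n) (g1 := iE)
    (u := quot_pi (ideal_pow p n.+1)) (v := idfun)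
    (fun c => erefl) (fun c => erefl).
HB.instance Definition _ n := GRing.RMorphism.on (@to_residueT n).

Lemma to_residueT_compat n x :
  @residueT_proj n (to_residueT n.+1 x) = to_residueT n x.
Proof.
elim/tens_ind: x => [|a y x IH]; first by rewrite !rmorph0.
rewrite !rmorphD; congr (_ + _); last exact: IH.
rewrite [LHS](_ : _ = residueT_proj (to_residueT n.+1 (tensor a y))) //.
rewrite [RHS](_ : _ = to_residueT n (tensor a y)) //.
rewrite /residueT_proj /to_residueT !talg_map_tensor /=.
by rewrite /residue_proj quot_proj_pi.
Qed.

(** The canonical maps from A ⊗ E and from A_p to (A ⊗ E)_p. *)
Definition tensA_to_padicT : tensA iE -> padicT :=
  plim_diag (f := fun n => @residueT_proj n) to_residueT_compat.

Lemma padicA_to_padicT_compat n (x : residue n.+1) :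
  @residueT_proj n (tensl _ _ x) = tensl _ _ (@residue_proj n x).
Proof. exact: talg_map_tensor. Qed.

Definition padicA_to_padicT : padicA -> padicT :=
  plim_map (f := fun n => @residue_proj n) (f' := fun n => @residueT_proj n)
    (g := fun n => @tensl _ _ _ (@residue_const n) iE)
    padicA_to_padicT_compat.

End Coefficients.

(** The map (A ⊗ E)_p → (A ⊗ E')_p induced by an F-algebra morphism u. *)
Section CoefficientMap.
Context (E E' : comPzRingType) (iE : F -> E) (iE' : F -> E').
Context (u : {rmorphism E -> E'}).

Definition residueT_map (uE : forall c, u (iE c) = iE' c) n :
    residueT iE n -> residueT iE' n :=
  talg_map (u := idfun) (v := u) (fun c => erefl) uE.
HB.instance Definition _ (uE : forall c, u (iE c) = iE' c) n :=
  GRing.RMorphism.on (@residueT_map uE n).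

Context (uE : forall c, u (iE c) = iE' c).

Lemma residueT_map_compat n (x : residueT iE n.+1) :
  @residueT_proj _ iE' n (residueT_map uE x) =
  residueT_map uE (residueT_proj x).
Proof.
elim/tens_ind: x => [|a y x IH]; first by rewrite !rmorph0.
rewrite !rmorphD; congr (_ + _); last exact: IH.
rewrite [LHS](_ : _ = residueT_proj (residueT_map uE (tensor a y))) //.
rewrite [RHS](_ : _ = residueT_map uE (residueT_proj (tensor a y))) //.
by rewrite /residueT_map /residueT_proj !talg_map_tensor.
Qed.

Definition padicT_map : padicT iE -> padicT iE' :=
  plim_map (f := fun n => @residueT_proj E iE n)
    (f' := fun n => @residueT_proj E' iE' n)
    (g := @residueT_map uE) residueT_map_compat.

End CoefficientMap.
End PadicCompletion.
End Curve.

Arguments ringA {F K} iF Oinf.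
Arguments constA {F K iF Oinf} c.
Arguments tensA {F K} iF Oinf {E} iE.
Arguments tensA_tau {F K iF Oinf E iE} x.
Arguments tensA_map {F K iF Oinf E E' iE iE' u} uE x.
Arguments ideal_tensA {F K iF Oinf E} iE p.
Arguments padicT {F K iF Oinf} p {E} iE.
Arguments to_padicA {F K iF Oinf} p x.
Arguments tensA_to_padicT {F K iF Oinf} p {E iE} x.
Arguments padicA_to_padicT {F K iF Oinf p E} iE x.
Arguments padicT_map {F K iF Oinf} p {E E' iE iE' u} uE x.

Section Norm.
Context (R : realType) (V : zmodType) (N : V -> R).

Definition norm_cvg (u : nat -> V) (l : V) : Prop :=
  N (u n - l) @[n --> \oo] --> (0 : R).

Definition norm_cauchy (u : nat -> V) : Prop :=
  forall e, 0 < e -> exists n0, forall m n, (n0 <= m)%N -> (n0 <= n)%N ->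
    N (u m - u n) < e.

Definition norm_complete : Prop :=
  forall u, norm_cauchy u -> exists l, norm_cvg u l.

Definition norm_dense (D : set V) : Prop :=
  forall x e, 0 < e -> exists2 y, D y & N (x - y) < e.

End Norm.

(** [is_Cinf iC Oinf abs]: the field C with absolute value abs is the
    completion of the algebraic closure of K in C at a place above Oinf. *)
Record is_Cinf (R : realType) (K C : fieldType) (iC : K -> C) (Oinf : set K)
    (abs : C -> R) : Prop := IsCinf {
  Cinf_abs_ge0 : forall x, 0 <= abs x;
  Cinf_abs0 : forall x, abs x = 0 <-> x = 0;
  Cinf_absM : forall x y, abs (x * y) = abs x * abs y;
  Cinf_absD : forall x y, abs (x + y) <= Num.max (abs x) (abs y);
  Cinf_above : forall x, abs (iC x) <= 1 <-> Oinf x;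
  Cinf_splits : forall P : {poly K}, exists (c : C) (s : seq C),
    map_poly iC P = c *: \prod_(z <- s) ('X - z%:P);
  Cinf_dense : norm_dense abs [set x | algebraicOver iC x];
  Cinf_complete : norm_complete abs }.

Structure sep_closure (L C : fieldType) (iLC : {rmorphism L -> C}) :=
  SepClosure {
  sep_sort :> fieldType;
  sep_in : {rmorphism L -> sep_sort};
  sep_out : {rmorphism sep_sort -> C};
  sep_comp : forall x, sep_out (sep_in x) = iLC x;
  sep_image : forall y, (exists x, y = sep_out x) <->
    exists2 P : {poly L}, separable_poly P & root (map_poly iLC P) y }.

Structure galois_group (L C : fieldType) (iLC : {rmorphism L -> C})
    (Ls : sep_closure iLC) := GaloisElement {
  gal_fun :> {rmorphism Ls -> Ls};
  gal_bij : bijective gal_fun;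
  gal_fix : forall x, gal_fun (sep_in Ls x) = sep_in Ls x }.

(** L{τ} = End_F(G_a), with Σ c_i τ^i encoded by the polynomial with
    coefficients c_i and composition given by τ c = c^q τ. *)
Definition tw_mul (L : fieldType) (q : nat) (P P' : {poly L}) : {poly L} :=
  \sum_(i < size P) \sum_(j < size P')
    (P`_i * P'`_j ^+ (q ^ i)) *: 'X^(i + j).

Definition tw_mulmx (L : fieldType) (q m n k : nat)
    (X : 'M[{poly L}]_(m, n)) (Y : 'M[{poly L}]_(n, k)) : 'M[{poly L}]_(m, k) :=
  \matrix_(i, j) \sum_h tw_mul q (X i h) (Y h j).

Definition tw_app (L C : fieldType) (iLC : L -> C) (q m n : nat)
    (X : 'M[{poly L}]_(m, n)) (x : 'cV[C]_n) : 'cV[C]_m :=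
  \col_i \sum_j \sum_(h < size (X i j)) iLC (X i j)`_h * x j 0 ^+ (q ^ h).

(** The differential, i.e. the coefficient of τ^0. *)
Definition tw_lie (L : fieldType) (m n : nat) (X : 'M[{poly L}]_(m, n)) :
  'M[L]_(m, n) := map_mx (fun P : {poly L} => P`_0) X.

Section Anderson.
Context (F : finFieldType) (K : fieldType) (iF : {rmorphism F -> K}).
Context (Oinf : set K) (L : fieldType) (ell : {rmorphism K -> L}).
Local Notation A := (ringA iF Oinf).
Local Notation q := #|F|.

(** An Anderson A-module on E = G_a^d, Hom(G_a^n, G_a^m) being the m × n
    matrices over L{τ}. *)
Structure anderson_module := AndersonModule {
  anderson_dim : nat;
  anderson_phi : A -> 'M[{poly L}]_anderson_dim;
  anderson_phiD : forall a b,
    anderson_phi (a + b) = anderson_phi a + anderson_phi b;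
  anderson_phi1 : anderson_phi 1 = 1%:M;
  anderson_phiM : forall a b,
    anderson_phi (a * b) = tw_mulmx q (anderson_phi a) (anderson_phi b);
  anderson_nilp : forall a, exists n,
    (tw_lie (anderson_phi a) - (ell (ringA_val a))%:M) ^+ n = 0 }.

Context (E : anderson_module).
Local Notation d := (anderson_dim E).

(** The exponential is the everywhere convergent F-linear power series
    Σ e_i τ^i with linear term e_0 = id that intertwines dφ and φ. *)
Definition is_exponential (R : realType) (C : fieldType) (abs : C -> R)
    (iLC : L -> C) (ex : 'cV[C]_d -> 'cV[C]_d) : Prop :=
  (exists e : nat -> 'M[C]_d, e 0 = 1%:M /\
     forall x j, norm_cvg abs
       (fun n => \sum_(i < n) (e i *m map_mx (fun z => z ^+ (q ^ i)) x) j 0)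
       (ex x j 0)) /\
  forall a x, tw_app iLC q (anderson_phi E a) (ex x) =
              ex (map_mx iLC (tw_lie (anderson_phi E a)) *m x).

Definition uniformizable (R : realType) (C : fieldType) (abs : C -> R)
    (iLC : L -> C) : Prop :=
  exists2 ex, is_exponential abs iLC ex & forall y, exists x, ex x = y.

Local Notation iL := (ell \o iF).
Local Notation AL := (tensA iF Oinf iL).

(** The motive Hom(E, G_a), with its action of A ⊗ L and its τ. *)
Definition motive : zmodType := 'rV[{poly L}]_d.

Definition motive_act (t : AL) (m : motive) : motive :=
  tens_lift (fun (a : A) (l : L) =>
    map_mx (fun P : {poly L} => l *: P) (tw_mulmx q m (anderson_phi E a))) t.

Definition motive_tau (m : motive) : motive := map_mx (tw_mul q 'X) m.

Definition motive_rank (Q : frac_field AL) (r : nat) : Prop :=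
  exists b : 'I_r -> scext (to_frac Q) motive_act, is_basis b.

(** The localization M_(p) = (A ⊗ L)_(p) ⊗_{A ⊗ L} M, with τ = τ ⊗ τ. *)
Section Localization.
Context (Q : frac_field AL) (p : set A).
Local Notation Sp := (semiloc Q (ideal_tensA iL p)).

Definition motive_loc : Type :=
  scext (to_semiloc Q (ideal_tensA iL p)) motive_act.
HB.instance Definition _ := GRing.Lmodule.on motive_loc.

Definition motive_loc_tau : motive_loc -> motive_loc :=
  tens_map (semiloc_endo tensA_tau) motive_tau.

End Localization.
End Anderson.

Section Tate.
Context (R : realType) (F : finFieldType) (K : fieldType).
Context (iF : {rmorphism F -> K}) (Oinf : set K).
Context (C : fieldType) (iC : F -> C) (abs : C -> R).
Local Notation A := (ringA iF Oinf).
Local Notation AC := (tensA iF Oinf iC).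

Definition lin_indep n (a : 'I_n -> A) : Prop :=
  forall c : 'I_n -> F, \sum_i constA (c i) * a i = 0 ->
  forall i, c i = 0.

Structure gauss_completion := GaussCompletion {
  gauss_sort :> comPzRingType;
  gauss_norm : gauss_sort -> R;
  to_gauss : {rmorphism AC -> gauss_sort};
  gauss_tau : {rmorphism gauss_sort -> gauss_sort};
  gauss_norm0 : forall x, gauss_norm x = 0 -> x = 0;
  gauss_normD : forall x y,
    gauss_norm (x + y) <= Num.max (gauss_norm x) (gauss_norm y);
  gauss_normN : forall x, gauss_norm (- x) = gauss_norm x;
  gauss_normM : forall x y,
    gauss_norm (x * y) <= gauss_norm x * gauss_norm y;
  gauss_normE : forall n (a : 'I_n -> A) (c : 'I_n -> C), lin_indep a ->
    gauss_norm (to_gauss (\sum_i tensor (a i) (c i))) =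
    \big[Num.max/0]_i abs (c i);
  gauss_dense : norm_dense gauss_norm (range to_gauss);
  gauss_complete : norm_complete gauss_norm;
  gauss_tauE : forall f, gauss_tau (to_gauss f) = to_gauss (tensA_tau f);
  gauss_tau_cont : forall u x, norm_cvg gauss_norm u x ->
    norm_cvg gauss_norm (gauss_tau \o u) (gauss_tau x) }.

End Tate.

Section DifferenceGalois.
Context (K Q LL : fieldType) (iKQ : K -> Q) (iQ : Q -> LL) (tau : LL -> LL).
Context (r : nat) (Psi : 'M[LL]_r).

(** P = Q[Psi, det(Psi)^-1], the smallest subring of LL containing Q, the
    entries of Psi and det(Psi)^-1. *)
Definition pv_pred : {pred LL} := fun x => `[< forall B : set LL,
  B 1 -> (forall y z, B y -> B z -> B (y - z)) ->
  (forall y z, B y -> B z -> B (y * z)) ->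
  (forall y, B (iQ y)) -> (forall i j, B (Psi i j)) -> B (\det Psi)^-1 ->
  B x >].

Record pv_ring : Type := PVRing { pv_val : LL; _ : pv_val \in pv_pred }.

HB.instance Definition _ := [isSub for pv_val].
HB.instance Definition _ := [Choice of pv_ring by <:].

Fact pv_closed : subring_closed pv_pred.
Proof.
split.
- by apply/asboolP.
- move=> x y /asboolP xP /asboolP yP; apply/asboolP => B B1 BB BM BQ BPsi Bdet.
  by apply: (BB); [exact: xP | exact: yP].
- move=> x y /asboolP xP /asboolP yP; apply/asboolP => B B1 BB BM BQ BPsi Bdet.
  by apply: (BM); [exact: xP | exact: yP].
Qed.

HB.instance Definition _ :=
  GRing.isSubringClosed.Build LL pv_pred pv_closed.
HB.instance Definition _ := [SubChoice_isSubComNzRing of pv_ring by <:].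

Fact pv_of_base_subproof y : iQ y \in pv_pred.
Proof. by apply/asboolP. Qed.
Fact pv_mx_subproof i j : Psi i j \in pv_pred.
Proof. by apply/asboolP. Qed.

Definition pv_of_base (y : Q) : pv_ring := PVRing (pv_of_base_subproof y).
Definition pv_mx : 'M[pv_ring]_r := \matrix_(i, j) PVRing (pv_mx_subproof i j).

(** The restriction of tau, which maps P to itself when tau is a ring morphism,
    tau Q ⊆ Q and tau(Psi) = Theta Psi with Theta in GL_r(Q). *)
Definition pv_tau (x : pv_ring) : pv_ring := insubd 0 (tau (pv_val x)).

(** C ∈ Γ_Psi(B), for a K-algebra B with structure map iB. *)
Section Points.
Context (B : comPzRingType) (iB : K -> B).
Local Notation PB := (talg (pv_of_base \o iKQ) iB).

Definition in_difference_galois_group (C : 'M[B]_r) : Prop :=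
  (exists C', mx_inverse C C') /\
  exists alpha : {rmorphism PB -> PB},
    [/\ bijective alpha,
        forall y b, alpha (tensor (pv_of_base y) b) = tensor (pv_of_base y) b,
        forall x, alpha (tens_map pv_tau id x) =
                  (tens_map pv_tau id (alpha x) : PB) &
        map_mx (fun x => alpha (tensor x 1)) pv_mx =
        map_mx (fun x => tensor x 1 : PB) pv_mx *m
        map_mx (fun b => tensor 1 b : PB) C ].

End Points.
End DifferenceGalois.

Section Trivialization.
Context (R : realType) (F : finFieldType) (K : fieldType).
Context (iF : {rmorphism F -> K}) (Oinf : set K).
Context (L C : fieldType) (ell : {rmorphism K -> L}) (iLC : {rmorphism L -> C}).
Context (abs : C -> R).
Local Notation A := (ringA iF Oinf).
Local Notation iL := (ell \o iF).
Local Notation iC := (iLC \o iL).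
Context (Q : frac_field (tensA iF Oinf iL)).
Context (T : gauss_completion iF Oinf iC abs) (LL : frac_field T).

(** The inclusion Quot(A ⊗ L) → Quot(T). *)
Definition frac_tate : Q -> LL :=
  frac_ext (to_frac Q)
    (fun t => to_frac LL (to_gauss T (tensA_map (u := iLC) (fun _ => erefl) t))).

(** The inclusion K = Frac(A) → Quot(A ⊗ L). *)
Definition const_frac : K -> Q :=
  frac_ext (@ringA_val _ _ iF Oinf) (fun a => to_frac Q (tensor a 1)).

Context (p : set A).

Definition tate_loc : Type := semiloc LL (to_gauss T @` ideal_tensA iC p).
HB.instance Definition _ := GRing.ComNzRing.on tate_loc.

Definition tate_loc_tau : tate_loc -> tate_loc := semiloc_endo (gauss_tau T).

(** The inclusion of (A ⊗ L)_(p) in T_(p). *)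
Definition semiloc_tate (x : semiloc Q (ideal_tensA iL p)) : tate_loc :=
  insubd 0 (frac_tate (semiloc_val x)).

(** The natural embedding of T_(p) in (A ⊗ C)_p. It is the only ring morphism
    compatible with A ⊗ C, because T = A ⊗ C + p^n T for all n. *)
Definition natural_embedding (iota : tate_loc -> padicT p iC) : Prop :=
  injective iota /\ forall t : tensA iF Oinf iC,
    iota (to_semiloc LL _ (to_gauss T t)) = tensA_to_padicT p t.

(** τ(Y m) = Y m in T_(p) ⊗ M, for the basis m of M_(p). *)
Definition rigid_trivialization (E : anderson_module iF Oinf ell) (r : nat)
    (m : 'I_r -> motive_loc E Q p) (Y : 'M[tate_loc]_r) : Prop :=
  forall i,
    let Ym : scext semiloc_tate (fun x (v : motive_loc E Q p) => x *: v) :=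
      \sum_j tensor (Y i j) (m j) in
    tens_map tate_loc_tau (@motive_loc_tau _ _ _ _ _ _ E Q p) Ym = Ym.

Context (Ls : sep_closure iLC).
Local Notation iLs := (sep_in Ls \o iL).

Definition padic_sep_incl : padicT p iLs -> padicT p iC :=
  padicT_map p (u := sep_out Ls) (fun c => sep_comp Ls (iL c)).

Definition padic_gal (gamma : galois_group Ls) : padicT p iLs -> padicT p iLs :=
  padicT_map p (u := gamma) (fun c => gal_fix gamma (iL c)).

(** The inclusion K = Frac(A) → K_p = Quot(A_p). *)
Definition const_padic (Kp : frac_field (padicA p)) : K -> Kp :=
  frac_ext (@ringA_val _ _ iF Oinf) (fun a => to_frac Kp (to_padicA p a)).

End Trivialization.

Arguments frac_tate {R F K iF Oinf L C ell iLC abs} Q {T} LL x.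
Arguments padic_sep_incl {F K iF Oinf L C ell iLC} p Ls x.
Arguments semiloc_val {S Q X} s.

(* Main.v *)
Require Import Defs.
From HB Require Import structures.
From mathcomp Require Import all_boot all_order all_algebra all_field.
From mathcomp Require Import boolp classical_sets reals topology normedtype.
From mathcomp Require Import zify ring.
Set Implicit Arguments.
Unset Strict Implicit.
Unset Printing Implicit Defensive.
Import Order.TTheory GRing.Theory Num.Theory.
Import numFieldNormedType.Exports.
Local Open Scope ring_scope.
Local Open Scope classical_set_scope.

(** The entries of Upsilon are fixed by a tau-semilinear system with
    coefficients in A ⊗ L.  Modulo p^n this becomes z = z^(q) B over L, in
    finitely many unknowns; Frobenius preserving linear independence, its
    solutions are separable over L, so gamma acts on Upsilon.  Both Upsilon and
    gamma(Upsilon) solve the system, hence D = Upsilon gamma(Upsilon)^-1 is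
    fixed by Frobenius and has entries in A_p.

    Since gamma(Psi) = Psi D and gamma fixes A ⊗ L, every relation over
    Quot(A ⊗ L) between the entries of Psi also holds for Psi D in (A ⊗ C)_p.
    To lift it to P ⊗ K_p one needs elements of A_p that are independent over A
    to stay independent over the Tate algebra T.  A relation over T, scaled to
    norm 1, is reduced to A by an F-linear functional C -> F that kills all
    small elements; this commutes with reduction modulo p^n because, A/aA being
    finite over F, T = A ⊗ C + aT with control of norms. *)

(** * Maximal subgroups, fractions and semilocalizations *)

Section MaximalSubgroup.
Context (I : Type) (V : zmodType) (act : I -> V -> V).

Definition stable_subgroup (W : set V) :=
  [/\ W 0, forall x y, W x -> W y -> W (x - y) &
      forall i x, W x -> W (act i x)].

Lemma maximal_avoiding (W : set V) (v : V) : stable_subgroup W -> ~ W v ->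
  exists H : set V, [/\ stable_subgroup H, W `<=` H, ~ H v &
    forall H' : set V, stable_subgroup H' -> H `<=` H' -> ~ H' v -> H' `<=` H].
Proof.
move=> sW nWv.
pose good X := [/\ stable_subgroup X, W `<=` X & ~ X v].
pose P (X : set V) := X = set0 \/ good X.
have [X [PX maxX]] : exists A, P A /\ forall B, A `<` B -> ~ P B.
  apply: (@Zorn_bigcup _ P) => Fam FP Ftot.
  have [[X [FX gX]]|none] := pselect (exists X, Fam X /\ good X); last first.
    left; rewrite -subset0 => x [Y FY Yx].
    by case: (FP _ FY) => [Y0|gY]; [rewrite Y0 in Yx|case: none; exists Y].
  have up Y : Fam Y -> exists Z, [/\ Fam Z, good Z & Y `<=` Z].
    move=> FY; case: (FP _ FY) => [->|gY]; last by exists Y; split=> // ?.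
    by exists X; split=> // ?.
  right; split.
  - split.
    + by case: gX => [[X0 _ _] _ _]; exists X.
    + move=> x y [Y1 FY1 Yx] [Y2 FY2 Yy].
      have [Z1 [FZ1 [[Z10 Z1B Z1a] _ _] s1]] := up _ FY1.
      have [Z2 [FZ2 [[Z20 Z2B Z2a] _ _] s2]] := up _ FY2.
      have [s12|s21] := Ftot _ _ FZ1 FZ2.
        by exists Z2 => //; apply: Z2B; [apply/s12/s1|apply: s2].
      by exists Z1 => //; apply: Z1B; [apply: s1|apply/s21/s2].
    + move=> i x [Y FY Yx]; have [Z [FZ [[_ _ Za] _ _] s]] := up _ FY.
      by exists Z => //; apply/Za/s.
  - by move=> w Ww; exists X => //; case: gX => _ + _; apply.
  - move=> [Y FY Yv]; have [Z [FZ [_ _ nZv] s]] := up _ FY.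
    by apply/nZv/s.
have gW : good W by split.
have gX : good X.
  case: PX => // X0; exfalso; apply: (maxX W); last by right.
  by rewrite X0; split=> // /(_ 0); case: sW => W0 _ _ /(_ W0).
case: gX => sX WX nXv; exists X; split=> // H' sH' XH' nH'v.
apply: contrapT => nH'X; apply: (maxX H').
  by split.
by right; split=> //; apply: subset_trans XH'.
Qed.

Lemma stable_subgroupD H x y : stable_subgroup H -> H x -> H y -> H (x + y).
Proof.
by case=> H0 HB _ Hx Hy; rewrite -[y]opprK -[- y]sub0r; apply: (HB) => //; apply: HB.
Qed.

End MaximalSubgroup.

Lemma separating_functional (F : fieldType) (C : comPzRingType)
    (iC : {rmorphism F -> C}) (W : set C) (v : C) :
  stable_subgroup (fun f x => iC f * x) W -> ~ W v ->
  exists lam : C -> F, [/\ forall x y, lam (x + y) = lam x + lam y,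
    forall f x, lam (iC f * x) = f * lam x,
    forall x, W x -> lam x = 0 & lam v = 1].
Proof.
move=> sW nWv; have [H [sH WH nHv maxH]] := maximal_avoiding sW nWv.
have HD x y := stable_subgroupD sH (x := x) (y := y).
case: (sH) => H0 HB Hs.
have uniq_coef x f g : H (x - iC f * v) -> H (x - iC g * v) -> f = g.
  move=> Hf Hg; have := HB _ _ Hf Hg.
  rewrite opprB addrC subrKA -mulrBl -rmorphB => Hd.
  apply/eqP; rewrite eq_sym -subr_eq0; apply: contra_notT nHv => nz.
  by have := Hs (g - f)^-1 _ Hd; rewrite mulrA -rmorphM mulVf ?rmorph1 ?mul1r.
have ex x : exists f, H (x - iC f * v).
  have [Hx|nHx] := pselect (H x); first by exists 0; rewrite rmorph0 mul0r subr0.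
  pose H' := [set z | exists h g, H h /\ z = h + iC g * x].
  have sH' : stable_subgroup (fun f x => iC f * x) H'.
    split.
    - by exists 0, 0; rewrite rmorph0 mul0r addr0.
    - move=> _ _ [h [g [Hh ->]]] [h' [g' [Hh' ->]]].
      exists (h - h'), (g - g'); split; first exact: HB.
      by rewrite rmorphB mulrBl opprD addrACA.
    - move=> f _ [h [g [Hh ->]]]; exists (iC f * h), (f * g).
      by split; [exact: Hs|rewrite mulrDr rmorphM mulrA].
  have H'x : H' x by exists 0, 1; rewrite rmorph1 mul1r add0r.
  have [h [g [Hh ev]]] : H' v.
    apply: contrapT => nH'v; apply: nHx; apply: (maxH H') => // z Hz.
    by exists z, 0; rewrite rmorph0 mul0r addr0.
  have gn0 : g != 0.
    apply: contra_notN nHv => /eqP g0.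
    by rewrite ev g0 rmorph0 mul0r addr0.
  exists g^-1; rewrite ev mulrDr mulrA -rmorphM mulVf// rmorph1 mul1r.
  rewrite opprD addrCA subrr addr0 -mulrN; apply: Hs.
  by rewrite -sub0r; apply: HB.
have /choice[lam lamP] := ex.
exists lam; split.
- move=> x y; apply: (uniq_coef (x + y)) => //.
  by rewrite rmorphD mulrDl opprD addrACA; apply: HD.
- move=> f x; apply: (uniq_coef (iC f * x)) => //.
  by rewrite rmorphM -mulrA -mulrBr; apply: Hs.
- move=> x Wx; apply: (uniq_coef x) => //.
  by rewrite rmorph0 mul0r subr0; apply: WH.
- by apply: (uniq_coef v) => //; rewrite rmorph1 mul1r subrr.
Qed.

Lemma prime_above (S : comPzRingType) (J : set S) :
  J 0 -> (forall x y, J x -> J y -> J (x - y)) -> (forall a x, J x -> J (a * x)) ->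
  ~ J 1 -> exists2 q, prime_ideal q & J `<=` q.
Proof.
move=> J0 JB JM nJ1.
have sJ : stable_subgroup (fun a x : S => a * x) J by split.
have [H [sH JH nH1 maxH]] := maximal_avoiding sJ nJ1.
have HD x y := stable_subgroupD sH (x := x) (y := y).
case: (sH) => H0 HB HM; exists H => //; split=> //.
have hit x : ~ H x -> exists h a, H h /\ 1 = h + a * x.
  move=> nHx; pose H' := [set z | exists h a, H h /\ z = h + a * x].
  suff : H' 1 by [].
  apply: contrapT => nH'1; apply: nHx; apply: (maxH H') => //.
  - split.
    + by exists 0, 0; rewrite mul0r addr0.
    + move=> _ _ [h [a [Hh ->]]] [h' [a' [Hh' ->]]].
      exists (h - h'), (a - a'); split; first exact: HB.
      by rewrite mulrBl opprD addrACA.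
    + move=> b _ [h [a [Hh ->]]]; exists (b * h), (b * a).
      by split; [exact: HM|rewrite mulrDr mulrA].
  - by move=> z Hz; exists z, 0; rewrite mul0r addr0.
  - by exists 0, 1; rewrite mul1r add0r.
move=> x y Hxy; apply: contrapT => /not_orP[/hit[h [a [Hh e]]] /hit[k [b [Hk e']]]].
apply: nH1; rewrite -[1]mulr1 {1}e {}e' mulrDl [a * x * _]mulrDr.
have HMr z c : H z -> H (z * c) by move=> Hz; rewrite mulrC; apply: HM.
apply: (HD); first exact: HMr.
apply: (HD); first exact: HM.
by rewrite mulrACA; apply: HM.
Qed.

Section FractionMorphism.
Context (S : comPzRingType) (E E' : fieldType).
Context (i : {rmorphism S -> E}) (g : {rmorphism S -> E'}).

Definition frac_morph of injective i & injective g &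
    (forall x, exists a b, i b != 0 /\ x = i a / i b) : E -> E' :=
  frac_ext i g.

Context (i_inj : injective i) (g_inj : injective g).
Context (fracP : forall x, exists a b, i b != 0 /\ x = i a / i b).
Local Notation h := (frac_morph i_inj g_inj fracP).

Let nz x : i x != 0 -> g x != 0.
Proof. by apply: contra_neq; rewrite -(rmorph0 g) => /g_inj ->; rewrite rmorph0. Qed.

Let hE a b : i b != 0 -> h (i a / i b) = g a / g b.
Proof. exact: frac_extE. Qed.

Fact frac_morph_zmod : zmod_morphism h.
Proof.
move=> x y; have [a [b [b0 ->]]] := fracP x; have [c [d [d0 ->]]] := fracP y.
have -> : i a / i b - i c / i d = i (a * d - c * b) / i (b * d).
  by rewrite -mulNr addf_div// rmorphB !rmorphM mulNr.
rewrite !hE ?rmorphM ?mulf_neq0// rmorphB !rmorphM.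
by rewrite -[in RHS]mulNr addf_div ?nz// mulNr.
Qed.

Fact frac_morph_monoid : monoid_morphism h.
Proof.
split=> [|x y].
  have -> : 1 = i 1 / i 1 by rewrite rmorph1 divr1.
  by rewrite hE ?rmorph1 ?divr1 ?oner_neq0.
have [a [b [b0 ->]]] := fracP x; have [c [d [d0 ->]]] := fracP y.
rewrite mulf_div -!rmorphM !hE ?rmorphM ?mulf_neq0//.
by rewrite [RHS]mulf_div.
Qed.

HB.instance Definition _ := GRing.isZmodMorphism.Build E E' h frac_morph_zmod.
HB.instance Definition _ := GRing.isMonoidMorphism.Build E E' h frac_morph_monoid.

Lemma frac_morphE x : h (i x) = g x.
Proof.
rewrite /frac_morph -[i x]divr1 -(rmorph1 i) frac_extE ?rmorph1 ?divr1//.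
exact: oner_neq0.
Qed.

End FractionMorphism.

HB.instance Definition _ (S : comPzRingType) (Q : frac_field S) (X : set S) :=
  GRing.isZmodMorphism.Build (semiloc Q X) Q (@semiloc_val S Q X)
    (fun x y => erefl).
HB.instance Definition _ (S : comPzRingType) (Q : frac_field S) (X : set S) :=
  GRing.isMonoidMorphism.Build (semiloc Q X) Q (@semiloc_val S Q X)
    (erefl, fun x y => erefl).

Lemma semiloc_inj (S : comPzRingType) (Q : frac_field S) (X : set S) :
  injective (@semiloc_val S Q X).
Proof. exact: val_inj. Qed.

Fact to_semiloc_zmod (S : comPzRingType) (Q : frac_field S) (X : set S) :
  zmod_morphism (to_semiloc Q X).
Proof. by move=> x y; apply: semiloc_inj; rewrite /= rmorphB. Qed.
Fact to_semiloc_monoid (S : comPzRingType) (Q : frac_field S) (X : set S) :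
  monoid_morphism (to_semiloc Q X).
Proof.
by split=> [|x y]; apply: semiloc_inj; rewrite /= ?rmorph1 ?rmorphM.
Qed.
HB.instance Definition _ (S : comPzRingType) (Q : frac_field S) (X : set S) :=
  GRing.isZmodMorphism.Build S (semiloc Q X) (to_semiloc Q X)
    (to_semiloc_zmod Q X).
HB.instance Definition _ (S : comPzRingType) (Q : frac_field S) (X : set S) :=
  GRing.isMonoidMorphism.Build S (semiloc Q X) (to_semiloc Q X)
    (to_semiloc_monoid Q X).

Lemma semiloc_functorial (S S' : comPzRingType) (Q : frac_field S)
    (Q' : frac_field S') (X : set S) (X' : set S') (g : {rmorphism S -> S'})
    (x : semiloc Q X) :
  injective g -> (forall t, X t -> X' (g t)) ->
  frac_ext (to_frac Q) (to_frac Q' \o g) (semiloc_val x) \in semiloc_pred X'.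
Proof.
move=> g_inj gX; apply/asboolP => q qP Xq.
case: x => x /= /asboolP/(_ (g @^-1` q))[].
- split=> /= [|y z|a y|/=|y z]; rewrite ?rmorph0 ?rmorphD ?rmorphM ?rmorph1.
  + exact: prime_ideal0.
  + exact: prime_idealD.
  + exact: prime_idealM.
  + exact: prime_ideal1.
  + exact: prime_ideal_prime.
- by move=> t /gX /Xq.
move=> a [s [/= qs ->]]; exists (g a), (g s); split=> //.
rewrite (frac_extE (g := to_frac Q' \o g)) //=.
- exact: to_frac_inj.
- by move=> y z /= /to_frac_inj /g_inj.
apply: contra_notN qs; rewrite -(rmorph0 (to_frac Q)) => /eqP/to_frac_inj ->.
by rewrite rmorph0; exact: prime_ideal0.
Qed.

Lemma gen_ideal_kernel (S S' : comPzRingType) (g : {rmorphism S -> S'})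
    (X : set S) x :
  (forall y, X y -> g y = 0) -> gen_ideal X x -> g x = 0.
Proof.
move=> gX [s sX ->]; rewrite rmorph_sum big_seq big1// => p ps.
by rewrite rmorphM (gX p.2) ?mulr0//; apply: sX.
Qed.

Lemma ideal_pow_expr (S : comPzRingType) (X : set S) n x :
  gen_ideal X x -> ideal_pow X n (x ^+ n).
Proof.
elim: n => [|n IH] Xx.
  apply: gen_ideal_sub; exists (fun=> 0); first by case.
  by rewrite big_ord0.
have {IH} := IH Xx; rewrite exprS; move: (x ^+ n) => y.
case: Xx => s sX -> [t tX ->]; rewrite mulr_suml.
elim: s sX => [|[a z] s IH] sX; first by rewrite big_nil; exact: gen_ideal0.
rewrite big_cons; apply: gen_idealD; last first.
  by apply: IH => p ps; apply: sX; rewrite inE ps orbT.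
rewrite -mulrA mulr_sumr; apply: gen_idealM => /=.
have Xz : X z := sX _ (mem_head _ _).
elim: t tX {IH} => [|[b w] t IHt] tX; first by rewrite big_nil; exact: gen_ideal0.
rewrite big_cons; apply: gen_idealD; last first.
  by apply: IHt => p ps; apply: tX; rewrite inE ps orbT.
rewrite mulrCA; apply: gen_idealM => /=.
have [c cX /= ->] := tX _ (mem_head _ _).
apply: gen_ideal_sub; exists (fun i => oapp c z (unlift ord0 i)).
  by move=> i; case: unliftP => [j|] _ /=.
rewrite big_ord_recl unlift_none; congr (_ * _).
by apply: eq_bigr => i _; rewrite liftK.
Qed.

(* The denominators of x form an ideal that lies in no prime containing X, so
   it is comaximal to (X), hence to (X)^n. *)
Lemma semiloc_approx (S : comPzRingType) (Q : frac_field S) (X : set S)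
    (x : semiloc Q X) n :
  exists t w, ideal_pow X n w /\ x = to_semiloc Q X t + to_semiloc Q X w * x.
Proof.
pose D := [set s | exists t, to_frac Q s * semiloc_val x = to_frac Q t].
have DM a s : D s -> D (a * s).
  by move=> [t e]; exists (a * t); rewrite !rmorphM -mulrA e.
have DB s s' : D s -> D s' -> D (s - s').
  by move=> [t e] [t' e']; exists (t - t'); rewrite !rmorphB mulrBl e e'.
have D0 : D 0 by exists 0; rewrite rmorph0 mul0r.
pose J := [set z | exists s w, [/\ D s, gen_ideal X w & z = s + w]].
have [s [w [[t et] Xw e]]] : J 1.
  apply: contrapT => nJ1.
  have [q qP Jq] : exists2 q, prime_ideal q & J `<=` q.
    apply: prime_above => //.
    - by exists 0, 0; rewrite addr0; split=> //; apply: gen_ideal0.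
    - move=> _ _ [s [w [Ds Xw ->]]] [s' [w' [Ds' Xw' ->]]].
      exists (s - s'), (w - w'); rewrite opprD addrACA.
      by split=> //; [exact: DB|exact/gen_idealD/gen_idealN].
    - move=> a _ [s [w [Ds Xw ->]]]; exists (a * s), (a * w); rewrite mulrDr.
      by split=> //; [exact: DM|exact: gen_idealM].
  have Xq : X `<=` q.
    by move=> z Xz; apply: Jq; exists 0, z; rewrite add0r; split=> //; exact: gen_ideal_sub.
  have /asboolP/(_ q qP Xq)[a [s [qs ex]]] := valP x.
  apply: (qs); apply: Jq; exists s, 0; rewrite addr0.
  split=> //; last exact: gen_ideal0.
  exists a; rewrite [semiloc_val x]ex mulrC divfK//; apply: contra_notN qs => /eqP.
  by rewrite -(rmorph0 (to_frac Q)) => /to_frac_inj ->; exact: prime_ideal0.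
have [t' et'] : D (1 - w ^+ n).
  have -> : 1 - w ^+ n = (\sum_(i < n) w ^+ i) * s.
    rewrite -(expr1n S n) subrXX mulrC; congr (_ * _); last by rewrite e addrK.
    by apply: eq_bigr => i _; rewrite expr1n mul1r.
  by apply: DM; exists t.
exists t', (w ^+ n); split; first exact: ideal_pow_expr.
apply: semiloc_inj; rewrite rmorphD rmorphM /= -et' -mulrDl -rmorphD subrK.
by rewrite rmorph1 mul1r.
Qed.

(** * Finiteness of A/aA *)

Lemma exists_relation (F : fieldType) (I J : finType) (M : I -> J -> F) :
  (#|J| < #|I|)%N -> exists v : I -> F,
    (exists i, v i != 0) /\ forall j, \sum_i v i * M i j = 0.
Proof.
move=> ltJI.
pose B := \matrix_(i < #|I|, j < #|J|) M (enum_val i) (enum_val j).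
have : kermx B != 0.
  by rewrite -mxrank_eq0 mxrank_ker subn_eq0 -ltnNge (leq_ltn_trans (rank_leq_col _)).
case/rowV0Pn => w /sub_kermxP wB w0; exists (fun i => w 0 (enum_rank i)); split.
  have [i wi] : exists i, w 0 i != 0.
    by apply/rV0Pn.
  by exists (enum_val i); rewrite enum_valK.
move=> j; have /rowP/(_ (enum_rank j)) := wB; rewrite !mxE => e.
rewrite -[RHS]e (reindex (@enum_val I predT)) /=; last first.
  by apply: onW_bij; exact: enum_val_bij.
by apply: eq_bigr => i _; rewrite !mxE enum_valK enum_rankK.
Qed.

Section FunctionField.
Context (F : finFieldType) (K : fieldType) (iF : {rmorphism F -> K}).
Hypothesis hK : function_field iF.

(* K has dimension n over F(t).  Multiplication by a raises the degree in t of
   numerators by at most e once denominators are cleared, so the (D+1)(ne+1)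
   elements a^i x_k, i <= D, lie in an F-space whose dimension grows only like
   neD. *)
Lemma function_field_finite (a : K) : exists N, forall x : 'I_N -> K,
  exists g : 'I_N -> {poly F}, (exists k, g k != 0) /\
    \sum_k (map_poly iF (g k)).[a] * x k = 0.
Proof.
have [t ttr [n [b bP]]] := function_field_fin hK.
pose ev : {rmorphism {poly F} -> K} := horner_morph (fun x => mulrC t (iF x)).
have evE p : (map_poly iF p).[t] = ev p by [].
have ev0 (p : {poly F}) : p != 0 -> ev p != 0.
  by move=> p0; apply: contra_notN ttr => /eqP e; exists p => //; apply/rootP.
have bP' x : exists (g : {poly F}) (c : 'I_n -> {poly F}), g != 0 /\ ev g * x = \sum_i ev (c i) * b i.
  by have [g [c]] := bP x; rewrite evE; exists g, c.
pose IN m z := exists c : 'I_n -> {poly F}, (forall i, size (c i) <= m)%N /\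
  z = \sum_i ev (c i) * b i.
have common (I : finType) (x : I -> K) : exists g : {poly F}, g != 0 /\
    exists C : I -> 'I_n -> {poly F}, forall j, ev g * x j = \sum_i ev (C j i) * b i.
  have /choice[gc gcP] : forall j, exists gc : {poly F} * ('I_n -> {poly F}),
      gc.1 != 0 /\ ev gc.1 * x j = \sum_i ev (gc.2 i) * b i.
    by move=> j; have [g [c h]] := bP' (x j); exists (g, c).
  exists (\prod_j (gc j).1); split.
    by apply/prodf_neq0 => j _; case: (gcP j).
  exists (fun j i => (\prod_(k | k != j) (gc k).1) * (gc j).2 i) => j.
  rewrite (bigD1 j)//= rmorphM mulrAC; case: (gcP j) => _ ->.
  by rewrite mulrC mulr_sumr; apply: eq_bigr => i _; rewrite rmorphM mulrA.
have [g [g0 [C CP]]] := common _ (fun j => a * b j).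
pose e := maxn (size g) (\max_j \max_i size (C j i)).
have sC j i : (size (C j i) <= e)%N.
  rewrite /e leq_max; apply/orP; right.
  by apply: leq_trans (leq_bigmax j); exact: leq_bigmax.
have sM m (p q : {poly F}) : (size p <= m)%N -> (size q <= e)%N -> (size (p * q)%R <= m + e)%N.
  move=> pm qe; apply: leq_trans (size_polyMleq _ _) _.
  by apply: leq_trans (leq_pred _) _; apply: leq_add.
have INg m z : IN m z -> IN (m + e)%N (ev g * z).
  move=> [c [cm ->]]; exists (fun i => c i * g); split.
    by move=> i; apply: sM => //; rewrite leq_max leqnn.
  by rewrite mulr_sumr; apply: eq_bigr => i _; rewrite rmorphM mulrA (mulrC (ev g)).
have INa m z : IN m z -> IN (m + e)%N (ev g * (a * z)).
  move=> [c [cm ->]]; exists (fun i => \sum_j c j * C j i); split.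
    move=> i; apply: leq_trans (size_sum _ _ _) _; apply/bigmax_leqP => j _.
    exact: sM.
  rewrite !mulr_sumr.
  under eq_bigr => j _ do rewrite [a * _]mulrCA (mulrCA (ev g)) CP mulr_sumr.
  rewrite exchange_big; apply: eq_bigr => i _; rewrite rmorph_sum mulr_suml.
  by apply: eq_bigr => j _; rewrite rmorphM mulrA.
have INpow m z D i : IN m z -> (i <= D)%N -> IN (m + D * e)%N (ev g ^+ D * (a ^+ i * z)).
  move=> zm; elim: D i => [|D IH] i iD.
    by move: iD; rewrite leqn0 => /eqP ->; rewrite mul0n addn0 !expr0 !mul1r.
  rewrite mulSn addnCA addnC exprS -mulrA.
  case: i iD => [|i] iD; first by apply: INg; apply: IH.
  rewrite exprS -mulrA [ev g ^+ D * _]mulrCA.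
  by apply: INa; apply: IH.
exists (n * e).+1 => x; have [h [h0 [Cx CxP]]] := common _ x.
pose m0 := \max_k \max_i size (Cx k i).
have INx k : IN m0 (ev h * x k).
  exists (Cx k); split=> // i; rewrite /m0.
  by apply: leq_trans (leq_bigmax k); exact: (leq_bigmax i).
pose D := (n * m0)%N; pose M := (m0 + D * e)%N.
have /choice[c cP] : forall ik : 'I_D.+1 * 'I_(n * e).+1, exists c : 'I_n -> {poly F},
    (forall i, size (c i) <= M)%N /\
    ev g ^+ D * (a ^+ ik.1 * (ev h * x ik.2)) = \sum_i ev (c i) * b i.
  by move=> [i k] /=; apply: INpow => //; rewrite -ltnS.
have [|v [[[i0 k0] v0] vP]] := @exists_relation F _ ('I_n * 'I_M)%type
    (fun ik jl => (c ik jl.1)`_jl.2).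
  rewrite !card_prod !card_ord /M mulnDr mulSn mulnS -/D.
  rewrite [(n * (D * e))%N]mulnCA; lia.
exists (fun k => \poly_(i < D.+1) v (inord i, k)); split.
  exists k0; apply/eqP => /polyP/(_ i0); rewrite coef_poly ltn_ord inord_val coef0.
  exact/eqP.
have gh0 : ev g ^+ D * ev h != 0 by rewrite mulf_neq0 ?expf_neq0 ?ev0.
apply: (mulfI gh0); rewrite mulr0.
transitivity (\sum_ik iF (v ik) * (ev g ^+ D * (a ^+ ik.1 * (ev h * x ik.2)))).
  pose f (i : 'I_D.+1) k := iF (v (i, k)) * (ev g ^+ D * (a ^+ i * (ev h * x k))).
  rewrite [RHS](eq_bigr (fun ik => f ik.1 ik.2)); last by case.
  rewrite -(pair_bigA _ f) /= exchange_big.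
  rewrite mulr_sumr; apply: eq_bigr => k _.
  have -> : map_poly iF (\poly_(i < D.+1) v (inord i, k)) =
            \poly_(i < D.+1) iF (v (inord i, k)).
    by apply/polyP => i; rewrite coef_map !coef_poly; case: ifP => // _; exact: rmorph0.
  rewrite horner_poly mulr_suml mulr_sumr; apply: eq_bigr => i _.
  rewrite inord_val -!mulrA [RHS]mulrCA; congr (_ * _).
  by rewrite [LHS]mulrCA; congr (_ * _); rewrite mulrCA.
under eq_bigr => ik _ do rewrite (cP ik).2 mulr_sumr.
rewrite exchange_big big1// => j _.
under eq_bigr => ik _ do rewrite mulrA.
rewrite -mulr_suml.
suff -> : \sum_ik iF (v ik) * ev (c ik j) = 0 by rewrite mul0r.
have -> : \sum_ik iF (v ik) * ev (c ik j) = ev (\sum_ik v ik *: c ik j).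
  rewrite rmorph_sum; apply: eq_bigr => ik _.
  by rewrite -mul_polyC rmorphM /= horner_morphC.
rewrite (_ : \sum_ik _ = 0) ?rmorph0//; apply/polyP => l; rewrite coef0 coef_sum.
have [lM|Ml] := ltnP l M; last first.
  rewrite big1// => ik _; rewrite coefZ nth_default ?mulr0//.
  exact: leq_trans ((cP ik).1 j) Ml.
rewrite -[RHS](vP (j, Ordinal lM)); apply: eq_bigr => ik _.
by rewrite coefZ.
Qed.

Context (Oinf : set K).
Local Notation A := (ringA iF Oinf).
Local Notation cA := (@constA F K iF Oinf).

Fact ringA_val_zmod : zmod_morphism (@ringA_val F K iF Oinf).
Proof. by []. Qed.
Fact ringA_val_monoid : monoid_morphism (@ringA_val F K iF Oinf).
Proof. by []. Qed.
HB.instance Definition _ := GRing.isZmodMorphism.Build A K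
  (@ringA_val F K iF Oinf) ringA_val_zmod.
HB.instance Definition _ := GRing.isMonoidMorphism.Build A K
  (@ringA_val F K iF Oinf) ringA_val_monoid.

Lemma ringA_val_inj : injective (@ringA_val F K iF Oinf).
Proof. exact: val_inj. Qed.

Fact constA_zmod : zmod_morphism cA.
Proof. by move=> x y; apply: ringA_val_inj; rewrite /= rmorphB. Qed.
Fact constA_monoid : monoid_morphism cA.
Proof. by split=> [|x y]; apply: ringA_val_inj; rewrite /= ?rmorph1 ?rmorphM. Qed.
HB.instance Definition _ := GRing.isZmodMorphism.Build F A cA constA_zmod.
HB.instance Definition _ := GRing.isMonoidMorphism.Build F A cA constA_monoid.

Lemma ringA_mulf_eq0 (a b : A) : a * b = 0 -> a = 0 \/ b = 0.
Proof.
move=> /(congr1 (@ringA_val F K iF Oinf)); rewrite rmorphM rmorph0 => /eqP.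
rewrite mulf_eq0 => /orP[]/eqP; rewrite -(rmorph0 (@ringA_val F K iF Oinf)).
  by move=> /ringA_val_inj; left.
by move=> /ringA_val_inj; right.
Qed.

(* A relation over F[a] among elements of A, divided by the largest possible
   power of a, is nontrivial modulo a. *)
Lemma ringA_mod_finite (a : A) : a != 0 -> exists N, forall x : 'I_N -> A,
  exists c : 'I_N -> F, (exists k, c k != 0) /\
    exists y, \sum_k cA (c k) * x k = a * y.
Proof.
move=> a0; have [N NP] := function_field_finite (ringA_val a); exists N => x.
have [g [[k0 gk0] g0]] := NP (@ringA_val _ _ _ _ \o x).
have {g0} e0 : \sum_k (map_poly cA (g k)).[a] * x k = 0.
  apply: ringA_val_inj; rewrite rmorph_sum rmorph0 -[RHS]g0.
  apply: eq_bigr => k _; rewrite rmorphM -horner_map -map_poly_comp.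
  by congr (_.[_] * _); apply: eq_map_poly.
have {gk0} : exists m k, (g k)`_m != 0.
  by exists (size (g k0)).-1, k0; rewrite -/(lead_coef _) lead_coef_eq0.
have base (h : 'I_N -> {poly F}) : \sum_k (map_poly cA (h k)).[a] * x k = 0 ->
    (exists k, (h k)`_0 != 0) -> exists c : 'I_N -> F, (exists k, c k != 0) /\
    exists y, \sum_k cA (c k) * x k = a * y.
  move=> eh [k1 gk1]; exists (fun k => (h k)`_0); split; first by exists k1.
  exists (- \sum_k (map_poly cA (drop_poly 1 (h k))).[a] * x k).
  apply/eqP; rewrite mulrN -addr_eq0 mulr_sumr -big_split /= -[X in _ == X]eh.
  apply/eqP; apply: eq_bigr => k _; rewrite mulrA -mulrDl; congr (_ * _).
  rewrite -[in RHS](poly_take_drop 1 (h k)) rmorphD rmorphM /= map_polyXn hornerD.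
  rewrite hornerM hornerXn expr1 (mulrC a); congr (_ + _).
  have -> : take_poly 1 (h k) = ((h k)`_0)%:P.
    by apply/polyP => -[|i]; rewrite coef_take_poly coefC.
  by rewrite map_polyC hornerC.
case=> m; elim: m g e0 => [|m IH] g e0 [k1 gk1]; first by apply: base e0 _; exists k1.
have [ex0|all0] := pselect (exists k, (g k)`_0 != 0); first exact: base e0 ex0.
apply: (IH (fun k => drop_poly 1 (g k))); last first.
  by exists k1; rewrite coef_drop_poly addn1.
suff /ringA_mulf_eq0[/eqP|//] :
    a * (\sum_k (map_poly cA (drop_poly 1 (g k))).[a] * x k) = 0 by rewrite (negPf a0).
rewrite mulr_sumr -[RHS]e0; apply: eq_bigr => k _; rewrite mulrA; congr (_ * _).
rewrite -[in RHS](poly_take_drop 1 (g k)) rmorphD rmorphM /= map_polyXn hornerD.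
rewrite hornerM hornerXn expr1 [RHS]addrC mulrC -[LHS]addr0; congr (_ + _).
have -> : take_poly 1 (g k) = 0.
  apply/polyP => -[|i]; rewrite coef_take_poly coef0//=.
  by apply/eqP; apply: contra_notT all0; exists k.
by rewrite rmorph0 horner0.
Qed.

End FunctionField.

(** * Frobenius-linear systems over a field *)

Lemma card_finField_pnat (F : finFieldType) (R : nzRingType)
    (f : {rmorphism F -> R}) : [pchar R].-nat #|F|.
Proof.
have [p p_pr pF] := finPcharP F.
rewrite (card_pprimeChar pF) pnatX; apply/orP; left.
by rewrite pnatE// (fmorph_pchar f).
Qed.

Lemma card_finField_natr0 (F : finFieldType) (R : nzRingType)
    (f : {rmorphism F -> R}) : #|F|%:R = 0 :> R.
Proof.
have [p p_pr pF] := finPcharP F.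
have pR : p \in [pchar R] by rewrite (fmorph_pchar f).
rewrite (card_pprimeChar pF); case e: (logn p _) => [|n].
  by have := finNzRing_gt1 F; rewrite (card_pprimeChar pF) e.
by rewrite expnS natrM (pcharf0 pR) mul0r.
Qed.

Section Frobenius.
Context (F : finFieldType) (R : comNzRingType) (iR : {rmorphism F -> R}).

(* The phantom argument fixes the characteristic, which makes frobq additive. *)
Definition frobq of {rmorphism F -> R} := fun x : R => x ^+ #|F|.
Local Notation fr := (frobq iR).

Fact frobq_zmod : zmod_morphism fr.
Proof.
move=> x y; apply/esym/eqP; rewrite subr_eq; apply/eqP.
by rewrite /frobq -exprDn_pchar ?subrK//; exact: card_finField_pnat iR.
Qed.
Fact frobq_monoid : monoid_morphism fr.
Proof. split=> [|x y]. exact: expr1n. exact: exprMn. Qed.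
HB.instance Definition _ := GRing.isZmodMorphism.Build R R fr frobq_zmod.
HB.instance Definition _ := GRing.isMonoidMorphism.Build R R fr frobq_monoid.

Lemma frobq_const c : fr (iR c) = iR c.
Proof. by rewrite /frobq -rmorphXn expf_card. Qed.

End Frobenius.

Lemma frobq_fixed (F : finFieldType) (C : fieldType) (iC : {rmorphism F -> C}) x :
  x ^+ #|F| = x -> exists c, x = iC c.
Proof.
move=> xq; have : root (map_poly iC ('X^#|F| - 'X)) x.
  by rewrite rmorphB /= map_polyXn map_polyX /root !hornerE xq subrr.
rewrite finField_genPoly rmorph_prod /= /root horner_prod prodf_seq_eq0.
case/hasP => c _ /=; rewrite map_polyXsubC hornerXsubC subr_eq0 => /eqP ->.
by exists c.
Qed.

Lemma separable_qpoly (F : finFieldType) (L : fieldType) (iL : {rmorphism F -> L})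
    t (c : 'I_t.+1 -> L) : c ord0 != 0 ->
  separable_poly (\sum_k c k *: 'X^(#|F| ^ k)).
Proof.
move=> c0; set P := BIG_F; rewrite separable_poly.unlock.
have -> : (\sum_k P k)^`() = (c ord0)%:P.
  rewrite raddf_sum big_ord_recl big1 /= => [|k _].
    by rewrite /P derivZ expn0 expr1 derivX addr0 alg_polyC.
  rewrite /P derivZ derivXn -mulr_natr; suff -> : (#|F| ^ k.+1)%N%:R = 0 :> {poly L}.
    by rewrite mulr0 scaler0.
  by rewrite expnS natrM -(polyC_natr L #|F|) (card_finField_natr0 iL) polyC0 mul0r.
apply/coprimepP => d _; rewrite -alg_polyC dvdpZr// dvdp1 size_poly_eq1.
by move=> ->.
Qed.

Section SeparableSystem.
Context (F : finFieldType) (L C : fieldType).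
Context (iL : {rmorphism F -> L}) (v : {rmorphism L -> C}).
Local Notation q := #|F|.
Local Notation frL := (frobq iL).
Let iC : {rmorphism F -> C} := v \o iL.
Local Notation frC := (frobq iC).
Local Notation "A ^v" := (map_mx v A) (at level 2).

Let frob_v m n (B : 'M[L]_(m, n)) : map_mx frC B^v = (map_mx frL B)^v.
Proof. by apply/matrixP => i j; rewrite !mxE /frobq rmorphXn. Qed.

(* With w independent over L, w^(q) = w G for an invertible G over L, so
   y = w u has y^q = w (G u^(q)).  Frobenius preserves linear independence, so
   the first relation among y, y^q, y^(q^2), ... has a nonzero coefficient at
   y: it is a separable equation. *)
Let sep_root y := exists2 P : {poly L}, separable_poly P & root (map_poly v P) y.

Let independent_case N (z : 'rV[C]_N) (B : 'M[L]_N) (u : 'cV[L]_N) :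
  z = map_mx frC z *m B^v -> (forall u : 'cV[L]_N, z *m u^v = 0 -> u = 0) ->
  sep_root ((z *m u^v) 0 0).
Proof.
move=> zB zind.
have Bu : B \in unitmx.
  rewrite -unitmx_tr -row_free_unit -kermx_eq0; apply/eqP.
  apply/row_matrixP => i; rewrite row0.
  have : row i (kermx B^T) *m B^T = 0 by apply/sub_kermxP; exact: row_sub.
  move=> /(congr1 trmx); rewrite trmx_mul trmxK trmx0 => e.
  by apply: trmx_inj; rewrite trmx0; apply: zind; rewrite zB -mulmxA -map_mxM e map_mx0 mulmx0.
pose G := invmx B.
have zG : map_mx frC z = z *m G^v.
  by rewrite {2}zB -mulmxA -map_mxM mulmxV// map_mx1 mulmx1.
pose phi (u : 'cV[L]_N) := G *m map_mx frL u.
have phiE w : z *m (phi w)^v = map_mx frC (z *m w^v).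
  by rewrite map_mxM mulmxA -zG -frob_v -map_mxM.
pose y := (z *m u^v) 0 0.
have iterE k : (z *m (iter k phi u)^v) 0 0 = y ^+ (q ^ k).
  elim: k => [|k IH]; first by rewrite expn0 expr1.
  by rewrite iterS phiE mxE IH /frobq -exprM expnSr.
pose Kr n := \matrix_(i < n, j < N) (iter i phi u) j 0.
have [t [ft nft]] : exists t, row_free (Kr t) /\ ~~ row_free (Kr t.+1).
  have ex : exists n, ~~ row_free (Kr n).
    exists N.+1; rewrite /row_free neq_ltn.
    by rewrite (leq_ltn_trans (rank_leq_col _)).
  case: (ex_minnP ex) => -[|t] nf tmin; first by rewrite flatmx0 /row_free mxrank0 in nf.
  exists t; split=> //; apply: contraT => /tmin; by rewrite ltnn.
have [c cK c0] : exists2 c : 'rV_t.+1, c *m Kr t.+1 = 0 & c != 0.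
  move: nft; rewrite -kermx_eq0 => /rowV0Pn[c /sub_kermxP cK c0]; by exists c.
have cK' : \sum_k c 0 k *: iter k phi u = 0.
  apply/colP => j; transitivity ((c *m Kr t.+1) 0 j); last by rewrite cK !mxE.
  by rewrite summxE mxE; apply: eq_bigr => k _; rewrite !mxE.
have c00 : c 0 ord0 != 0.
  apply: contraNneq c0 => c00; move: cK'; rewrite big_ord_recl c00 scale0r add0r.
  pose c' : 'rV_t := \row_k c 0 (lift ord0 k).
  move=> e; suff c'0 : c' = 0.
    apply/eqP/rowP => k; rewrite mxE; case: (unliftP ord0 k) => [k' ->|->//].
    by have /rowP/(_ k') := c'0; rewrite !mxE.
  have : c' *m map_mx frL (Kr t) *m G^T = 0.
    apply/rowP => j; have /colP/(_ j) := e; rewrite summxE [RHS]mxE => e'.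
    rewrite [RHS]mxE -[RHS]e' mxE.
    under eq_bigr => l _ do rewrite !mxE mulr_suml.
    rewrite exchange_big; apply: eq_bigr => k _; rewrite !mxE mulr_sumr.
    by apply: eq_bigr => l _; rewrite !mxE -mulrA (mulrC (frL _)).
  move=> /(congr1 (mulmxr (invmx G^T))) /=.
  rewrite mulmxK ?unitmx_tr ?unitmx_inv// mul0mx => e'.
  have : row_free (map_mx frL (Kr t)) by rewrite row_free_map.
  by move=> /row_free_inj/(_ c' 0); rewrite mul0mx; apply.
exists (\sum_k c 0 k *: 'X^(q ^ k)); first exact: separable_qpoly.
rewrite /root rmorph_sum horner_sum; apply/eqP.
transitivity ((z *m (\sum_k c 0 k *: iter k phi u)^v) 0 0); last first.
  by rewrite cK' map_mx0 mulmx0 mxE.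
rewrite map_mx_sum mulmx_sumr summxE; apply: eq_bigr => k _.
by rewrite map_mxZ -scalemxAr [RHS]mxE iterE /= map_polyZ map_polyXn hornerZ hornerXn.
Qed.

Lemma separable_system_row N (z : 'rV[C]_N) (B : 'M[L]_N) (u : 'cV[L]_N) :
  z = map_mx frC z *m B^v -> sep_root ((z *m u^v) 0 0).
Proof.
elim: N z B u => [|N IH] z B u zB.
  exists 'X; first by rewrite separable_poly.unlock derivX coprimep1.
  by rewrite thinmx0 mul0mx mxE map_polyX /root hornerX.
have [[u0 [zu0 u00]]|none] := pselect (exists u0 : 'cV[L]_N.+1, z *m u0^v = 0 /\ u0 != 0);
  last first.
  apply: independent_case zB _ => w zw; apply/eqP; apply: contra_notT none.
  by exists w.
have [i0 ui0] : exists i0, u0 i0 0 != 0 by apply/cV0Pn.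
pose A : 'M[L]_(N, N.+1) := \matrix_(i', i)
  if unlift i0 i is Some j then (i' == j)%:R else - (u0 (lift i0 i') 0 / u0 i0 0).
pose z' := col' i0 z.
have zA : z = z' *m A^v.
  apply/rowP => i; rewrite !mxE; case: (unliftP i0 i) => [j|] ->.
    rewrite (bigD1 j)//= !mxE liftK eqxx rmorph1 mulr1 big1 ?addr0// => k kj.
    by rewrite !mxE liftK (negPf kj) rmorph0 mulr0.
  have vu0 : v (u0 i0 0) != 0 by rewrite fmorph_eq0.
  apply: (mulIf vu0); move: zu0 => /rowP/(_ 0); rewrite !mxE (bigD1_ord i0)//= !mxE.
  move/eqP; rewrite addr_eq0 => /eqP ->; rewrite mulr_suml -sumrN.
  apply: eq_bigr => k _; rewrite !mxE unlift_none rmorphN mulrN mulNr.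
  by rewrite fmorph_div -mulrA divfK.
pose S : 'M[L]_(N.+1, N) := col' i0 1%:M.
have zS : z' = z *m S^v.
  apply/rowP => i; rewrite !mxE (bigD1 (lift i0 i))//= !mxE eqxx rmorph1 mulr1.
  rewrite big1 ?addr0// => k ki; rewrite !mxE.
  by rewrite (negPf ki) rmorph0 mulr0.
rewrite {1}zA -mulmxA -map_mxM; apply: (IH _ (map_mx frL A *m B *m S)).
rewrite {1}zS {1}zB {1}zA.
by rewrite !map_mxM !mulmxA /= frob_v.
Qed.

Lemma separable_system (I : finType) (z : I -> C) (B : I -> I -> L) :
  (forall i, z i = \sum_j z j ^+ q * v (B j i)) -> forall i, sep_root (z i).
Proof.
move=> zB i; pose Z : 'rV_#|I| := \row_k z (enum_val k).
pose BB : 'M[L]_#|I| := \matrix_(j, k) B (enum_val j) (enum_val k).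
have ZB : Z = map_mx frC Z *m BB^v.
  apply/rowP => k; rewrite !mxE zB (reindex (@enum_val I predT)) /=; last first.
    by apply: onW_bij; exact: enum_val_bij.
  by apply: eq_bigr => j _; rewrite !mxE.
have := separable_system_row (delta_mx (enum_rank i) 0) ZB.
rewrite map_delta_mx -colE !mxE enum_rankK.
by [].
Qed.

End SeparableSystem.

(** * Tensor products with a finite F-algebra *)

Lemma basis_modulo (F : fieldType) (R : comPzRingType) (f : {rmorphism F -> R})
    (W : set R) N :
  stable_subgroup (fun c x => f c * x) W ->
  (forall x : 'I_N -> R, exists c : 'I_N -> F, (exists k, c k != 0) /\
     W (\sum_k f (c k) * x k)) ->
  exists s (b : 'I_s -> R),
    (forall x, exists c : 'I_s -> F, W (x - \sum_k f (c k) * b k)) /\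
    (forall c : 'I_s -> F, W (\sum_k f (c k) * b k) -> forall k, c k = 0).
Proof.
move=> sW dep; case: (sW) => W0 WB Ws.
pose indep s (b : 'I_s -> R) :=
  forall c : 'I_s -> F, W (\sum_k f (c k) * b k) -> forall k, c k = 0.
apply: contrapT => none.
have grow s : exists b, @indep s b.
  elim: s => [|s [b bi]]; first by exists (fun=> 0) => c _ [].
  have [x nx] : exists x, ~ exists c : 'I_s -> F, W (x - \sum_k f (c k) * b k).
    by apply/existsNP => H; apply: none; exists s, b; split.
  exists (fun k => oapp b x (unlift ord0 k)) => c.
  rewrite big_ord_recl unlift_none /=.
  under eq_bigr => k _ do rewrite liftK /=.
  have [c0|c0] := eqVneq (c ord0) 0.
    rewrite c0 rmorph0 mul0r add0r => /bi cl k.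
    by case: (unliftP ord0 k) => [j|] ->; rewrite ?c0 ?cl.
  move=> Wc; exfalso; apply: nx; exists (fun k => - (c ord0)^-1 * c (lift ord0 k)).
  have := Ws (c ord0)^-1 _ Wc; rewrite mulrDr mulrA -rmorphM mulVf// rmorph1 mul1r.
  congr (W (_ + _)); rewrite mulr_sumr -sumrN; apply: eq_bigr => k _.
  by rewrite mulNr rmorphN mulNr opprK rmorphM mulrA.
have [b bi] := grow N; have [c [[k ck] Wc]] := dep b.
by rewrite (bi c Wc k) eqxx in ck.
Qed.

Section FiniteBasis.
Context (F : finFieldType) (R : comPzRingType) (f : {rmorphism F -> R}).
Context (s : nat) (e : 'I_s -> R) (kap : 'I_s -> R -> F).

Definition dual_bases :=
  [/\ forall k x y, kap k (x + y) = kap k x + kap k y,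
      forall k c x, kap k (f c * x) = c * kap k x,
      forall x, x = \sum_k f (kap k x) * e k &
      forall k (c : 'I_s -> F), kap k (\sum_j f (c j) * e j) = c k].
Hypothesis basisP : dual_bases.

Section Coordinates.
Context (E : comPzRingType) (iE : {rmorphism F -> E}).
Local Notation T := (talg f iE).

Definition coordT k (x : T) : E := tens_lift (fun r y => iE (kap k r) * y) x.

Lemma coordT_balanced k :
  balanced (scal_by f) (scal_by iE) (fun r y => iE (kap k r) * y).
Proof.
have [kD kZ _ _] := basisP; split=> [x x' y|x y y'|c x y].
- by rewrite kD rmorphD mulrDl.
- by rewrite mulrDr.
- by rewrite /scal_by kZ rmorphM mulrCA mulrA.
Qed.

Lemma coordT_tensor k r y : coordT k (tensor r y) = iE (kap k r) * y.
Proof. exact: (tens_lift_tensor (coordT_balanced k)). Qed.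

Lemma coordT_zmod k : zmod_morphism (coordT k).
Proof.
by move=> x y; rewrite /coordT (tens_liftD (coordT_balanced k))
                       (tens_liftN (coordT_balanced k)).
Qed.
HB.instance Definition _ k :=
  GRing.isZmodMorphism.Build T E (coordT k) (coordT_zmod k).

Lemma coordTD k (x y : T) : coordT k (x + y) = coordT k x + coordT k y.
Proof. exact: raddfD. Qed.

Lemma coordT0 k : coordT k 0 = 0.
Proof. exact: raddf0. Qed.

Lemma coordT_sum k I (r : seq I) (P : pred I) (a : I -> T) :
  coordT k (\sum_(i <- r | P i) a i) = \sum_(i <- r | P i) coordT k (a i).
Proof. exact: raddf_sum. Qed.

Lemma tensor_suml I (r : seq I) (P : pred I) (a : I -> R) (y : E) :
  tensor (\sum_(i <- r | P i) a i) y = \sum_(i <- r | P i) (tensor (a i) y : T).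
Proof.
elim/big_rec2: _ => [|i u w _ <-]; last exact: tensorDl.
by apply: (addrI (tensor 0 y : T)); rewrite -tensorDl !addr0.
Qed.

Lemma tensor0r (x : R) : tensor x 0 = 0 :> T.
Proof. by apply: (addrI (tensor x 0 : T)); rewrite -tensorDr !addr0. Qed.

Lemma coordT_expand (x : T) : x = \sum_k tensor (e k) (coordT k x).
Proof.
have [_ _ kE _] := basisP.
elim/tens_ind: x => [|r y x IH].
  by rewrite big1// => k _; rewrite coordT0 tensor0r.
under eq_bigr => k _ do rewrite coordTD tensorDr coordT_tensor.
rewrite [RHS]big_split /= -IH; congr (_ + _).
rewrite {1}(kE r) tensor_suml; apply: eq_bigr => k _.
exact: tensor_bal.
Qed.

Lemma kap_e k j : kap k (e j) = (k == j)%:R.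
Proof.
have [_ _ _ kd] := basisP.
have -> : e j = \sum_i f ((i == j)%:R) * e i.
  rewrite (bigD1 j)//= eqxx rmorph1 mul1r big1 ?addr0// => i ij.
  by rewrite (negPf ij) rmorph0 mul0r.
exact: kd.
Qed.

Lemma coordTE k (y : 'I_s -> E) : coordT k (\sum_j tensor (e j) (y j)) = y k.
Proof.
rewrite coordT_sum (bigD1 k)//= coordT_tensor kap_e eqxx rmorph1 mul1r big1 ?addr0//.
by move=> j jk; rewrite coordT_tensor kap_e eq_sym (negPf jk) rmorph0 mul0r.
Qed.

Lemma coordT_inj (x y : T) : (forall k, coordT k x = coordT k y) -> x = y.
Proof.
move=> xy; rewrite (coordT_expand x) (coordT_expand y).
by apply: eq_bigr => k _; rewrite xy.
Qed.

Lemma tensl_inj : injective iE -> injective (@tensl F R E f iE).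
Proof.
have [_ _ kE _] := basisP.
move=> iE_inj x y xy; rewrite (kE x) (kE y); apply: eq_bigr => k _.
congr (f _ * _); apply: iE_inj; rewrite -[LHS]mulr1 -[RHS]mulr1.
by rewrite -!coordT_tensor -/(tensl f iE x) xy.
Qed.

End Coordinates.

Section CoordinateMap.
Context (E E' : comPzRingType) (iE : {rmorphism F -> E}) (iE' : {rmorphism F -> E'}).
Context (v : {rmorphism E -> E'}) (u : {rmorphism R -> R}).
Context (uid : forall x, u x = x) (uf : forall c, u (f c) = f c).
Context (vE : forall c, v (iE c) = iE' c).
Local Notation uv := (talg_map uf vE).

Lemma coordT_map k x : coordT k (uv x) = v (coordT k x).
Proof.
elim/tens_ind: x => [|r y x IH].
  by rewrite (rmorph0 uv) !coordT0 (rmorph0 v).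
rewrite (rmorphD uv) /= !coordTD (rmorphD v) IH.
by congr (_ + _); rewrite talg_map_tensor !coordT_tensor rmorphM vE uid.
Qed.

Lemma talg_map_injr : injective v -> injective uv.
Proof.
move=> v_inj x y xy; apply: coordT_inj => k; apply: v_inj.
by rewrite -!coordT_map xy.
Qed.

Lemma talg_map_image x :
  (forall k, exists y, coordT k x = v y) -> exists x', uv x' = x.
Proof.
move=> /choice[y yP]; exists (\sum_k tensor (e k) (y k)).
rewrite rmorph_sum [RHS]coordT_expand; apply: eq_bigr => k _.
by rewrite yP /= talg_map_tensor uid.
Qed.

End CoordinateMap.

Lemma talg_frob_fixed (C : fieldType) (iC : {rmorphism F -> C})
    (u : {rmorphism R -> R}) (uid : forall x, u x = x)
    (uf : forall c, u (f c) = f c) (x : talg f iC) :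
  talg_map uf (frobq_const iC) x = x -> exists r, x = tensl f iC r.
Proof.
move=> xx.
have /choice[c cP] : forall k, exists c, coordT k x = iC c.
  move=> k; apply: frobq_fixed; rewrite -{2}xx.
  by rewrite (coordT_map uid).
exists (\sum_k f (c k) * e k); rewrite (coordT_expand x) rmorph_sum.
apply: eq_bigr => k _; rewrite cP rmorphM /tensl mul_tensor mulr1.
rewrite -[tensor (f _ * _) _]/(tensor (scal_by f (c k) (e k)) 1) tensor_bal.
by rewrite /scal_by mulr1.
Qed.

Section Descent.
Context (E C : fieldType) (iE : {rmorphism F -> E}) (iC : {rmorphism F -> C}).
Context (v : {rmorphism E -> C}) (u : {rmorphism R -> R}).
Context (uid : forall x, u x = x) (uf : forall c, u (f c) = f c).
Context (vE : forall c, v (iE c) = iC c).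
Local Notation uv := (talg_map uf vE).

(* x is a unit iff its multiplication matrix is invertible, which may be tested
   over an extension field. *)
Lemma talg_unit_descent (x : talg f iE) (y : talg f iC) :
  uv x * y = 1 -> exists x', x * x' = 1.
Proof.
move=> xy.
pose M := \matrix_(j, k) coordT k (x * (tensor (e j) 1 : talg f iE)).
have ME (w : 'I_s -> E) k :
    coordT k (x * \sum_j (tensor (e j) (w j) : talg f iE)) = \sum_j w j * M j k.
  rewrite mulr_sumr coordT_sum; apply: eq_bigr => j _; rewrite mxE.
  have -> : tensor (e j) (w j) = (tensor 1 (w j) : talg f iE) * tensor (e j) 1.
    by rewrite mul_tensor mul1r mulr1.
  rewrite mulrCA; move: (x * _) => z; rewrite {1}(coordT_expand z) mulr_sumr.
  under eq_bigr => i _ do rewrite mul_tensor mul1r.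
  by rewrite coordTE.
have MC (w : 'I_s -> C) k :
    coordT k (uv x * \sum_j (tensor (e j) (w j) : talg f iC)) = \sum_j w j * v (M j k).
  rewrite mulr_sumr coordT_sum; apply: eq_bigr => j _; rewrite mxE.
  have -> : tensor (e j) (w j) = (tensor 1 (w j) : talg f iC) * uv (tensor (e j) 1).
    by rewrite talg_map_tensor rmorph1 mul_tensor mul1r mulr1 uid.
  rewrite mulrCA -rmorphM -(coordT_map uid uf vE) /=.
  move: (uv _) => z; rewrite {1}(coordT_expand z) mulr_sumr.
  under eq_bigr => i _ do rewrite mul_tensor mul1r.
  by rewrite coordTE.
have Mu : M \in unitmx.
  rewrite -(map_unitmx v) -row_full_unit -sub1mx; apply/row_subP => i.
  pose t : talg f iC := \sum_k tensor (e k) ((i == k)%:R).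
  have -> : row i 1%:M = (\row_j coordT j (y * t)) *m map_mx v M.
    apply/rowP => k; rewrite !mxE.
    transitivity (coordT k (uv x * (y * t))).
      by rewrite mulrA xy mul1r coordTE.
    rewrite {1}(coordT_expand (y * t)) MC.
    by apply: eq_bigr => j _; rewrite !mxE.
  exact: submxMl.
pose w := (\row_k coordT k (1 : talg f iE)) *m invmx M.
exists (\sum_j tensor (e j) (w 0 j)); apply: coordT_inj => k; rewrite ME.
have /rowP/(_ k) := mulmxKV Mu (\row_k coordT k (1 : talg f iE)).
by rewrite -/w [in X in X -> _]mxE [X in _ = X -> _]mxE.
Qed.

End Descent.

Lemma separable_matrix_system (L C : fieldType) (iL : {rmorphism F -> L})
    (iC : {rmorphism F -> C}) (v : {rmorphism L -> C}) (u : {rmorphism R -> R})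
    (uid : forall x, u x = x) (uf : forall c, u (f c) = f c)
    (vE : forall c, v (iL c) = iC c) r (Y : 'M[talg f iC]_r) (Th : 'M[talg f iL]_r) :
  map_mx (talg_map uf (frobq_const iC)) Y *m map_mx (talg_map uf vE) Th = Y ->
  forall i j k, exists2 P : {poly L}, separable_poly P &
    root (map_poly v P) (coordT k (Y i j)).
Proof.
move=> YT i j k.
pose z (jk : 'I_r * 'I_s) := coordT jk.2 (Y i jk.1).
pose B (lm jk : 'I_r * 'I_s) :=
  coordT jk.2 ((tensor (e lm.2) 1 : talg f iL) * Th lm.1 jk.1).
apply: (@separable_system F L C iL v _ z B _ (j, k)) => {j k} -[j k].
rewrite {1}/z /= -{1}YT mxE coordT_sum /=.
rewrite (eq_bigr (fun lm => z (lm.1, lm.2) ^+ #|F| * v (B (lm.1, lm.2) (j, k))));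
  last by case.
rewrite -(pair_bigA _ (fun l m => z (l, m) ^+ #|F| * v (B (l, m) (j, k)))) /=.
apply: eq_bigr => l _; rewrite !mxE (coordT_expand (talg_map _ _ _)) mulr_suml coordT_sum.
apply: eq_bigr => m _ /=; rewrite (coordT_map uid) /B /= -(coordT_map uid uf vE).
have -> : tensor (e m) (frobq iC (coordT m (Y i l))) =
  (tensor 1 (frobq iC (coordT m (Y i l))) : talg f iC) *
    talg_map uf vE (tensor (e m) 1).
  by rewrite talg_map_tensor rmorph1 mul_tensor mul1r mulr1 uid.
rewrite -mulrA -rmorphM /=; move: (talg_map _ _ (_ * _)) => w.
rewrite {1}(coordT_expand w) mulr_sumr.
under eq_bigr => n _ do rewrite mul_tensor mul1r.
by rewrite coordTE.
Qed.

End FiniteBasis.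

(** * Residue rings and tensors over A *)

Section Residues.
Context (F : finFieldType) (K : fieldType) (iF : {rmorphism F -> K}).
Context (Oinf : set K).
Local Notation A := (ringA iF Oinf).
Local Notation cA := (@constA F K iF Oinf).

Section Level.
Context (p : set A) (n : nat).

Fact residue_const_zmod : zmod_morphism (@residue_const F K iF Oinf p n).
Proof. by move=> x y; rewrite /residue_const !rmorphB. Qed.
Fact residue_const_monoid : monoid_morphism (@residue_const F K iF Oinf p n).
Proof. by split=> [|x y]; rewrite /residue_const ?rmorph1// !rmorphM. Qed.
HB.instance Definition _ := GRing.isZmodMorphism.Build F (residue p n)
  (@residue_const F K iF Oinf p n) residue_const_zmod.
HB.instance Definition _ := GRing.isMonoidMorphism.Build F (residue p n)
  (@residue_const F K iF Oinf p n) residue_const_monoid.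

End Level.

Lemma ringA_span (hK : function_field iF) (a : A) : a != 0 ->
  exists s (b : 'I_s -> A), forall x, exists (c : 'I_s -> F) y,
    x = \sum_k cA (c k) * b k + a * y.
Proof.
move=> a0; have [N NP] := ringA_mod_finite hK a0.
have [|//|s [b [bspan _]]] := @basis_modulo F A cA [set z | exists y, z = a * y] N.
  split=> [|_ _ [y ->] [z ->]|c _ [y ->]]; first by exists 0; rewrite mulr0.
    by exists (y - z); rewrite mulrBr.
  by exists (cA c * y); rewrite mulrCA.
exists s, b => x; have [c [y xy]] := bspan x; exists c, y.
by rewrite -xy addrC subrK.
Qed.

Lemma prime_ideal_expn0 (p : set A) (a : A) n : prime_ideal p -> a != 0 -> a ^+ n != 0.
Proof.
move=> pP a0; elim: n => [|n IH].
  by rewrite expr0; exact: oner_neq0.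
rewrite exprS; apply/eqP => /ringA_mulf_eq0[] e.
  by rewrite e eqxx in a0.
by rewrite e eqxx in IH.
Qed.

Lemma residue_basis (hK : function_field iF) (p : set A) (hp : prime_ideal p)
    (hp0 : exists2 a, p a & a != 0) n :
  exists s (e : 'I_s -> residue p n) (kap : 'I_s -> residue p n -> F),
    dual_bases (@residue_const F K iF Oinf p n) e kap.
Proof.
have [a pa a0] := hp0.
have an0 : a ^+ n.+1 != 0 by exact: prime_ideal_expn0 hp a0.
have pan : ideal_pow p n.+1 (a ^+ n.+1).
  by apply: ideal_pow_expr; exact: gen_ideal_sub.
pose W := gen_ideal (ideal_pow p n.+1).
have [N NP] := ringA_mod_finite hK an0.
have [||s [b [bspan bind]]] := @basis_modulo F A cA W N.
- split=> [|x y Wx Wy|c x Wx]; first exact: gen_ideal0.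
    exact/gen_idealD/gen_idealN.
  exact: gen_idealM.
- move=> x; have [c [c0 [y e]]] := NP x; exists c; split=> //.
  by rewrite e mulrC; apply: gen_idealM; exact: gen_ideal_sub.
pose f : {rmorphism F -> residue p n} := @residue_const F K iF Oinf p n.
pose e k : residue p n := quot_pi _ (b k).
have eE (c : 'I_s -> F) : \sum_k f (c k) * e k =
    quot_pi _ (\sum_k cA (c k) * b k) :> residue p n.
  rewrite [RHS]rmorph_sum; apply: eq_bigr => k _.
  by rewrite [RHS]rmorphM.
have span (x : residue p n) : exists c : 'I_s -> F, x = \sum_k f (c k) * e k.
  have [c Wc] := bspan (quot_repr x); exists c.
  by rewrite eE -[LHS]quot_reprK; apply/quot_piP.
have uniq_c (c c' : 'I_s -> F) : \sum_k f (c k) * e k = \sum_k f (c' k) * e k ->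
    forall k, c k = c' k.
  rewrite !eE => /quot_piP; rewrite -sumrB.
  under eq_bigr => k _ do rewrite -mulrBl -rmorphB.
  move=> /bind H k; apply/eqP; rewrite -subr_eq0; apply/eqP; exact: H.
have [kap kapP] := choice span.
exists s, e, (fun k x => kap x k); split=> [k x y|k c x|x|k c].
- move: k; apply: uniq_c; rewrite -kapP {1}(kapP x) {1}(kapP y) -big_split.
  by apply: eq_bigr => k _; rewrite rmorphD mulrDl.
- move: k; apply: uniq_c; rewrite -kapP {1}(kapP x) mulr_sumr.
  by apply: eq_bigr => k _; rewrite rmorphM mulrA.
- exact: kapP.
- by move: k; apply: uniq_c; rewrite -kapP.
Qed.

Section TensorA.
Context (E : comPzRingType) (iE : {rmorphism F -> E}).
Local Notation AE := (tensA iF Oinf iE).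

Lemma tensA_lin_indep (x : AE) : exists n (a : 'I_n -> A) (c : 'I_n -> E),
  lin_indep a /\ x = \sum_i tensor (a i) (c i).
Proof.
have [n0 [a0 [c0 x0]]] : exists n (a : 'I_n -> A) (c : 'I_n -> E),
    x = \sum_i tensor (a i) (c i).
  elim/tens_ind: x => [|a c x [n [b [d xbd]]]].
    exists 0%N, (fun=> 0), (fun=> 0); rewrite big_ord0. exact: erefl.
  exists n.+1, (fun k => oapp b a (unlift ord0 k)).
  exists (fun k => oapp d c (unlift ord0 k)).
  rewrite big_ord_recl unlift_none xbd /=; congr (_ + _).
  by apply: eq_bigr => k _; rewrite liftK.
pose P n := `[< exists (a : 'I_n -> A) (c : 'I_n -> E), x = \sum_i tensor (a i) (c i) >].
have exP : exists n, P n by exists n0; apply/asboolP; exists a0, c0.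
case: (ex_minnP exP) => n /asboolP[a [c xE]] nmin; exists n, a, c; split=> //.
apply: contrapT => /existsNP[c' /not_implyP[rel /existsNP[j /eqP cj]]].
case: n a c xE nmin c' rel j cj => [|n] a c xE nmin c' rel j cj; first by case: j cj.
suff /nmin : P n by rewrite ltnn.
apply/asboolP; exists (fun k => a (lift j k)).
exists (fun k => c (lift j k) - iE (c' (lift j k) / c' j) * c j).
have aj : a j = - \sum_k cA (c' (lift j k) / c' j) * a (lift j k).
  have : cA (c' j)^-1 * \sum_i cA (c' i) * a i = 0 by rewrite rel mulr0.
  rewrite (bigD1_ord j)//= mulrDr mulrA -rmorphM mulVf// rmorph1 mul1r.
  move/eqP; rewrite addr_eq0 => /eqP ->; rewrite mulr_sumr; congr (- _).
  by apply: eq_bigr => k _; rewrite mulrA -rmorphM (mulrC (c' j)^-1).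
rewrite xE (bigD1_ord j)//= aj.
pose T : {rmorphism A -> AE} := tensl constA iE.
have tE (u : A) (y : E) : tensor u y = T u * tensor 1 y :> AE.
  by rewrite /T /= /tensl mul_tensor mulr1 mul1r.
rewrite tE rmorphN rmorph_sum mulNr mulr_suml -sumrN -big_split.
apply: eq_bigr => k _; rewrite -mulNr -rmorphN -tE tensorDr [RHS]addrC; congr (_ + _).
transitivity (tensor (scal_by cA (- (c' (lift j k) / c' j)) (a (lift j k))) (c j) : AE).
  by rewrite /scal_by rmorphN mulNr.
by rewrite tensor_bal /scal_by rmorphN mulNr.
Qed.

End TensorA.
End Residues.

(** * The Gauss norm *)

Lemma ultrametric_limit (R : realType) (V : zmodType) (N : V -> R)
    (NN : forall x, N (- x) = N x)
    (ND : forall x y, N (x + y) <= Num.max (N x) (N y))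
    (Ncomp : norm_complete N) (u : nat -> V) (e : nat -> R) :
  (forall m n, (m <= n)%N -> e n <= e m) ->
  (forall d, 0 < d -> exists n, e n < d) -> (forall n, 0 <= e n) ->
  N 0 = 0 ->
  (forall n, N (u n.+1 - u n) <= e n) ->
  exists l, forall n, N (l - u n) <= e n.
Proof.
move=> e_dec e_lim e0 N0 ue.
have tail m n : (n <= m)%N -> N (u m - u n) <= e n.
  move=> /subnK <-; elim: (m - n)%N => [|k IH]; first by rewrite add0n subrr N0.
  rewrite addSn -(subrKA (u (k + n)%N)); apply: le_trans (ND _ _) _.
  by rewrite ge_max IH (le_trans (ue _))// e_dec// leq_addl.
have Nsym x y : N (x - y) = N (y - x) by rewrite -NN opprB.
have [l ul] : exists l, norm_cvg N u l.
  apply: Ncomp => d /e_lim[n0 en0]; exists n0 => m n mn nn.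
  rewrite -(subrKA (u n0)); apply: le_lt_trans (ND _ _) _.
  by rewrite gt_max [N (u n0 - _)]Nsym !(le_lt_trans (tail _ _ _) en0).
exists l => n; rewrite leNgt; apply/negP => lt.
have d0 : 0 < N (l - u n) by exact: le_lt_trans lt.
have /cvgrPdist_lt/(_ _ d0)[m0 _ mP] := ul.
have /= := mP (maxn m0 n) (leq_maxl _ _).
rewrite sub0r normrN => /(le_lt_trans (ler_norm _)) lt2.
have := ND (l - u (maxn m0 n)) (u (maxn m0 n) - u n); rewrite subrKA.
apply/negP; rewrite -ltNge gt_max Nsym lt2 /=.
by apply: le_lt_trans lt; apply: tail; exact: leq_maxr.
Qed.

Section GaussCompletion.
Context (R : realType) (F : finFieldType) (K : fieldType).
Context (iF : {rmorphism F -> K}) (Oinf : set K) (C : fieldType).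
Context (iC : {rmorphism F -> C}) (abs : C -> R).
Local Notation A := (ringA iF Oinf).
Local Notation cA := (@constA F K iF Oinf).
Local Notation AC := (tensA iF Oinf iC).
Hypothesis abs_ge0 : forall x, 0 <= abs x.
Hypothesis abs_eq0 : forall x, abs x = 0 <-> x = 0.
Hypothesis absM : forall x y, abs (x * y) = abs x * abs y.
Hypothesis absD : forall x y, abs (x + y) <= Num.max (abs x) (abs y).
Hypothesis abs_complete : norm_complete abs.

Lemma abs0 : abs 0 = 0. Proof. exact/abs_eq0. Qed.

Lemma abs1 : abs 1 = 1.
Proof.
have n0 : abs 1 != 0 by apply/eqP => /abs_eq0/eqP; rewrite oner_eq0.
by apply: (mulfI n0); rewrite -absM !mulr1.
Qed.

Lemma absX x n : abs (x ^+ n) = abs x ^+ n.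
Proof. by elim: n => [|n IH]; rewrite ?expr0 ?abs1// !exprS absM IH. Qed.

Lemma abs_const c : abs (iC c) <= 1.
Proof.
rewrite leNgt; apply/negP => lt.
have := absX (iC c) #|F|; rewrite -rmorphXn expf_card => /eqP.
rewrite -{1}[abs _]expr1 => /eqP e; have := finNzRing_gt1 F => gt1.
have := ltr_eXn2l lt 1 #|F|; rewrite gt1 -e expr1 ltxx.
by [].
Qed.

Lemma absN x : abs (- x) = abs x.
Proof.
have le y : abs (- y) <= abs y.
  rewrite -mulN1r absM -(rmorph1 iC) -rmorphN.
  by rewrite ler_piMl ?abs_const.
by apply/le_anti; rewrite le /= -{1}(opprK x) le.
Qed.

Context (T : gauss_completion iF Oinf iC abs).
Local Notation N := (@gauss_norm _ _ _ _ _ _ _ _ T).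
Local Notation tg := (to_gauss T).

Lemma gauss_norm_0 : N 0 = 0.
Proof.
have := @gauss_normE _ _ _ _ _ _ _ _ T 0 (fun=> 0) (fun=> 0) _.
by rewrite !big_ord0 rmorph0; apply => c _ [].
Qed.

Lemma gauss_norm_ge0 x : 0 <= N x.
Proof.
have := gauss_normD x (- x); rewrite subrr gauss_norm_0 gauss_normN.
by rewrite maxxx.
Qed.

Lemma gauss_norm_sum I (r : seq I) (P : pred I) (x : I -> T) B : 0 <= B ->
  (forall i, P i -> N (x i) <= B) -> N (\sum_(i <- r | P i) x i) <= B.
Proof.
move=> B0 xB; elim/big_ind: _ => [||i Pi]; rewrite ?gauss_norm_0//; last exact: xB.
by move=> y z yB zB; apply: le_trans (gauss_normD _ _) _; rewrite ge_max yB.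
Qed.

Lemma gauss_normB x y : N (x - y) <= Num.max (N x) (N y).
Proof. by rewrite -(gauss_normN y); exact: gauss_normD. Qed.

Lemma lin_indep1 (a : A) : a != 0 -> lin_indep (fun _ : 'I_1 => a).
Proof.
move=> a0 d; rewrite big_ord1 => /ringA_mulf_eq0[|/eqP]; last by rewrite (negPf a0).
move=> d0 i; rewrite ord1; apply/eqP; apply: contraT => dn.
have : cA (d ord0)^-1 * cA (d ord0) = 0 by rewrite d0 mulr0.
by rewrite -rmorphM mulVf// rmorph1 => /eqP; rewrite oner_eq0.
Qed.

Lemma gauss_norm_tensorE (a : A) c : a != 0 -> N (tg (tensor a c)) = abs c.
Proof.
move=> /lin_indep1/(@gauss_normE _ _ _ _ _ _ _ _ T 1 (fun=> a) (fun=> c)).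
by rewrite big_ord1 big_ord_recl big_ord0 => ->; rewrite max_l.
Qed.

Lemma gauss_norm_tensor (a : A) c : N (tg (tensor a c)) <= abs c.
Proof.
have [->|a0] := eqVneq a 0; last by rewrite gauss_norm_tensorE.
have -> : tensor 0 c = 0 :> AC.
  by apply: (addrI (tensor 0 c : AC)); rewrite -tensorDl !addr0.
by rewrite rmorph0 gauss_norm_0.
Qed.

Lemma bigmax_attained n (c : 'I_n -> C) (B := \big[Num.max/0]_i abs (c i)) :
  0 < B -> exists i, B = abs (c i).
Proof.
have : B = 0 \/ exists i, B = abs (c i).
  rewrite /B; elim/big_ind: _ => [|x y|i _]; [by left| |by right; exists i].
  - move=> [->|[i ->]] [->|[j ->]]; rewrite ?maxxx; first by left.
    + by right; exists j; rewrite max_r.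
    + by right; exists i; rewrite max_l.
    + by right; case: leP => _; [exists j|exists i].
by case=> // ->; rewrite ltxx.
Qed.

Lemma le_gauss_coef n (a : 'I_n -> A) (c : 'I_n -> C) i : lin_indep a ->
  abs (c i) <= N (tg (\sum_i tensor (a i) (c i))).
Proof.
by move=> ai; rewrite gauss_normE//; exact: (le_bigmax _ (fun i => abs (c i))).
Qed.

Lemma to_gauss_inj : injective tg.
Proof.
suff ker x : tg x = 0 -> x = 0.
  by move=> x y xy; apply/eqP; rewrite -subr_eq0; apply/eqP/ker; rewrite rmorphB xy subrr.
have [n [a [c [ai ->]]]] := tensA_lin_indep x => e.
rewrite big1// => i _; have := le_gauss_coef c i ai.
rewrite e gauss_norm_0 => le0.
have -> : c i = 0 by apply/abs_eq0/le_anti; rewrite le0 abs_ge0.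
exact: (tensor0r constA iC (a i)).
Qed.

Lemma tensA_tau_tensor (a : A) c : tensA_tau (tensor a c : AC) = tensor a (c ^+ #|F|).
Proof.
exact: (talg_map_tensor (u := idfun) (v := frobq iC) (fun _ => erefl) (frobq_const iC)).
Qed.

Fact tensA_tau_zmod : zmod_morphism (@tensA_tau F K iF Oinf C iC).
Proof.
exact: (talg_map_zmod (u := idfun) (v := frobq iC) (f := constA) (f1 := constA)
  (fun _ => erefl) (frobq_const iC)).
Qed.
Fact tensA_tau_monoid : monoid_morphism (@tensA_tau F K iF Oinf C iC).
Proof.
exact: (talg_map_monoid (u := idfun) (v := frobq iC) (f := constA) (f1 := constA)
  (fun _ => erefl) (frobq_const iC)).
Qed.

HB.instance Definition _ := GRing.isZmodMorphism.Build AC AC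
  (@tensA_tau F K iF Oinf C iC) tensA_tau_zmod.
HB.instance Definition _ := GRing.isMonoidMorphism.Build AC AC
  (@tensA_tau F K iF Oinf C iC) tensA_tau_monoid.

Lemma gauss_norm_tau x : N (tg x) ^+ #|F| <= N (tg (tensA_tau x)).
Proof.
have [n [a [c [ai ->]]]] := tensA_lin_indep x.
have -> : tensA_tau (\sum_i (tensor (a i) (c i) : AC)) = \sum_i tensor (a i) (c i ^+ #|F|).
  by rewrite rmorph_sum; apply: eq_bigr => i _; exact: tensA_tau_tensor.
rewrite gauss_normE//; set B := \big[_/_]_i _.
have [B0|Bn0] := ltP 0 B.
  have [i Bi] := bigmax_attained B0; rewrite -/B in Bi.
  by rewrite Bi -absX; exact: (le_gauss_coef (fun i => c i ^+ #|F|)).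
have -> : B = 0.
  by apply/le_anti; rewrite Bn0; exact: (bigmax_ge_id _ _ _ (fun i => abs (c i))).
by rewrite expr0n (gtn_eqF (ltnW (finNzRing_gt1 F))) gauss_norm_ge0.
Qed.

Lemma gauss_approx x e : 0 < e -> exists y, N (x - tg y) < e.
Proof. by move=> /(gauss_dense x)[_ [y _ <-]]; exists y. Qed.

Lemma gauss_norm_eq x y : N (x - y) < N x -> N y = N x.
Proof.
move=> lt; apply/le_anti/andP; split.
  have := gauss_normB x (x - y); rewrite opprB addrC subrK.
  by rewrite max_l// ltW.
have := gauss_normD (x - y) y; rewrite subrK le_max => /orP[|//].
by move=> /(lt_le_trans lt); rewrite ltxx.
Qed.

Lemma gauss_tau_inj : injective (gauss_tau T).
Proof.
suff ker x : gauss_tau T x = 0 -> x = 0.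
  by move=> x y xy; apply/eqP; rewrite -subr_eq0; apply/eqP/ker; rewrite rmorphB xy subrr.
move=> tx; apply: gauss_norm0; apply/eqP; rewrite eq_le gauss_norm_ge0 andbT leNgt.
apply/negP => x0.
have /choice[u uP] : forall n, exists y, N (x - tg y) < N x / n.+1%:R.
  by move=> n; apply: gauss_approx; rewrite divr_gt0.
have ux : norm_cvg N (tg \o u) x.
  apply/cvgrPdist_lt => e e0.
  exists (Num.truncn (N x / e)) => // n /= ln.
  rewrite sub0r normrN ger0_norm ?gauss_norm_ge0// -gauss_normN opprB.
  apply: lt_le_trans (uP n) _; rewrite ler_pdivrMr// mulrC -ler_pdivrMr//.
  apply: ltW; apply: lt_le_trans (truncnS_gt _) _.
  by rewrite ler_nat ltnS.
have /cvgrPdist_lt/(_ (N x ^+ #|F|)) := gauss_tau_cont ux.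
rewrite exprn_gt0// => /(_ isT)[n0 _ /(_ n0 (leqnn _))] /=.
rewrite sub0r normrN tx subr0 ger0_norm ?gauss_norm_ge0// gauss_tauE.
apply/negP; rewrite -leNgt; apply: le_trans (gauss_norm_tau _).
rewrite (@gauss_norm_eq x)//; apply: lt_le_trans (uP n0) _.
by rewrite ler_pdivrMr// ler_peMr ?ler1n ?ltW.
Qed.

Section Division.
Context (hK : function_field iF) (a : A) (a0 : a != 0).

Lemma tensA_division : exists s (b : 'I_s -> A), forall d : AC,
  exists (c : 'I_s -> C) (y : AC),
    [/\ d = \sum_k (tensor (b k) (c k) : AC) + (tensor a 1 : AC) * y,
        forall k, abs (c k) <= N (tg d) & N (tg y) <= N (tg d)].
Proof.
have [s [b bspan]] := ringA_span hK a0; exists s, b => d.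
have [n [u [c [ui ->]]]] := tensA_lin_indep d.
have [f fP] := choice (fun i => bspan (u i)).
have [w wP] := choice fP.
set M := N _.
have M0 : 0 <= M by exact: gauss_norm_ge0.
have cM i : abs (c i) <= M by exact: le_gauss_coef.
exists (fun k => \sum_i iC (f i k) * c i), (\sum_i tensor (w i) (c i)); split.
- have e i : tensor (u i) (c i) =
      \sum_k tensor (b k) (iC (f i k) * c i) + (tensor a 1 : AC) * tensor (w i) (c i) :> AC.
    rewrite {1}(wP i) tensorDl mul_tensor mul1r; congr (_ + _).
    rewrite (tensor_suml constA iC); apply: eq_bigr => k _.
    exact: tensor_bal.
  rewrite (eq_bigr _ (fun i _ => e i)) big_split /= -mulr_sumr; congr (_ + _).
  rewrite exchange_big; apply: eq_bigr => k _.
  elim/big_rec2: _ => [|i y z _ ->]; first by symmetry; exact: (tensor0r constA iC (b k)).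
  by rewrite tensorDr.
- move=> k; elim/big_ind: _ => [||i _]; first by rewrite abs0.
    by move=> x y xM yM; apply: le_trans (absD _ _) _; rewrite ge_max xM.
  by rewrite absM; apply: le_trans (cM i); rewrite ler_piMl// abs_const.
- rewrite raddf_sum; apply: gauss_norm_sum => // i _.
  exact: le_trans (gauss_norm_tensor _ _) (cM i).
Qed.

Lemma gauss_division (x : T) : exists (t : AC) (y : T),
  x = tg t + tg (tensor a 1) * y /\ N (tg t) <= N x.
Proof.
have [->|x0] := eqVneq x 0.
  by exists 0, 0; rewrite mulr0 addr0 rmorph0 gauss_norm_0.
have Nx : 0 < N x.
  rewrite lt_neqAle gauss_norm_ge0 andbT; apply: contra_neq x0 => e.
  by apply: gauss_norm0.
have [s [b bP]] := tensA_division.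
pose eps n : R := N x / n.+1%:R.
have eps0 n : 0 < eps n by rewrite divr_gt0.
have eps_dec m n : (m <= n)%N -> eps n <= eps m.
  by move=> mn; rewrite ler_pM2l// lef_pV2 ?posrE// ler_nat ltnS.
have eps_lim d : 0 < d -> exists n, eps n < d.
  move=> d0; exists (Num.truncn (N x / d)).
  rewrite /eps ltr_pdivrMr// mulrC -ltr_pdivrMr//; exact: truncnS_gt.
have eps_le n : eps n <= N x.
  by rewrite ler_pdivrMr// ler_peMr ?ler1n ?ltW.
have /choice[u uP] : forall n, exists y, N (x - tg y) < eps n.
  by move=> n; apply: gauss_approx.
pose d n := if n is m.+1 then u m.+1 - u m else u 0%N.
have du n : u n = \sum_(i < n.+1) d i.
  elim: n => [|n IH]; first by rewrite big_ord1.
  by rewrite big_ord_recr -IH /= addrC subrK.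
have dN n : N (tg (d n.+1)) <= eps n.
  rewrite /= rmorphB -(subrKA x); apply: le_trans (gauss_normD _ _) _.
  rewrite ge_max -(gauss_normN (_ - x)) opprB.
  by rewrite (le_trans (ltW (uP _)) (eps_dec _ _ (leqnSn _))) ltW.
have d0N : N (tg (d 0%N)) <= N x.
  rewrite -[tg _](subKr x); apply: le_trans (gauss_normB _ _) _.
  by rewrite ge_max lexx (le_trans (ltW (uP 0%N))).
have [c cP] := choice (fun n => bP (d n)).
have [y yP] := choice cP.
pose cs k n := \sum_(i < n.+1) c i k.
pose ys n := \sum_(i < n.+1) tg (y i).
have /choice[cl clP] : forall k, exists z, forall n, abs (z - cs k n) <= eps n.
  move=> k; apply: ultrametric_limit => //.
  - exact: absN.
  - by move=> n; exact: ltW.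
  - exact: abs0.
  - move=> n; rewrite /cs big_ord_recr addrC addKr /=.
    by case: (yP n.+1) => _ cn _; exact: le_trans (cn k) (dN n).
have [yl ylP] : exists yl, forall n, N (yl - ys n) <= eps n.
  apply: ultrametric_limit => //.
  - exact: gauss_normN.
  - exact: gauss_normD.
  - exact: gauss_complete.
  - by move=> n; exact: ltW.
  - exact: gauss_norm_0.
  - move=> n; rewrite /ys big_ord_recr addrC addKr /=.
    by case: (yP n.+1) => _ _ cn; exact: le_trans cn (dN n).
have uE n : tg (u n) = \sum_k tg (tensor (b k) (cs k n)) + tg (tensor a 1) * ys n.
  rewrite /ys mulr_sumr; transitivity (\sum_(i < n.+1) tg (d i)).
    by rewrite du rmorph_sum.
  have e i : tg (d i) = \sum_k tg (tensor (b k) (c i k)) + tg (tensor a 1) * tg (y i).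
    by case: (yP i) => e _ _; rewrite [in LHS]e rmorphD rmorph_sum rmorphM.
  under eq_bigr => i _ do rewrite e.
  rewrite big_split /=; congr (_ + _).
  rewrite exchange_big; apply: eq_bigr => k _; rewrite /cs.
  elim/big_rec2: _ => [|i z z' _ ->].
    have e0 : tensor (b k) 0 = 0 :> AC by exact: (tensor0r constA iC (b k)).
    by rewrite e0 rmorph0.
  by rewrite tensorDr; symmetry; exact: (rmorphD tg).
have Na : N (tg (tensor a 1)) <= 1 by rewrite -abs1; exact: gauss_norm_tensor.
exists (\sum_k tensor (b k) (cl k)), yl; split.
  apply/eqP; rewrite -subr_eq0; apply/eqP/gauss_norm0; set z := _ - _.
  have zle n : N z <= eps n.
    have -> : z = (x - tg (u n)) + ((\sum_k tg (tensor (b k) (cs k n - cl k))) +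
        tg (tensor a 1) * (ys n - yl)).
      rewrite uE mulrBr /z rmorph_sum.
      have -> : \sum_k tg (tensor (b k) (cs k n - cl k)) =
          \sum_k tg (tensor (b k) (cs k n)) - \sum_k tg (tensor (b k) (cl k)).
        rewrite -sumrB; apply: eq_bigr => k _; rewrite -rmorphB; congr (tg _).
        apply/eqP; rewrite eq_sym subr_eq; apply/eqP.
        by rewrite -tensorDr subrK.
      move: (\sum_k _) (\sum_k _) (_ * _) (_ * _) => P P' Q Q'.
      by rewrite [P - P' + _]addrACA -opprD subrKA.
    apply: le_trans (gauss_normD _ _) _; rewrite ge_max ltW//=.
    apply: le_trans (gauss_normD _ _) _; rewrite ge_max; apply/andP; split.
      apply: gauss_norm_sum => [|k _]; first exact: ltW.
      apply: le_trans (gauss_norm_tensor _ _) _.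
      by rewrite -absN opprB.
    apply: le_trans (gauss_normM _ _) _; rewrite -(gauss_normN (ys n - yl)) opprB.
    apply: le_trans (ylP n).
    by rewrite ler_piMl ?gauss_norm_ge0.
  apply/eqP; rewrite eq_le gauss_norm_ge0 andbT leNgt; apply/negP => /eps_lim[n].
  by move=> /(le_lt_trans (zle n)); rewrite ltxx.
rewrite rmorph_sum; apply: gauss_norm_sum => [|k _]; first exact: ltW.
apply: le_trans (gauss_norm_tensor _ _) _.
rewrite -(subrK (cs k 0%N) (cl k)); apply: le_trans (absD _ _) _.
rewrite ge_max (le_trans (clP k 0%N))//= /cs big_ord1.
by case: (yP 0%N) => _ c0 _; exact: le_trans (c0 k) d0N.
Qed.

End Division.
End GaussCompletion.

(** * Maps of semilocalizations; twisted polynomials *)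

Section SemilocalMap.
Context (S S' : comPzRingType) (Q : frac_field S) (Q' : frac_field S').
Context (X : set S) (X' : set S') (g : {rmorphism S -> S'}).

Definition semiloc_map of injective g & (forall t, X t -> X' (g t)) :
    semiloc Q X -> semiloc Q' X' :=
  fun x => insubd 0 (frac_ext (to_frac Q) (to_frac Q' \o g) (semiloc_val x)).

Context (g_inj : injective g) (gX : forall t, X t -> X' (g t)).
Local Notation h := (semiloc_map g_inj gX).

Lemma to_frac_comp_inj : injective (to_frac Q' \o g).
Proof. by move=> x y /= /to_frac_inj /g_inj. Qed.

Definition frac_map : Q -> Q' :=
  frac_morph (@to_frac_inj _ Q) to_frac_comp_inj (@to_fracP _ Q).
HB.instance Definition _ := GRing.RMorphism.on frac_map.

Lemma frac_mapE x : frac_map (to_frac Q x) = to_frac Q' (g x).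
Proof. exact: frac_morphE. Qed.

Lemma semiloc_mapE x : semiloc_val (h x) = frac_map (semiloc_val x).
Proof. by rewrite -[LHS]/(val _) insubdK//; exact: semiloc_functorial. Qed.

Fact semiloc_map_zmod : zmod_morphism h.
Proof.
move=> x y; apply: semiloc_inj.
by rewrite semiloc_mapE !rmorphB /= !semiloc_mapE.
Qed.
Fact semiloc_map_monoid : monoid_morphism h.
Proof.
split=> [|x y]; apply: semiloc_inj; first by rewrite semiloc_mapE !rmorph1.
by rewrite semiloc_mapE !rmorphM /= !semiloc_mapE.
Qed.
HB.instance Definition _ :=
  GRing.isZmodMorphism.Build (semiloc Q X) (semiloc Q' X') h semiloc_map_zmod.
HB.instance Definition _ :=
  GRing.isMonoidMorphism.Build (semiloc Q X) (semiloc Q' X') h semiloc_map_monoid.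

Lemma semiloc_map_to x : h (to_semiloc Q X x) = to_semiloc Q' X' (g x).
Proof. by apply: semiloc_inj; rewrite semiloc_mapE /= frac_mapE. Qed.

End SemilocalMap.

Section TwistedPolynomials.
Context (F : finFieldType) (L : fieldType) (iL : {rmorphism F -> L}).
Local Notation q := #|F|.

Lemma q_gt0 : (0 < q)%N. Proof. exact: ltnW (finNzRing_gt1 F). Qed.

Lemma expr_frobX i (x y : L) : (x + y) ^+ (q ^ i) = x ^+ (q ^ i) + y ^+ (q ^ i).
Proof.
by apply: exprDn_pchar; rewrite pnatX (card_finField_pnat iL).
Qed.

Lemma coef_tw_mul (P P' : {poly L}) k :
  (tw_mul q P P')`_k = \sum_(i < k.+1) P`_i * P'`_(k - i) ^+ (q ^ i).
Proof.
pose g i := P`_i * P'`_(k - i) ^+ (q ^ i).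
have inner (i : nat) : (\sum_(j < size P') (P`_i * P'`_j ^+ (q ^ i)) *: 'X^(i + j))`_k =
    if (i < k.+1)%N then g i else 0.
  rewrite coef_sum; under eq_bigr => j _ do rewrite coefZ coefXn.
  case: ltnP => ik; last first.
    rewrite big1// => j _; rewrite (_ : (k == i + j)%N = false) ?mulr0//; lia.
  have [lt|ge] := ltnP (k - i) (size P').
    rewrite (bigD1 (Ordinal lt))//= subnKC// eqxx mulr1 big1 ?addr0// => j jk.
    rewrite (_ : (k == i + j)%N = false) ?mulr0//.
    by apply: contraNF jk => /eqP e; apply/eqP/val_inj; rewrite /= e addKn.
  rewrite /g [P'`_(_ - _)]nth_default// expr0n expn_eq0 (gtn_eqF q_gt0) mulr0 big1// => j _.
  rewrite (_ : (k == i + j)%N = false) ?mulr0//; have := ltn_ord j; lia.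
rewrite /tw_mul coef_sum; under eq_bigr => i _ do rewrite inner.
rewrite -big_mkcond /= [RHS](eq_bigr (fun i : 'I_k.+1 => g i))//.
transitivity (\sum_(0 <= i < size P | (i < k.+1)%N) g i); first by rewrite big_mkord.
have g0 i : (size P <= i)%N -> g i = 0 by move=> ?; rewrite /g nth_default ?mul0r.
rewrite -(big_mkord xpredT g); have [le|le] := leqP (size P) k.+1.
  rewrite [RHS](big_cat_nat (n := size P))//= [X in _ + X]big_nat_cond.
  rewrite [X in _ + X]big1 ?addr0; last by move=> i /andP[/andP[+ _] _] => /g0.
  rewrite big_nat_cond [RHS]big_nat_cond; apply: eq_bigl => i /=.
  by rewrite andbT; apply: andb_idr => ip; exact: leq_trans ip le.
rewrite (big_cat_nat (n := k.+1)) ?(ltnW le)//= [X in _ + X]big_nat_cond.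
rewrite [X in _ + X]big1 ?addr0; last by move=> i; lia.
rewrite big_nat_cond [RHS]big_nat_cond; apply: eq_bigl => i /=.
by rewrite andbT andbb.
Qed.

Lemma tw_mulDr (P P1 P2 : {poly L}) :
  tw_mul q P (P1 + P2) = tw_mul q P P1 + tw_mul q P P2.
Proof.
apply/polyP => k; rewrite coefD !coef_tw_mul -big_split /=.
by apply: eq_bigr => i _; rewrite coefD expr_frobX mulrDr.
Qed.

Lemma tw_mulX (P : {poly L}) k :
  (tw_mul q 'X P)`_k = if k is k'.+1 then P`_k' ^+ q else 0.
Proof.
rewrite coef_tw_mul; case: k => [|k].
  by rewrite big_ord1 coefX mul0r.
rewrite big_ord_recl coefX mul0r add0r big_ord_recl coefX mul1r /= subSS subn0 expn1.
by rewrite big1 ?addr0// => i _; rewrite coefX mul0r.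
Qed.

Lemma tw_mulmxDr m n k (X : 'M[{poly L}]_(m, n)) (Y Z : 'M[{poly L}]_(n, k)) :
  tw_mulmx q X (Y + Z) = tw_mulmx q X Y + tw_mulmx q X Z.
Proof.
apply/matrixP => i j; rewrite !mxE -big_split; apply: eq_bigr => h _.
by rewrite mxE tw_mulDr.
Qed.

Lemma nilpotent_frob_scalar d (M : 'M[L]_d) (l : L) n :
  (M - l%:M) ^+ n = 0 -> M ^+ q = M -> l ^+ q = l -> M = l%:M.
Proof.
case: d M => [|d] M nil Mq lq; first by rewrite (flatmx0 M) (flatmx0 _%:M).
apply/eqP; rewrite -subr_eq0; apply/eqP; set X := M - _.
have XE : X = horner_mx M ('X - l%:P).
  by rewrite rmorphB /= horner_mx_X horner_mx_C.
have Xq : X ^+ q = X.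
  have e : ('X - l%:P) ^+ q = 'X^q - (l ^+ q)%:P.
    have pq : [pchar {poly L}].-nat q.
      exact: (card_finField_pnat (GRing.RMorphism.clone _ _ (@polyC L \o iL) _)).
    by apply/eqP; rewrite eq_sym subr_eq polyC_exp -exprDn_pchar// subrK.
  by rewrite XE -rmorphXn e lq !rmorphB rmorphXn /= horner_mx_X horner_mx_C Mq.
have Xqj j : X ^+ (q ^ j) = X by elim: j => [|j IH]; rewrite ?expr1// expnS exprM Xq.
rewrite -(Xqj n) -(subnK (ltnW (ltn_expl n (finNzRing_gt1 F)))) exprD.
by rewrite -/X in nil; rewrite nil mulr0.
Qed.

Lemma derivation_finField (d : F -> L) :
  (forall x y, d (x * y) = iL x * d y + d x * iL y) -> forall x, d x = 0.
Proof.
move=> dM x.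
have dX n : d (x ^+ n.+1) = n.+1%:R * iL x ^+ n * d x.
  elim: n => [|n IH]; first by rewrite expr1 expr0 !mul1r.
  rewrite exprS dM IH rmorphXn /= -[in RHS]natr1 exprS.
  move: (n.+1%:R) (iL x) (d x) => N a D; ring.
rewrite -(expf_card x) -(prednK q_gt0) dX prednK ?q_gt0//.
by rewrite (card_finField_natr0 iL) !mul0r.
Qed.

End TwistedPolynomials.

(** * Semilinearity of tau on the motive *)

Lemma tens_lift_sum (S : Type) (M N V : zmodType) (aM : S -> M -> M)
    (aN : S -> N -> N) (b : M -> N -> V) I (r : seq I) (P : pred I)
    (x : I -> M) (y : I -> N) : balanced aM aN b ->
  tens_lift b (\sum_(i <- r | P i) (tensor (x i) (y i) : tens aM aN)) =
  \sum_(i <- r | P i) b (x i) (y i).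
Proof.
move=> bP; elim/big_rec2: _ => [|i u w _ <-]; first exact: tens_lift0.
by rewrite tens_liftD ?tens_lift_tensor.
Qed.

Section AndersonModule.
Context (F : finFieldType) (K : fieldType) (iF : {rmorphism F -> K}).
Context (Oinf : set K) (L : fieldType) (ell : {rmorphism K -> L}).
Local Notation A := (ringA iF Oinf).
Local Notation cA := (@constA F K iF Oinf).
Local Notation q := #|F|.
Local Notation iL := (ell \o iF).
Local Notation AL := (tensA iF Oinf iL).
Context (E : anderson_module iF Oinf ell).
Local Notation d := (anderson_dim E).
Local Notation phi := (anderson_phi E).

Let iL' : {rmorphism F -> L} := ell \o iF.

Lemma coef_tw_mulmx m n l (X : 'M[{poly L}]_(m, n)) (Y : 'M[{poly L}]_(n, l)) i j k :
  (tw_mulmx q X Y i j)`_k =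
  \sum_h \sum_(a < k.+1) (X i h)`_a * (Y h j)`_(k - a) ^+ (q ^ a).
Proof.
by rewrite mxE coef_sum; apply: eq_bigr => h _; rewrite coef_tw_mul.
Qed.

Lemma iL_frob c k : iL' c ^+ (q ^ k) = iL' c.
Proof.
elim: k => [|k IH]; first by rewrite expr1.
by rewrite expnS exprM -rmorphXn expf_card IH.
Qed.

(* phi restricted to F: its constant term is semisimple with nilpotent
   difference from ell, and its higher terms are derivations of F. *)
Lemma anderson_phi_const c i j : phi (cA c) i j = (iL' c *+ (i == j))%:P.
Proof.
pose rho k (c : F) : 'M[L]_d := \matrix_(i, j) (phi (cA c) i j)`_k.
have rhoM k x y i0 j0 : rho k (x * y) i0 j0 =
    \sum_h \sum_(a < k.+1) rho a x i0 h * rho (k - a)%N y h j0 ^+ (q ^ a).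
  rewrite mxE rmorphM anderson_phiM coef_tw_mulmx.
  by apply: eq_bigr => h _; apply: eq_bigr => a _; rewrite !mxE.
have rho0M x y : rho 0%N (x * y) = rho 0%N x * rho 0%N y.
  apply/matrixP => i0 j0; rewrite rhoM [RHS]mxE; apply: eq_bigr => h _.
  by rewrite big_ord1 subn0 expr1.
have rho01 : rho 0%N 1 = 1.
  apply/matrixP => i0 j0; rewrite mxE rmorph1 anderson_phi1 !mxE.
  by case: eqP => _; rewrite ?coefC.
have rho0 x : rho 0%N x = (iL' x)%:M.
  have [n nil] := anderson_nilp E (cA x).
  apply: (@nilpotent_frob_scalar F L iL' _ _ _ n).
  - rewrite -[RHS]nil; congr ((_ - _) ^+ n).
    by apply/matrixP => i0 j0; rewrite !mxE.
  - have rhoX k : rho 0%N (x ^+ k) = rho 0%N x ^+ k.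
      by elim: k => [|k IH]; rewrite ?rho01// exprS rho0M IH -exprS.
    by rewrite -rhoX expf_card.
  - by rewrite -rmorphXn expf_card.
have rhoS k : (0 < k)%N -> forall x, rho k x = 0.
  elim/ltn_ind: k => k IH k0 x; apply/matrixP => i0 j0; rewrite [RHS]mxE.
  apply: (@derivation_finField F L iL' (fun z => rho k z i0 j0)) => y z.
  rewrite rhoM; under eq_bigr => h _.
    rewrite (bigD1 ord0)//= (bigD1 ord_max)//=; last by rewrite -val_eqE /= -lt0n.
    rewrite big1 => [|a /andP[a0 am]]; last first.
      rewrite (IH a); first by rewrite mxE mul0r.
        by rewrite ltn_neqAle am -ltnS ltn_ord.
      by rewrite lt0n.
    rewrite addr0 subn0 subnn expr1 !rho0 [_%:M i0 h]mxE [_%:M h j0]mxE.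
    over.
  rewrite big_split /=; congr (_ + _).
    rewrite (bigD1 i0)//= eqxx mulr1n big1 ?addr0// => h hi.
    by rewrite eq_sym (negPf hi) mulr0n mul0r.
  rewrite (bigD1 j0)//= eqxx mulr1n iL_frob big1 ?addr0// => h hj.
  by rewrite (negPf hj) mulr0n expr0n expn_eq0 (gtn_eqF (q_gt0 F)) mulr0.
apply/polyP => k; rewrite coefC.
have -> : (phi (cA c) i j)`_k = rho k c i j by rewrite mxE.
by case: k => [|k]; rewrite ?rho0 ?rhoS// mxE.
Qed.

Lemma anderson_phi_constM c a : phi (cA c * a) = map_mx (fun P => iL' c *: P) (phi a).
Proof.
apply/matrixP => i j; rewrite anderson_phiM; apply/polyP => k.
rewrite coef_tw_mulmx mxE coefZ (bigD1 i)//= big_ord_recl big1 => [|a' _]; last first.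
  by rewrite anderson_phi_const coefC mul0r.
rewrite addr0 anderson_phi_const coefC eqxx mulr1n subn0 expr1 big1 ?addr0// => h hi.
rewrite big1// => a' _; rewrite anderson_phi_const eq_sym (negPf hi) mulr0n.
by rewrite coefC if_same mul0r.
Qed.

Lemma tw_mulmx_constr m n l (X : 'M[{poly L}]_(m, n)) (Y : 'M[{poly L}]_(n, l)) c :
  tw_mulmx q X (map_mx (fun P => iL' c *: P) Y) =
  map_mx (fun P => iL' c *: P) (tw_mulmx q X Y).
Proof.
apply/matrixP => i j; apply/polyP => k; rewrite coef_tw_mulmx [in RHS]mxE coefZ.
rewrite coef_tw_mulmx mulr_sumr; apply: eq_bigr => h _; rewrite mulr_sumr.
by apply: eq_bigr => a _; rewrite mxE coefZ exprMn iL_frob mulrCA.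
Qed.

Lemma motive_act_balanced (m : motive E) : balanced (scal_by cA) (scal_by iL)
  (fun (a : A) (l : L) =>
    map_mx (fun P : {poly L} => l *: P) (tw_mulmx q m (phi a)) : motive E).
Proof.
split=> [a a' l|a l l'|c a l].
- rewrite anderson_phiD (tw_mulmxDr iL'); apply/matrixP => i j.
  by rewrite !mxE scalerDr.
- by apply/matrixP => i j; rewrite !mxE scalerDl.
- rewrite /scal_by anderson_phi_constM tw_mulmx_constr; apply/matrixP => i j.
  by rewrite ![map_mx _ _ _ _]mxE scalerA mulrC.
Qed.

Lemma motive_tauD (m m' : motive E) : motive_tau (m + m') = motive_tau m + motive_tau m'.
Proof. by apply/matrixP => i j; rewrite !mxE (tw_mulDr iL'). Qed.

Lemma motive_tau0 : motive_tau (0 : motive E) = 0.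
Proof. by apply: (addrI (motive_tau (0 : motive E))); rewrite -motive_tauD !addr0. Qed.

Lemma motive_tau_act (t : AL) (m : motive E) :
  motive_tau (motive_act t m) = motive_act (tensA_tau t) (motive_tau m).
Proof.
have balm := motive_act_balanced m; have balt := motive_act_balanced (motive_tau m).
elim/tens_ind: t => [|a l t IH].
  rewrite /motive_act (tens_lift0 balm) motive_tau0.
  by rewrite [tensA_tau _](raddf0 (@tensA_tau F K iF Oinf L iL')) (tens_lift0 balt).
rewrite /motive_act (tens_liftD balm) motive_tauD.
rewrite [tensA_tau _](raddfD (@tensA_tau F K iF Oinf L iL')) (tens_liftD balt).
congr (_ + _); last exact: IH.
rewrite (tens_lift_tensor balm) /= (tensA_tau_tensor iL') (tens_lift_tensor balt).
apply/matrixP => i j; apply/polyP => k.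
rewrite [in RHS]mxE coefZ coef_tw_mulmx mxE tw_mulX; case: k => [|k].
  rewrite big1 ?mulr0// => h _; rewrite big_ord1 mxE tw_mulX mul0r.
  by [].
rewrite mxE coefZ exprMn; congr (_ * _).
rewrite coef_tw_mulmx -[LHS]/(frobq iL' _) rmorph_sum; apply: eq_bigr => h _.
rewrite rmorph_sum [RHS]big_ord_recl mxE tw_mulX mul0r add0r.
apply: eq_bigr => b _; rewrite tw_mulX /= /frobq exprMn /bump /= add1n subSS.
by rewrite -exprM -expnSr.
Qed.

Section Localization.
Context (Q : frac_field AL) (p : set A).
Hypothesis tau_inj : injective (@tensA_tau F K iF Oinf L iL').
Local Notation X := (ideal_tensA iL p).
Local Notation Sp := (semiloc Q X).

Lemma ideal_tensA_tau t : X t -> X (tensA_tau t).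
Proof.
move=> [a pa <-]; exists a => //.
by rewrite (tensA_tau_tensor iL') expr1n.
Qed.

Definition loc_tau : Sp -> Sp := semiloc_map Q tau_inj ideal_tensA_tau.
HB.instance Definition _ := GRing.RMorphism.on loc_tau.

Lemma motive_loc_tau_balanced : balanced (scal_by (to_semiloc Q X))
  (@motive_act _ _ _ _ _ _ E)
  (fun x m => tensor (loc_tau x) (motive_tau m) : motive_loc E Q p).
Proof.
split=> [x y m|x m m'|s x m].
- by rewrite rmorphD tensorDl.
- by rewrite motive_tauD tensorDr.
- rewrite /scal_by rmorphM /= {1}/loc_tau semiloc_map_to motive_tau_act.
  exact: tensor_bal.
Qed.

Lemma motive_loc_tauD (v w : motive_loc E Q p) :
  motive_loc_tau (v + w) = motive_loc_tau v + motive_loc_tau w.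
Proof. exact: (tens_liftD motive_loc_tau_balanced). Qed.

Lemma motive_loc_tauZ (x : Sp) (v : motive_loc E Q p) :
  motive_loc_tau (x *: v) = loc_tau x *: motive_loc_tau v.
Proof.
have z0 : motive_loc_tau (0 : motive_loc E Q p) = 0.
  exact: (tens_lift0 motive_loc_tau_balanced).
elim/tens_ind: v => [|y m v IH]; first by rewrite scaler0 z0 scaler0.
rewrite [_ *: _]scalerDr [LHS]motive_loc_tauD [in RHS]motive_loc_tauD scalerDr.
congr (_ + _); last exact: IH.
have tE (y' : Sp) : motive_loc_tau (tensor y' m : motive_loc E Q p) =
    tensor (loc_tau y') (motive_tau m).
  exact: (tens_lift_tensor motive_loc_tau_balanced).
rewrite [x *: _](scext_scale_tensor) [LHS]tE tE rmorphM.
by symmetry; exact: scext_scale_tensor.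
Qed.

End Localization.
End AndersonModule.

(** * The p-adic completion *)

Section ProjectiveLimitMaps.
Context (R : nat -> comPzRingType) (f : forall n, {rmorphism R n.+1 -> R n}).

Definition plim_pr n (x : plim f) : R n := plim_coord x n.
HB.instance Definition _ n := GRing.isZmodMorphism.Build (plim f) (R n)
  (plim_pr n) (fun x y => erefl).
HB.instance Definition _ n := GRing.isMonoidMorphism.Build (plim f) (R n)
  (plim_pr n) (erefl, fun x y => erefl).

Lemma plim_diag_rmorph (S : comPzRingType) (g : forall n, {rmorphism S -> R n})
    (gf : forall n x, f n (g n.+1 x) = g n x) :
  zmod_morphism (plim_diag gf) * monoid_morphism (plim_diag gf).
Proof.
split; first by move=> x y; apply: plimP => n; exact: rmorphB.
by split=> [|x y]; apply: plimP => n; [exact: rmorph1|exact: rmorphM].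
Qed.

Context (R' : nat -> comPzRingType) (f' : forall n, {rmorphism R' n.+1 -> R' n}).
Context (g : forall n, {rmorphism R n -> R' n}).
Context (gf : forall n x, f' n (g n.+1 x) = g n (f n x)).

Lemma plim_map_rmorph : zmod_morphism (plim_map (f := f) (f' := f') (g := g) gf) * monoid_morphism (plim_map (f := f) (f' := f') (g := g) gf).
Proof.
split; first by move=> x y; apply: plimP => n; exact: rmorphB.
by split=> [|x y]; apply: plimP => n; [exact: rmorph1|exact: rmorphM].
Qed.

Lemma plim_map_inj : (forall n, injective (g n)) -> injective (plim_map (f := f) (f' := f') (g := g) gf).
Proof.
move=> g_inj x y xy; apply: plimP => n; apply: g_inj.
by rewrite -[LHS]/(plim_coord (plim_map (f := f) (f' := f') (g := g) gf x) n) xy.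
Qed.

Lemma plim_map_image (y : plim f') : (forall n, injective (g n)) ->
  (forall n, exists x, plim_coord y n = g n x) -> exists x, plim_map (f := f) (f' := f') (g := g) gf x = y.
Proof.
move=> g_inj yg.
have ex n : {x | plim_coord y n = g n x} by exact: cid (yg n).
have compat n : f n (sval (ex n.+1)) = sval (ex n).
  apply: g_inj; rewrite -gf.
  by case: (ex n) => u /= <-; case: (ex n.+1) => w /= <-; exact: plim_compat.
by exists (PLim compat); apply: plimP => n /=; case: (ex n).
Qed.

End ProjectiveLimitMaps.

Section Padic.
Context (F : finFieldType) (K : fieldType) (iF : {rmorphism F -> K}).
Context (Oinf : set K) (p : set (ringA iF Oinf)).
Local Notation A := (ringA iF Oinf).
Local Notation cA := (@constA F K iF Oinf).

Section Maps.
Context (E : comPzRingType) (iE : F -> E).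

HB.instance Definition _ := GRing.isZmodMorphism.Build A (padicA p) (to_padicA p)
  (plim_diag_rmorph (g := fun n => quot_pi (ideal_pow p n.+1))
     (fun n x => quot_proj_pi (@ideal_powS F K iF Oinf p n.+1) x)).1.
HB.instance Definition _ := GRing.isMonoidMorphism.Build A (padicA p) (to_padicA p)
  (plim_diag_rmorph (g := fun n => quot_pi (ideal_pow p n.+1))
     (fun n x => quot_proj_pi (@ideal_powS F K iF Oinf p n.+1) x)).2.

HB.instance Definition _ := GRing.isZmodMorphism.Build (tensA iF Oinf iE)
  (padicT p iE) (@tensA_to_padicT _ _ _ _ p E iE)
  (plim_diag_rmorph (f := fun n => @residueT_proj _ _ _ _ p E iE n)
    (g := fun n => @to_residueT _ _ _ _ p E iE n)
    (@to_residueT_compat F K iF Oinf p E iE)).1.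
HB.instance Definition _ := GRing.isMonoidMorphism.Build (tensA iF Oinf iE)
  (padicT p iE) (@tensA_to_padicT _ _ _ _ p E iE)
  (plim_diag_rmorph (f := fun n => @residueT_proj _ _ _ _ p E iE n)
    (g := fun n => @to_residueT _ _ _ _ p E iE n)
    (@to_residueT_compat F K iF Oinf p E iE)).2.

HB.instance Definition _ := GRing.isZmodMorphism.Build (padicA p) (padicT p iE)
  (padicA_to_padicT iE)
  (plim_map_rmorph (f := fun n => @residue_proj _ _ _ _ p n)
    (f' := fun n => @residueT_proj _ _ _ _ p E iE n)
    (g := fun n => @tensl _ _ _ (@residue_const _ _ _ _ p n) iE)
    (@padicA_to_padicT_compat F K iF Oinf p E iE)).1.
HB.instance Definition _ := GRing.isMonoidMorphism.Build (padicA p) (padicT p iE)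
  (padicA_to_padicT iE)
  (plim_map_rmorph (f := fun n => @residue_proj _ _ _ _ p n)
    (f' := fun n => @residueT_proj _ _ _ _ p E iE n)
    (g := fun n => @tensl _ _ _ (@residue_const _ _ _ _ p n) iE)
    (@padicA_to_padicT_compat F K iF Oinf p E iE)).2.

Lemma tensA_to_padicT_const a :
  tensA_to_padicT p (tensor a 1 : tensA iF Oinf iE) = padicA_to_padicT iE (to_padicA p a).
Proof. by apply: plimP => n; exact: talg_map_tensor. Qed.

Context (E' : comPzRingType) (iE' : F -> E') (u : {rmorphism E -> E'}).
Context (uE : forall c, u (iE c) = iE' c).

HB.instance Definition _ := GRing.RMorphism.copy (tensA_map (Oinf := Oinf) uE)
  (talg_map (f := cA) (f1 := cA) (u := idfun) (fun _ => erefl) uE).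

Lemma tensA_map_tensor a x :
  tensA_map uE (tensor a x : tensA iF Oinf iE) = tensor a (u x).
Proof. exact: (talg_map_tensor (u := idfun) (f := cA)). Qed.

HB.instance Definition _ := GRing.isZmodMorphism.Build (padicT p iE) (padicT p iE')
  (padicT_map p uE)
  (plim_map_rmorph (f := fun n => @residueT_proj _ _ _ _ p E iE n)
    (f' := fun n => @residueT_proj _ _ _ _ p E' iE' n)
    (g := fun n => @residueT_map _ _ _ _ p E E' iE iE' u uE n)
    (@residueT_map_compat F K iF Oinf p E E' iE iE' u uE)).1.
HB.instance Definition _ := GRing.isMonoidMorphism.Build (padicT p iE) (padicT p iE')
  (padicT_map p uE)
  (plim_map_rmorph (f := fun n => @residueT_proj _ _ _ _ p E iE n)
    (f' := fun n => @residueT_proj _ _ _ _ p E' iE' n)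
    (g := fun n => @residueT_map _ _ _ _ p E E' iE iE' u uE n)
    (@residueT_map_compat F K iF Oinf p E E' iE iE' u uE)).2.

Lemma residueT_map_tensor n (a : residue p n) x :
  residueT_map uE (tensor a x : residueT p iE n) = tensor a (u x).
Proof. exact: (talg_map_tensor (u := idfun)). Qed.

Lemma residueT_map_to n (t : tensA iF Oinf iE) :
  residueT_map uE (to_residueT p n t) = to_residueT p n (tensA_map uE t).
Proof.
elim/tens_ind: t => [|a x t IH]; first by rewrite !rmorph0.
rewrite (rmorphD (@to_residueT _ _ _ _ p E iE n)) (rmorphD (@residueT_map _ _ _ _ p _ _ _ _ _ uE n)).
rewrite (rmorphD (tensA_map uE)) (rmorphD (@to_residueT _ _ _ _ p E' iE' n)).
congr (_ + _); last exact: IH.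
rewrite /= tensA_map_tensor /to_residueT /residueT_map.
by rewrite !talg_map_tensor.
Qed.

Lemma padicT_map_const b : padicT_map p uE (padicA_to_padicT iE b) = padicA_to_padicT iE' b.
Proof.
apply: plimP => n; apply: (etrans (talg_map_tensor _ _ _ _)).
by rewrite rmorph1.
Qed.

End Maps.

Lemma padicT_map_comp (E1 E2 E3 : comPzRingType)
    (i1 : F -> E1) (i2 : F -> E2) (i3 : F -> E3)
    (u : {rmorphism E1 -> E2}) (w : {rmorphism E2 -> E3}) (v : {rmorphism E1 -> E3})
    (uE : forall c, u (i1 c) = i2 c) (wE : forall c, w (i2 c) = i3 c)
    (vE : forall c, v (i1 c) = i3 c) :
  (forall x, w (u x) = v x) ->
  forall x, padicT_map p wE (padicT_map p uE x) = padicT_map p vE x.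
Proof.
move=> wu x; apply: plimP => n; rewrite /=; move: (plim_coord x n) => y.
elim/tens_ind: y => [|a c y IH]; first by rewrite !rmorph0.
rewrite (rmorphD (@residueT_map _ _ _ _ p _ _ _ _ _ uE n)).
rewrite (rmorphD (@residueT_map _ _ _ _ p _ _ _ _ _ wE n)).
rewrite (rmorphD (@residueT_map _ _ _ _ p _ _ _ _ _ vE n)).
congr (_ + _); last exact: IH.
transitivity (tensor a (w (u c)) : residueT p i3 n).
  by apply: etrans (residueT_map_tensor wE _ _); congr residueT_map; exact: residueT_map_tensor.
by rewrite wu; symmetry; exact: residueT_map_tensor.
Qed.

Lemma padicT_map_square (E1 E2 E2' E3 : comPzRingType)
    (i1 : F -> E1) (i2 : F -> E2) (i2' : F -> E2') (i3 : F -> E3)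
    (u : {rmorphism E1 -> E2}) (w : {rmorphism E2 -> E3})
    (u' : {rmorphism E1 -> E2'}) (w' : {rmorphism E2' -> E3})
    (uE : forall c, u (i1 c) = i2 c) (wE : forall c, w (i2 c) = i3 c)
    (uE' : forall c, u' (i1 c) = i2' c) (wE' : forall c, w' (i2' c) = i3 c) :
  (forall x, w (u x) = w' (u' x)) ->
  forall x, padicT_map p wE (padicT_map p uE x) = padicT_map p wE' (padicT_map p uE' x).
Proof.
move=> wu x; have vE c : (w \o u) (i1 c) = i3 c by rewrite /= uE wE.
rewrite (padicT_map_comp (v := w \o u) uE wE vE)//.
by rewrite (padicT_map_comp (v := w \o u) uE' wE' vE)// => y; rewrite /= wu.
Qed.

Context (hK : function_field iF) (hp : prime_ideal p) (hp0 : exists2 a, p a & a != 0).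

Let idfun_id n : forall x : residue p n, idfun x = x. Proof. by []. Qed.

Section FieldMaps.
Context (E E' : fieldType) (iE : {rmorphism F -> E}) (iE' : {rmorphism F -> E'}).
Context (u : {rmorphism E -> E'}) (uE : forall c, u (iE c) = iE' c).

Lemma residueT_map_inj n : injective (@residueT_map _ _ _ _ p _ _ _ _ u uE n).
Proof.
have [s [e [kap basis]]] := residue_basis hK hp hp0 n.
exact: (talg_map_injr basis (u := idfun) (idfun_id (n := n)) (@fmorph_inj _ _ u)).
Qed.

Lemma padicT_map_inj : injective (padicT_map p uE).
Proof. by apply: plim_map_inj => n; exact: residueT_map_inj. Qed.

Lemma padicT_map_image (y : padicT p iE') :
  (forall n, exists x, plim_coord y n = residueT_map uE x) -> exists x, padicT_map p uE x = y.
Proof. by apply: plim_map_image => n; exact: residueT_map_inj. Qed.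

Lemma padicT_unit_descent (x : padicT p iE) (y : padicT p iE') :
  padicT_map p uE x * y = 1 -> exists x', x * x' = 1.
Proof.
move=> xy.
suff [x' xy'] : exists x', padicT_map p uE x' = y.
  by exists x'; apply: padicT_map_inj; rewrite rmorphM rmorph1 /= xy'.
apply: padicT_map_image => n.
have [s [e [kap basis]]] := residue_basis hK hp hp0 n.
have xyn : residueT_map uE (plim_coord x n) * plim_coord y n = 1.
  by have := congr1 (fun z : padicT p iE' => plim_coord z n) xy.
have [x' xx'] := talg_unit_descent basis (u := idfun) (idfun_id (n := n))
  (uf := fun c => erefl) (vE := uE) xyn.
exists x'; rewrite -[LHS]mul1r -(rmorph1 (@residueT_map _ _ _ _ p _ _ _ _ u uE n)).
have <- : plim_coord x n * x' = 1 :> residueT p iE n by exact: xx'.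
by rewrite mulrC rmorphM mulrA (mulrC (plim_coord y n)) xyn mul1r.
Qed.

End FieldMaps.

Lemma padicA_to_padicT_inj (E : fieldType) (iE : {rmorphism F -> E}) :
  injective (@padicA_to_padicT _ _ _ _ p E iE).
Proof.
apply: plim_map_inj => n; have [s [e [kap basis]]] := residue_basis hK hp hp0 n.
exact: (tensl_inj basis (@fmorph_inj _ _ iE)).
Qed.

Lemma padicT_frob_fixed (C : fieldType) (iC : {rmorphism F -> C}) (x : padicT p iC) :
  padicT_map p (frobq_const iC) x = x -> exists b, padicA_to_padicT iC b = x.
Proof.
move=> xx; apply: (plim_map_image (f := fun n => @residue_proj _ _ _ _ p n)
    (f' := fun n => @residueT_proj _ _ _ _ p C iC n)
    (g := fun n => @tensl _ _ _ (@residue_const _ _ _ _ p n) iC)) => n.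
  have [s [e [kap basis]]] := residue_basis hK hp hp0 n.
  exact: (tensl_inj basis (@fmorph_inj _ _ iC)).
have [s [e [kap basis]]] := residue_basis hK hp hp0 n.
apply: (talg_frob_fixed basis (u := idfun) (idfun_id (n := n))).
exact: (congr1 (fun z : padicT p iC => plim_coord z n) xx).
Qed.

End Padic.

(** * The rigid trivialization as a matrix equation *)

Lemma talg_ext (S : Type) (R R' : comPzRingType) (f : S -> R) (g : S -> R')
    (V : zmodType) (h h' : {additive talg f g -> V}) :
  (forall x y, h (tensor x y) = h' (tensor x y)) -> forall t, h t = h' t.
Proof.
move=> hh; elim/tens_ind => [|x y t IH].
  by rewrite [LHS](raddf0 h) [RHS](raddf0 h').
by rewrite [LHS](raddfD h) [RHS](raddfD h') hh IH.
Qed.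

Section TateModule.
Context (R : realType) (F : finFieldType) (K : fieldType).
Context (iF : {rmorphism F -> K}) (Oinf : set K).
Context (L Cinf : fieldType).
Context (ell : {rmorphism K -> L}) (iLC : {rmorphism L -> Cinf}).
Context (abs : Cinf -> R) (hCinf : is_Cinf (iLC \o ell) Oinf abs).
Local Notation A := (ringA iF Oinf).
Local Notation iL := (ell \o iF).
Local Notation iC := (iLC \o iL).
Local Notation AL := (tensA iF Oinf iL).
Local Notation AC := (tensA iF Oinf iC).
Context (Q : frac_field AL) (p : set A).
Context (T : gauss_completion iF Oinf iC abs) (LL : frac_field T).
Local Notation tg := (to_gauss T).

Let iL' : {rmorphism F -> L} := ell \o iF.
Let iC' : {rmorphism F -> Cinf} := iLC \o (ell \o iF).
Let abs_ge0 := Cinf_abs_ge0 hCinf.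
Let abs_eq0 := Cinf_abs0 hCinf.
Let absM := Cinf_absM hCinf.

Let tg_inj : injective tg := @to_gauss_inj R F K iF Oinf Cinf iC' abs abs_ge0 abs_eq0 T.
Let gt_inj : injective (gauss_tau T) :=
  @gauss_tau_inj R F K iF Oinf Cinf iC' abs abs_ge0 abs_eq0 absM T.

Definition tens_incl : AL -> AC := tensA_map (u := iLC) (fun _ => erefl).
HB.instance Definition _ := GRing.RMorphism.on tens_incl.

Lemma tens_incl_tensor a l : tens_incl (tensor a l) = tensor a (iLC l).
Proof. exact: tensA_map_tensor. Qed.

Lemma tens_incl_inj : injective tens_incl.
Proof.
suff ker x : tens_incl x = 0 -> x = 0.
  by move=> x y xy; apply/eqP; rewrite -subr_eq0; apply/eqP/ker; rewrite rmorphB /= xy subrr.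
have [n [a [c [ai ->]]]] := tensA_lin_indep (iE := iL') x => e.
rewrite big1// => i _.
have := @le_gauss_coef R F K iF Oinf Cinf iC' abs T n a (iLC \o c) i ai.
have -> : \sum_i (tensor (a i) ((iLC \o c) i) : AC) = 0.
  rewrite -[RHS]e rmorph_sum; apply: eq_bigr => j _.
  by rewrite /= tens_incl_tensor.
rewrite rmorph0 gauss_norm_0 => le0.
have /eqP : iLC (c i) = 0 by apply/abs_eq0/le_anti; rewrite le0 abs_ge0.
by rewrite fmorph_eq0 => /eqP ->; exact: (tensor0r constA iL' (a i)).
Qed.

Lemma tens_incl_tau x : tens_incl (tensA_tau x) = tensA_tau (tens_incl x).
Proof.
pose tL : {rmorphism AL -> AL} := @tensA_tau F K iF Oinf L iL'.
pose tC : {rmorphism AC -> AC} := @tensA_tau F K iF Oinf Cinf iC'.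
apply: (@talg_ext _ _ _ _ _ _ (tens_incl \o tL) (tC \o tens_incl)) => a l.
rewrite /= (tensA_tau_tensor iL') !tens_incl_tensor (tensA_tau_tensor iC').
by rewrite rmorphXn.
Qed.

Lemma tensA_tau_inj : injective (@tensA_tau F K iF Oinf L iL').
Proof.
move=> x y /(congr1 (tg \o tens_incl)) /=.
by rewrite !tens_incl_tau -!gauss_tauE => /gt_inj/tg_inj/tens_incl_inj.
Qed.

Lemma tate_tau_ideal t :
  (to_gauss T @` ideal_tensA iC p) t -> (to_gauss T @` ideal_tensA iC p) (gauss_tau T t).
Proof.
move=> [_ [a pa <-] <-]; exists (tensor a 1); first by exists a.
by rewrite gauss_tauE (tensA_tau_tensor iC') expr1n.
Qed.

Definition tate_tau : tate_loc LL p -> tate_loc LL p :=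
  semiloc_map LL gt_inj tate_tau_ideal.
HB.instance Definition _ := GRing.RMorphism.on tate_tau.

Lemma tate_incl_inj : injective (tg \o tens_incl).
Proof. by move=> x y /= /tg_inj /tens_incl_inj. Qed.

Lemma tate_incl_ideal t : ideal_tensA iL p t ->
  (to_gauss T @` ideal_tensA iC p) ((tg \o tens_incl) t).
Proof.
move=> [a pa <-]; exists (tensor a 1); first by exists a.
by rewrite /= tens_incl_tensor rmorph1.
Qed.

Definition loc_incl : semiloc Q (ideal_tensA iL p) -> tate_loc LL p :=
  semiloc_map LL tate_incl_inj tate_incl_ideal.
HB.instance Definition _ := GRing.RMorphism.on loc_incl.

Lemma frac_map_incl (x : Q) :
  frac_map LL tate_incl_inj (frac_map Q tensA_tau_inj x) =
  frac_map LL gt_inj (frac_map LL tate_incl_inj x).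
Proof.
have [a [b [b0 ->]]] := to_fracP x.
rewrite !fmorph_div /= !frac_mapE /= !tens_incl_tau.
by rewrite !gauss_tauE.
Qed.

Lemma loc_incl_tau x : loc_incl (loc_tau tensA_tau_inj x) = tate_tau (loc_incl x).
Proof.
apply: semiloc_inj; rewrite /loc_incl /tate_tau /loc_tau !semiloc_mapE.
exact: frac_map_incl.
Qed.

Section Rigid.
Context (E : anderson_module iF Oinf ell) (r : nat).
Context (m : 'I_r -> motive_loc E Q p) (hm : is_basis m).
Context (Theta : 'M[semiloc Q (ideal_tensA iL p)]_r).
Hypothesis hTheta : forall i, motive_loc_tau (m i) = \sum_j Theta i j *: m j.
Context (Y : 'M[tate_loc LL p]_r).
Hypothesis hY : rigid_trivialization m Y.

Lemma rigid_matrix : map_mx tate_tau Y *m map_mx loc_incl Theta = Y.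
Proof.
have /choice[kap kapP] : forall v, exists c : 'rV_r,
    v = \sum_i c 0 i *: m i /\ forall c' : 'rV_r, v = \sum_i c' 0 i *: m i -> c = c'.
  by move=> v; have [c [? ?]] := hm v; exists c.
have kapE (c : 'rV_r) : kap (\sum_i c 0 i *: m i) = c by apply: (kapP _).2.
have kapD v w : kap (v + w) = kap v + kap w.
  apply: (kapP _).2; rewrite {1}(kapP v).1 {1}(kapP w).1 -big_split.
  by apply: eq_bigr => i _; rewrite mxE scalerDl.
have kapZ x v : kap (x *: v) = x *: kap v.
  apply: (kapP _).2; rewrite {1}(kapP v).1 scaler_sumr.
  by apply: eq_bigr => i _; rewrite mxE scalerA.
have kapm j : kap (m j) = delta_mx 0 j.
  rewrite -[RHS]kapE; congr kap; rewrite (bigD1 j)//= mxE !eqxx scale1r big1 ?addr0// => i ij.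
  by rewrite mxE (negPf ij) andbF scale0r.
pose aV x (v : motive_loc E Q p) := x *: v.
have balk k : balanced (scal_by (@semiloc_tate _ _ _ _ _ _ _ _ _ _ Q T LL p)) aV
    (fun y v => y * loc_incl (kap v 0 k)).
  split=> [y y' v|y v v'|x y v]; first by rewrite mulrDl.
    by rewrite kapD mxE rmorphD mulrDr.
  by rewrite /aV kapZ mxE rmorphM mulrCA mulrA.
have balt : balanced (scal_by (@semiloc_tate _ _ _ _ _ _ _ _ _ _ Q T LL p)) aV
    (fun y v => tensor (tate_tau y) (motive_loc_tau v) :
       scext (@semiloc_tate _ _ _ _ _ _ _ _ _ _ Q T LL p) aV).
  split=> [y y' v|y v v'|x y v]; first by rewrite rmorphD tensorDl.
    by rewrite (motive_loc_tauD tensA_tau_inj) tensorDr.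
  rewrite /aV (motive_loc_tauZ tensA_tau_inj).
  have -> : tate_tau (scal_by (@semiloc_tate _ _ _ _ _ _ _ _ _ _ Q T LL p) x y) =
      loc_incl (loc_tau tensA_tau_inj x) * tate_tau y.
    by rewrite loc_incl_tau -rmorphM.
  exact: tensor_bal.
apply/matrixP => i k.
have /(congr1 (tens_lift (fun y v => y * loc_incl (kap v 0 k)))) := hY i.
have -> : tens_map (@tate_loc_tau _ _ _ _ _ _ _ _ _ _ T LL p)
    (@motive_loc_tau _ _ _ _ _ _ E Q p)
    (\sum_j tensor (Y i j) (m j) : tens (scal_by (@semiloc_tate _ _ _ _ _ _ _ _ _ _ Q T LL p)) aV)
    = \sum_j tensor (tate_tau (Y i j)) (motive_loc_tau (m j))
     :> tens (scal_by (@semiloc_tate _ _ _ _ _ _ _ _ _ _ Q T LL p)) aV.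
  exact: (tens_lift_sum _ _ _ _ balt).
rewrite !(tens_lift_sum _ _ _ _ (balk k)) => e.
rewrite mxE; transitivity (\sum_j tate_tau (Y i j) * loc_incl (kap (motive_loc_tau (m j)) 0 k)).
  apply: eq_bigr => j _; rewrite !mxE; congr (_ * loc_incl _).
  have -> : motive_loc_tau (m j) = \sum_l (row j Theta) 0 l *: m l.
    by rewrite hTheta; apply: eq_bigr => l _; rewrite mxE.
  by rewrite kapE mxE.
rewrite [LHS]e (bigD1 k)//= kapm mxE !eqxx rmorph1 mulr1 big1 ?addr0// => j jk.
by rewrite kapm mxE eq_sym (negPf jk) andbF rmorph0 mulr0.
Qed.

End Rigid.
End TateModule.

(** * Separability of the entries of Upsilon *)

Lemma ideal_pow_kill (F : finFieldType) (K : fieldType) (iF : {rmorphism F -> K})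
    (Oinf : set K) (p : set (ringA iF Oinf)) n (S S' : comPzRingType)
    (X : set S) (g : {rmorphism ringA iF Oinf -> S}) (h : {rmorphism S -> S'}) w :
  (forall x, X x -> exists2 a, p a & x = g a) ->
  (forall a, ideal_pow p n a -> h (g a) = 0) ->
  ideal_pow X n w -> h w = 0.
Proof.
move=> Xg hg; apply: gen_ideal_kernel => _ [b Xb ->].
have /choice[a aP] : forall i, exists a, p a /\ b i = g a.
  by move=> i; have [a pa e] := Xg _ (Xb i); exists a.
have -> : \prod_i b i = g (\prod_i a i).
  by rewrite rmorph_prod; apply: eq_bigr => i _; case: (aP i).
by apply: hg; apply: gen_ideal_sub; exists a => // i; case: (aP i).
Qed.

Section PadicEmbedding.
Context (R : realType) (F : finFieldType) (K : fieldType).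
Context (iF : {rmorphism F -> K}) (hK : function_field iF) (Oinf : set K).
Context (L Cinf : fieldType).
Context (ell : {rmorphism K -> L}) (iLC : {rmorphism L -> Cinf}).
Context (abs : Cinf -> R) (hCinf : is_Cinf (iLC \o ell) Oinf abs).
Local Notation A := (ringA iF Oinf).
Local Notation iL := (ell \o iF).
Local Notation iC := (iLC \o iL).
Local Notation AL := (tensA iF Oinf iL).
Local Notation AC := (tensA iF Oinf iC).
Context (Q : frac_field AL) (p : set A) (hp : prime_ideal p).
Context (hp0 : exists2 a, p a & a != 0).
Context (T : gauss_completion iF Oinf iC abs) (LL : frac_field T).
Context (iota : {rmorphism tate_loc LL p -> padicT p iC}).
Context (hiota : natural_embedding iota).
Local Notation tg := (to_gauss T).
Local Notation XT := (to_gauss T @` ideal_tensA iC p).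
Local Notation toT := (to_semiloc LL XT).
Local Notation N := (@gauss_norm _ _ _ _ _ _ _ _ T).
Local Notation tau := (tate_tau hCinf (p := p) (LL := LL)).
Local Notation incl := (loc_incl (Q := Q) hCinf (p := p) LL).

Let iL' : {rmorphism F -> L} := ell \o iF.
Let iC' : {rmorphism F -> Cinf} := iLC \o (ell \o iF).

Definition iota_level n (x : tate_loc LL p) : residueT p iC n := plim_coord (iota x) n.
HB.instance Definition _ n :=
  GRing.RMorphism.copy (iota_level n) (@plim_pr _ _ n \o iota).
Local Notation lv := iota_level.

Lemma iota_level_to n t : lv n (toT (tg t)) = to_residueT p n t.
Proof. by rewrite /iota_level /= hiota.2. Qed.

Lemma residueT_kill n (a : A) : ideal_pow p n.+1 a ->
  to_residueT p n (tensor a 1 : AC) = 0.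
Proof.
move=> pa; rewrite [LHS](talg_map_tensor (f := constA)) /=.
have -> : quot_pi (ideal_pow p n.+1) a = 0.
  by apply/quot_piP; rewrite subr0; exact: gen_ideal_sub.
exact: (raddf0 (tensl (@residue_const F K iF Oinf p n) iC)).
Qed.

Let gC : {rmorphism A -> AC} := tensl constA iC.

Lemma iota_level_kill n w : ideal_pow XT n.+1 w -> lv n (toT w) = 0.
Proof.
apply: (@ideal_pow_kill F K iF Oinf p n.+1 _ _ XT (tg \o gC) (lv n \o toT)).
  by move=> _ [_ [a pa <-] <-]; exists a.
by move=> a pa; rewrite /= -[RHS](residueT_kill pa) -iota_level_to.
Qed.

Lemma level_element n : exists2 a, a != 0 & ideal_pow p n.+1 a.
Proof.
have [a pa a0] := hp0; exists (a ^+ n.+1); first exact: prime_ideal_expn0 hp a0.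
by apply: ideal_pow_expr; exact: gen_ideal_sub.
Qed.

Lemma tate_level_approx n (x : T) : exists t : AC, [/\ N (tg t) <= N x,
  lv n (toT x) = to_residueT p n t &
  lv n (tau (toT x)) = to_residueT p n (tensA_tau t)].
Proof.
have [a a0 pa] := level_element n.
have [t [y [xE tx]]] := @gauss_division R F K iF Oinf Cinf iC' abs
  (Cinf_abs_ge0 hCinf) (Cinf_abs0 hCinf) (Cinf_absM hCinf) (Cinf_absD hCinf)
  (Cinf_complete hCinf) T hK a a0 x.
have ka : lv n (toT (tg (tensor a 1))) = 0.
  by rewrite iota_level_to residueT_kill.
exists t; split=> //.
  by rewrite xE !rmorphD !rmorphM /= ka mul0r addr0 iota_level_to.
rewrite xE /= /tate_tau semiloc_map_to !rmorphD !rmorphM /= !gauss_tauE.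
by rewrite (tensA_tau_tensor iC') expr1n ka mul0r addr0 iota_level_to.
Qed.

Lemma iota_level_approx n x : exists t : AC, lv n x = to_residueT p n t /\
  lv n (tau x) = to_residueT p n (tensA_tau t).
Proof.
have [x' [w [Xw xE]]] := semiloc_approx x n.+1.
have [t [_ tx ttx]] := tate_level_approx n x'.
exists t; rewrite xE !(rmorphD, rmorphM) /= (iota_level_kill Xw) mul0r addr0.
split=> //; rewrite [X in _ + X](_ : _ = 0) ?addr0//.
rewrite /tate_tau semiloc_map_to.
suff -> : lv n (toT (gauss_tau T w)) = 0 by rewrite mul0r.
apply: (@ideal_pow_kill F K iF Oinf p n.+1 _ _ XT (tg \o gC) (lv n \o toT \o gauss_tau T)) Xw.
  by move=> _ [_ [a pa <-] <-]; exists a.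
move=> a pa; rewrite /= gauss_tauE (tensA_tau_tensor iC') expr1n.
by rewrite iota_level_to residueT_kill.
Qed.

Lemma iota_tau x : iota (tau x) = padicT_map p (frobq_const iC') (iota x).
Proof.
apply: plimP => n; have [t [e e']] := iota_level_approx n x.
rewrite [LHS]e' -[RHS]/(residueT_map (frobq_const iC') (lv n x)) e.
by rewrite residueT_map_to.
Qed.

Lemma iota_incl_level n (x : semiloc Q (ideal_tensA iL p)) :
  exists t : AL, lv n (incl x) =
    residueT_map (u := iLC) (iE := iL) (fun _ => erefl) (to_residueT p n t).
Proof.
have [t [w [Xw xE]]] := semiloc_approx x n.+1; exists t.
pose gL : {rmorphism A -> AL} := tensl constA iL.
have kw : lv n (incl (to_semiloc Q _ w)) = 0.
  apply: (@ideal_pow_kill F K iF Oinf p n.+1 _ _ (ideal_tensA iL p) gL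
    (lv n \o incl \o to_semiloc Q _)) Xw.
    by move=> _ [a pa <-]; exists a.
  move=> a pa; rewrite /= /loc_incl semiloc_map_to /= tens_incl_tensor rmorph1.
  by rewrite iota_level_to residueT_kill.
rewrite {1}xE !(rmorphD, rmorphM) /= kw mul0r addr0 /loc_incl semiloc_map_to /=.
by rewrite iota_level_to residueT_map_to.
Qed.

Local Notation inclC := (padicT_map p (u := iLC) (iE := iL) (fun _ => erefl)).

Lemma iota_incl_image (x : semiloc Q (ideal_tensA iL p)) :
  exists z : padicT p iL, inclC z = iota (incl x).
Proof.
apply: (padicT_map_image hK hp hp0 (iE := iL') (iE' := iC')) => n.
by have [t e] := iota_incl_level n x; exists (to_residueT p n t).
Qed.

Context (Ls : sep_closure iLC).
Local Notation iLs := (sep_in Ls \o iL).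
Let iLs' : {rmorphism F -> Ls} := sep_in Ls \o (ell \o iF).
Let sE : forall c, sep_out Ls (iLs' c) = iC' c := fun c => sep_comp Ls (ell (iF c)).

Context (r : nat) (Theta : 'M[semiloc Q (ideal_tensA iL p)]_r) (Y : 'M[tate_loc LL p]_r).
Hypothesis YTheta : map_mx tau Y *m map_mx incl Theta = Y.

Lemma iota_sep_image i j : exists u, padic_sep_incl p Ls u = iota (Y i j).
Proof.
apply: (padicT_map_image hK hp hp0 (iE := iLs') (iE' := iC') (uE := sE)) => n.
have [s [e [kap basis]]] := residue_basis hK hp hp0 n.
have /choice[th thP] : forall kl : 'I_r * 'I_r, exists t : AL,
    lv n (incl (Theta kl.1 kl.2)) =
    residueT_map (u := iLC) (iE := iL) (fun _ => erefl) (to_residueT p n t).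
  by move=> kl; exact: iota_incl_level.
pose Yn : 'M[talg (@residue_const F K iF Oinf p n) iC']_r := map_mx (lv n) Y.
pose Tn : 'M[talg (@residue_const F K iF Oinf p n) iL']_r :=
  \matrix_(k, l) to_residueT p n (th (k, l)).
have sys := @separable_matrix_system F (residue p n) (@residue_const F K iF Oinf p n)
  s e kap basis L Cinf iL' iC' iLC idfun (fun x => erefl) (fun c => erefl)
  (fun c => erefl) r Yn Tn.
have [x' x'E] : exists x' : residueT p iLs n,
    @residueT_map _ _ _ _ p _ _ iLs iC (sep_out Ls) sE n x' = Yn i j.
  apply: (talg_map_image basis (iE := iLs') (iE' := iC') (v := sep_out Ls) (u := idfun)
    (fun x => erefl)) => k.
  apply/sep_image; apply: sys; apply/matrixP => a b; rewrite mxE.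
  have /matrixP/(_ a b) := YTheta; rewrite mxE => /(congr1 (lv n)).
  rewrite rmorph_sum => e'; rewrite [RHS]mxE -[RHS]e'; apply: eq_bigr => l _.
  rewrite !mxE rmorphM; congr (_ * _); last by rewrite /= (thP (l, b)).
  by rewrite -[RHS]/(plim_coord (iota (tau (Y a l))) n) iota_tau.
by exists x'; rewrite x'E mxE.
Qed.

End PadicEmbedding.

(** * The Galois cocycle *)

Lemma mx_inverse_unique (R : comPzRingType) r (A B C : 'M[R]_r) :
  B *m A = 1%:M -> A *m C = 1%:M -> B = C.
Proof. by move=> BA1 AC1; rewrite -[B]mulmx1 -AC1 mulmxA BA1 mul1mx. Qed.

Lemma mx_inverse_map (R R' : comPzRingType) (f : {rmorphism R -> R'}) r
    (A B : 'M[R]_r) : mx_inverse A B -> mx_inverse (map_mx f A) (map_mx f B).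
Proof. by case=> AB BA; split; rewrite -map_mxM ?AB ?BA map_mx1. Qed.

Lemma mx_inverse_det (R : comPzRingType) r (A : 'M[R]_r) x :
  \det A * x = 1 -> mx_inverse A (x *: \adj A).
Proof.
move=> Ax; split; rewrite -?scalemxAr -?scalemxAl ?mul_mx_adj ?mul_adj_mx.
  by rewrite scale_scalar_mx mulrC Ax.
by rewrite scale_scalar_mx mulrC Ax.
Qed.

Lemma trivialization_quotient (R : comPzRingType) (f : {rmorphism R -> R}) r
    (A B B' Th : 'M[R]_r) :
  map_mx f A *m Th = A -> map_mx f B *m Th = B -> mx_inverse B B' ->
  map_mx f (A *m B') = A *m B'.
Proof.
move=> fA fB BB'; have [_ fB'B] := mx_inverse_map f BB'.
have ThE : Th = map_mx f B' *m B by rewrite -[in RHS]fB mulmxA fB'B mul1mx.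
rewrite map_mxM -[A in RHS]fA ThE -!mulmxA; case: BB' => -> _.
by rewrite mulmx1.
Qed.

Lemma trivialization_inverse (R : comPzRingType) (f : {rmorphism R -> R}) r
    (A B Th : 'M[R]_r) :
  map_mx f A *m Th = A -> mx_inverse A B -> map_mx f B = Th *m B.
Proof.
move=> fA AB; have [_ fBA] := mx_inverse_map f AB.
by rewrite -[RHS]mul1mx -fBA -mulmxA [X in _ *m X]mulmxA fA AB.1 mulmx1.
Qed.

Lemma mx_inverse_mul (R : comPzRingType) r (A A' B B' : 'M[R]_r) :
  mx_inverse A A' -> mx_inverse B B' -> mx_inverse (A *m B') (B *m A').
Proof.
move=> [AA' A'A] [BB' B'B].
split; rewrite mulmxA.
  by rewrite -(mulmxA A) B'B mulmx1.
by rewrite -(mulmxA B) A'A mulmx1.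
Qed.

Section GaloisMatrix.
Context (R : realType) (F : finFieldType) (K : fieldType).
Context (iF : {rmorphism F -> K}) (hK : function_field iF) (Oinf : set K).
Context (L Cinf : fieldType).
Context (ell : {rmorphism K -> L}) (iLC : {rmorphism L -> Cinf}).
Context (abs : Cinf -> R) (hCinf : is_Cinf (iLC \o ell) Oinf abs).
Local Notation A := (ringA iF Oinf).
Local Notation iL := (ell \o iF).
Local Notation iC := (iLC \o iL).
Local Notation AL := (tensA iF Oinf iL).
Local Notation AC := (tensA iF Oinf iC).
Context (Q : frac_field AL) (p : set A) (hp : prime_ideal p).
Context (hp0 : exists2 a, p a & a != 0).
Context (T : gauss_completion iF Oinf iC abs) (LL : frac_field T).
Context (iota : {rmorphism tate_loc LL p -> padicT p iC}).
Context (hiota : natural_embedding iota).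
Local Notation tau := (tate_tau hCinf (p := p) (LL := LL)).
Local Notation incl := (loc_incl (Q := Q) hCinf (p := p) LL).
Context (Ls : sep_closure iLC).
Local Notation iLs := (sep_in Ls \o iL).
Local Notation sep_incl := (@padic_sep_incl F K iF Oinf L Cinf ell iLC p Ls).
Context (r : nat) (Theta : 'M[semiloc Q (ideal_tensA iL p)]_r).
Context (Y Psi : 'M[tate_loc LL p]_r).
Hypothesis YTheta : map_mx tau Y *m map_mx incl Theta = Y.
Hypothesis YPsi : mx_inverse Y Psi.

Let iL' : {rmorphism F -> L} := ell \o iF.
Let iC' : {rmorphism F -> Cinf} := iLC \o (ell \o iF).
Let iLs' : {rmorphism F -> Ls} := sep_in Ls \o (ell \o iF).
Let sE : forall c, sep_out Ls (iLs' c) = iC' c := fun c => sep_comp Ls (ell (iF c)).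

HB.instance Definition _ := GRing.RMorphism.copy sep_incl (padicT_map p sE).

Lemma sep_incl_inj : injective sep_incl.
Proof. exact: (padicT_map_inj hK hp hp0 (iE := iLs') (iE' := iC') (uE := sE)). Qed.

Lemma sep_matrix : exists U U' : 'M[padicT p iLs]_r, [/\ mx_inverse U U',
  map_mx sep_incl U = map_mx iota Y & map_mx sep_incl U' = map_mx iota Psi].
Proof.
have /choice[u uP] : forall ij : 'I_r * 'I_r, exists u,
    sep_incl u = iota (Y ij.1 ij.2).
  by move=> ij; exact: (iota_sep_image hK hp hp0 hiota Ls YTheta).
pose U := \matrix_(i, j) u (i, j).
have UE : map_mx sep_incl U = map_mx iota Y.
  by apply/matrixP => i j; rewrite !mxE uP.
have [x Ux] : exists x, \det U * x = 1.
  apply: (padicT_unit_descent hK hp hp0 (iE := iLs') (iE' := iC') (uE := sE)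
    (y := iota (\det Psi))).
  have -> : padicT_map p sE (\det U) = iota (\det Y).
    by rewrite -[LHS]/(sep_incl _) -!det_map_mx UE.
  by rewrite -rmorphM -det_mulmx YPsi.1 det1 rmorph1.
exists U, (x *: \adj U); split=> //; first exact: mx_inverse_det.
have [i1 i2] := mx_inverse_map sep_incl (mx_inverse_det Ux).
apply: (mx_inverse_unique i2); rewrite UE.
by rewrite -map_mxM YPsi.1 map_mx1.
Qed.

Section Gamma.
Context (g : {rmorphism Ls -> Ls}) (gfix : forall x, g (sep_in Ls x) = sep_in Ls x).
Local Notation gal := (padicT_map p (u := g) (iE := iLs) (fun c => gfix (iL c))).

Context (U U' : 'M[padicT p iLs]_r) (UU' : mx_inverse U U').
Hypothesis UE : map_mx sep_incl U = map_mx iota Y.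
Hypothesis U'E : map_mx sep_incl U' = map_mx iota Psi.

Lemma galois_cocycle : exists D D' : 'M[padicA p]_r, [/\ mx_inverse D D',
  map_mx (padicA_to_padicT iC) D = map_mx iota Y *m map_mx sep_incl (map_mx gal U') &
  map_mx (padicA_to_padicT iC) D' = map_mx sep_incl (map_mx gal U) *m map_mx iota Psi].
Proof.
pose frC := padicT_map p (frobq_const iC').
pose frS := padicT_map p (frobq_const iLs').
pose inL := padicT_map p (u := sep_in Ls) (iE := iL) (iE' := iLs) (fun _ => erefl).
have /choice[th thP] : forall ij : 'I_r * 'I_r, exists z : padicT p iL,
    padicT_map p (u := iLC) (iE := iL) (fun _ => erefl) z = iota (incl (Theta ij.1 ij.2)).
  by move=> ij; exact: (iota_incl_image hK hCinf hp hp0 hiota).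
pose ThL : 'M[padicT p iL]_r := \matrix_(i, j) th (i, j).
pose ThS := map_mx inL ThL; pose ThC := map_mx sep_incl ThS.
have ThCE : ThC = map_mx iota (map_mx incl Theta).
  apply/matrixP => i j; rewrite !mxE -(thP (i, j)).
  apply: (padicT_map_comp (u := sep_in Ls) (w := sep_out Ls) (v := iLC)) => x.
  exact: sep_comp.
have galThS : map_mx gal ThS = ThS.
  apply/matrixP => i j; rewrite !mxE.
  exact: (padicT_map_comp (u := sep_in Ls) (w := g) (v := sep_in Ls)).
have frY : map_mx frC (map_mx iota Y) *m ThC = map_mx iota Y.
  rewrite ThCE -[in RHS]YTheta map_mxM; congr (_ *m _).
  by apply/matrixP => i j; rewrite !mxE (iota_tau hK hCinf hp hp0 hiota).
have frU : map_mx frS U *m ThS = U.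
  suff e : map_mx sep_incl (map_mx frS U *m ThS) = map_mx sep_incl U.
    apply/matrixP => i j; apply: sep_incl_inj.
    by have /matrixP/(_ i j) := e; rewrite [LHS]mxE [RHS]mxE.
  rewrite UE -[RHS]frY -UE map_mxM; congr (_ *m _).
  apply/matrixP => k l; rewrite !mxE.
  by apply: padicT_map_square => x; rewrite /= /frobq rmorphXn.
have frgU : map_mx frS (map_mx gal U) *m ThS = map_mx gal U.
  rewrite -[in RHS]frU map_mxM galThS; congr (_ *m _).
  apply/matrixP => k l; rewrite !mxE.
  by apply: padicT_map_square => x; rewrite /= /frobq rmorphXn.
pose V := map_mx sep_incl (map_mx gal U); pose W := map_mx sep_incl (map_mx gal U').
have VW : mx_inverse V W by do 2!apply: mx_inverse_map.
have frV : map_mx frC V *m ThC = V.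
  rewrite -[in RHS]/V /V -{2}frgU [in RHS]map_mxM; congr (_ *m _).
  apply/matrixP => k l; rewrite !mxE.
  by apply: padicT_map_square => x; rewrite /= /frobq rmorphXn.
have iYPsi := mx_inverse_map iota YPsi.
have fixed (M : 'M[padicT p iC]_r) : map_mx frC M = M ->
    exists D : 'M[padicA p]_r, map_mx (padicA_to_padicT iC) D = M.
  move=> MM; have /choice[d dP] : forall ij : 'I_r * 'I_r, exists b,
      padicA_to_padicT iC b = M ij.1 ij.2.
    move=> [i j]; apply: (padicT_frob_fixed hK hp hp0 (iC := iC')).
    by have /matrixP/(_ i j) := MM; rewrite mxE.
  by exists (\matrix_(i, j) d (i, j)); apply/matrixP => i j; rewrite !mxE dP.
have [D DE] := fixed _ (trivialization_quotient frY frV VW).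
have [D' D'E] := fixed _ (trivialization_quotient frV frY iYPsi).
have cst_inj : injective (map_mx (padicA_to_padicT iC) : 'M[padicA p]_r -> _).
  move=> M N MN; apply/matrixP => i j.
  apply: (@padicA_to_padicT_inj F K iF Oinf p hK hp hp0 Cinf iC').
  by have /matrixP/(_ i j) := MN; rewrite !mxE.
have [e1 e2] := mx_inverse_mul iYPsi VW.
exists D, D'; split; [split; apply: cst_inj|exact: DE|exact: D'E].
  by rewrite map_mxM map_mx1 DE D'E; exact: e1.
by rewrite map_mxM map_mx1 DE D'E; exact: e2.
Qed.

End Gamma.
End GaloisMatrix.

(** * Linear disjointness of T and A_p *)

Section LinearDisjointness.
Context (R : realType) (F : finFieldType) (K : fieldType).
Context (iF : {rmorphism F -> K}) (hK : function_field iF) (Oinf : set K).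
Context (L Cinf : fieldType).
Context (ell : {rmorphism K -> L}) (iLC : {rmorphism L -> Cinf}).
Context (abs : Cinf -> R) (hCinf : is_Cinf (iLC \o ell) Oinf abs).
Local Notation A := (ringA iF Oinf).
Local Notation iL := (ell \o iF).
Local Notation iC := (iLC \o iL).
Local Notation AC := (tensA iF Oinf iC).
Context (p : set A) (hp : prime_ideal p).
Context (hp0 : exists2 a, p a & a != 0).
Context (T : gauss_completion iF Oinf iC abs) (LL : frac_field T).
Context (iota : {rmorphism tate_loc LL p -> padicT p iC}).
Context (hiota : natural_embedding iota).
Local Notation tg := (to_gauss T).
Local Notation N := (@gauss_norm _ _ _ _ _ _ _ _ T).
Local Notation toT := (to_semiloc LL (to_gauss T @` ideal_tensA iC p)).
Local Notation cst := (@padicA_to_padicT F K iF Oinf p Cinf iC).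
Local Notation lv := (iota_level iota).

Let iC' : {rmorphism F -> Cinf} := iLC \o (ell \o iF).
Let abs_ge0 := Cinf_abs_ge0 hCinf.
Let abs_eq0 := Cinf_abs0 hCinf.
Let absM := Cinf_absM hCinf.
Let absD := Cinf_absD hCinf.

Section Functional.
Context (lam : Cinf -> F) (lamD : forall x y, lam (x + y) = lam x + lam y).
Context (lamZ : forall f x, lam (iC f * x) = f * lam x).

Definition coef_map (S : comPzRingType) (f : F -> S) (x : talg f iC) : S :=
  tens_lift (fun s c => f (lam c) * s) x.

Section CoefMap.
Context (S : comPzRingType) (f : {rmorphism F -> S}).

Lemma coef_map_balanced :
  balanced (scal_by f) (scal_by iC) (fun (s : S) c => f (lam c) * s).
Proof.
split=> [s s' c|s c c'|d s c]; first by rewrite mulrDr.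
  by rewrite lamD rmorphD mulrDl.
by rewrite /scal_by lamZ rmorphM mulrCA mulrA.
Qed.

Lemma coef_map_lin_comb n (a : 'I_n -> S) (c : 'I_n -> Cinf) :
  coef_map (\sum_i (tensor (a i) (c i) : talg f iC)) = \sum_i f (lam (c i)) * a i.
Proof. exact: (tens_lift_sum _ _ _ _ coef_map_balanced). Qed.

Lemma coef_map_tensor s c : coef_map (tensor s c : talg f iC) = f (lam c) * s.
Proof. exact: (tens_lift_tensor coef_map_balanced). Qed.

Fact coef_map_zmod : zmod_morphism (@coef_map S f).
Proof.
by move=> x y; rewrite /coef_map (tens_liftD coef_map_balanced)
                       (tens_liftN coef_map_balanced).
Qed.
HB.instance Definition _ :=
  GRing.isZmodMorphism.Build (talg f iC) S (@coef_map S f) coef_map_zmod.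

Lemma coef_mapM (z : talg f iC) s : coef_map (z * tensl f iC s) = coef_map z * s.
Proof.
elim/tens_ind: z => [|s' c z IH].
  by rewrite mul0r (raddf0 (@coef_map S f)) mul0r.
rewrite mulrDl (raddfD (@coef_map S f)) [in RHS](raddfD (@coef_map S f)) mulrDl.
congr (_ + _); last exact: IH.
by rewrite /tensl mul_tensor mulr1 /= !coef_map_tensor mulrA.
Qed.

End CoefMap.

Lemma coef_map_residue n (t : AC) :
  coef_map (to_residueT p n t) = quot_pi (ideal_pow p n.+1) (coef_map t).
Proof.
pose f := @residue_const F K iF Oinf p n.
pose q : {rmorphism A -> residue p n} := quot_pi (ideal_pow p n.+1).
apply: (@talg_ext _ _ _ _ _ _
  (@coef_map (residue p n) f \o @to_residueT F K iF Oinf p Cinf iC n)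
  (q \o @coef_map A (@constA F K iF Oinf))) => a c.
rewrite /= coef_map_tensor [LHS](_ : _ = coef_map (tensor (q a) c : talg f iC)).
  by rewrite coef_map_tensor [RHS](rmorphM q).
by congr coef_map; exact: talg_map_tensor.
Qed.

Context (rho : R) (lam0 : forall c, abs c < rho -> lam c = 0).

Lemma coef_map_small (t : AC) : N (tg t) < rho -> coef_map t = 0.
Proof.
have [n [a [c [ai ->]]]] := tensA_lin_indep (iE := iC') t => small.
rewrite raddf_sum big1// => i _; rewrite /= coef_map_tensor lam0 ?rmorph0 ?mul0r//.
exact: le_lt_trans (@le_gauss_coef R F K iF Oinf Cinf iC' abs T n a c i ai) small.
Qed.

Lemma coef_map_level n (x : T) (t : AC) : N (x - tg t) < rho ->
  coef_map (lv n (toT x)) = quot_pi (ideal_pow p n.+1) (coef_map t).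
Proof.
move=> small; have [s [Ns es _]] := tate_level_approx hK hCinf hp hp0 hiota n (x - tg t).
have -> : lv n (toT x) = to_residueT p n s + to_residueT p n t.
  rewrite -es -(iota_level_to hiota n t) -!rmorphD subrK.
  by [].
rewrite (raddfD (@coef_map _ (@residue_const F K iF Oinf p n))) /= !coef_map_residue.
rewrite coef_map_small ?rmorph0 ?add0r//.
exact: le_lt_trans Ns small.
Qed.

Lemma coef_map_relation n (t : 'I_n -> T) (x : 'I_n -> AC) (b : 'I_n -> padicA p) :
  \sum_i iota (toT (t i)) * cst (b i) = 0 -> (forall i, N (t i - tg (x i)) < rho) ->
  \sum_i to_padicA p (coef_map (x i)) * b i = 0.
Proof.
move=> rel small; apply: plimP => k.
pose h : {additive residueT p iC k -> residue p k} :=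
  @coef_map (residue p k) (@residue_const F K iF Oinf p k).
have : h (plim_pr k (\sum_i iota (toT (t i)) * cst (b i))) = 0.
  by rewrite rel rmorph0 raddf0.
rewrite rmorph_sum raddf_sum => e.
rewrite -[LHS]/(plim_pr k _) rmorph_sum -[RHS]e; apply: eq_bigr => i _.
rewrite [LHS]rmorphM; symmetry.
transitivity (h (lv k (toT (t i))) * plim_pr k (b i)); first exact: coef_mapM.
by congr (_ * _); exact: coef_map_level.
Qed.

End Functional.

(* Elements of A_p are linearly independent over T as soon as they are over A:
   normalize a relation over T and reduce it to A by an F-linear functional on
   the coefficients that kills all small ones. *)
Lemma tate_padic_disjoint n (t : 'I_n -> T) (b : 'I_n -> padicA p) :
  \sum_i iota (toT (t i)) * cst (b i) = 0 -> (exists i, t i != 0) ->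
  exists a : 'I_n -> A, (exists i, a i != 0) /\ \sum_i to_padicA p (a i) * b i = 0.
Proof.
move=> rel [i1 ti1].
have N_gt0 (x : T) : x != 0 -> 0 < N x.
  move=> x0; rewrite lt_neqAle (gauss_norm_ge0 (iC := iC')) andbT.
  by apply: contra_neq x0 => e; apply: gauss_norm0.
have [i0 i0max] : exists i0, forall i, N (t i) <= N (t i0).
  by case: (arg_maxP (fun i => N (t i)) (i0 := i1) (P := xpredT)) => // i0 _ H; exists i0 => i; exact: H.
set rho := N (t i0).
have rho0 : 0 < rho by exact: lt_le_trans (N_gt0 _ ti1) (i0max i1).
have /choice[x xP] : forall i, exists y, N (t i - tg y) < rho.
  by move=> i; apply: (gauss_approx (iC := iC')).
have [k [a [c [ai xE]]]] := tensA_lin_indep (iE := iC') (x i0).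
have Nx : N (tg (x i0)) = rho by apply: (gauss_norm_eq (iC := iC')).
have [l cl] : exists l, rho = abs (c l).
  have e : \big[Num.max/0]_i abs (c i) = rho.
    by rewrite -Nx xE (gauss_normE _ _ ai).
  by have := rho0; rewrite -e; exact: (bigmax_attained abs_ge0).
pose W := [set z | abs z < rho].
have [lam [lamD lamZ lamW laml]] : exists lam : Cinf -> F,
    [/\ forall x y, lam (x + y) = lam x + lam y,
        forall f x, lam (iC' f * x) = f * lam x,
        forall x, W x -> lam x = 0 & lam (c l) = 1].
  apply: separating_functional; last by rewrite /W /= cl ltxx.
  split=> [|y z Wy Wz|f y Wy].
  - by rewrite /W /= (abs0 abs_eq0).
  - apply: le_lt_trans (absD _ _) _; rewrite gt_max (absN iC' abs_ge0 abs_eq0 absM).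
    by apply/andP.
  - rewrite /W /= absM; apply: le_lt_trans Wy; rewrite ler_piMl ?abs_ge0//.
    exact: (abs_const iC' abs_eq0 absM).
exists (fun i => coef_map lam (x i)); split.
  exists i0; apply/eqP => e0.
  have : \sum_i constA (lam (c i)) * a i = 0 :> A.
    by rewrite -[RHS]e0 xE (coef_map_lin_comb lamD lamZ).
  by move=> /ai/(_ l)/eqP; rewrite laml oner_eq0.
exact: (coef_map_relation lamD lamZ lamW rel xP).
Qed.

End LinearDisjointness.

(** * Points of the difference Galois group *)

Lemma det_map_neq0 (R : comPzRingType) (E : fieldType) (f : {rmorphism R -> E}) r
    (A B : 'M[R]_r) : mx_inverse A B -> \det (map_mx f B) != 0.
Proof.
move=> /(mx_inverse_map f)[AB _]; apply/eqP => d0; have := congr1 determinant AB.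
by rewrite det_mulmx d0 mulr0 det1 => /esym/eqP; rewrite oner_eq0.
Qed.

Section PicardVessiotRing.
Context (Q LL : fieldType) (iQ : {rmorphism Q -> LL}) (r : nat) (Psi : 'M[LL]_r).
Local Notation P := (pv_ring iQ Psi).

Fact pv_val_zmod : zmod_morphism (@pv_val Q LL iQ r Psi).
Proof. by []. Qed.
Fact pv_val_monoid : monoid_morphism (@pv_val Q LL iQ r Psi).
Proof. by []. Qed.
HB.instance Definition _ :=
  GRing.isZmodMorphism.Build P LL (@pv_val Q LL iQ r Psi) pv_val_zmod.
HB.instance Definition _ :=
  GRing.isMonoidMorphism.Build P LL (@pv_val Q LL iQ r Psi) pv_val_monoid.

Lemma pv_val_inj : injective (@pv_val Q LL iQ r Psi).
Proof. exact: val_inj. Qed.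

Fact pv_of_base_zmod : zmod_morphism (@pv_of_base Q LL iQ r Psi).
Proof. by move=> x y; apply: pv_val_inj; rewrite /= rmorphB. Qed.
Fact pv_of_base_monoid : monoid_morphism (@pv_of_base Q LL iQ r Psi).
Proof. by split=> [|x y]; apply: pv_val_inj; rewrite /= ?rmorph1 ?rmorphM. Qed.
HB.instance Definition _ :=
  GRing.isZmodMorphism.Build Q P (@pv_of_base Q LL iQ r Psi) pv_of_base_zmod.
HB.instance Definition _ :=
  GRing.isMonoidMorphism.Build Q P (@pv_of_base Q LL iQ r Psi) pv_of_base_monoid.

Fact pv_detV_subproof : (\det Psi)^-1 \in pv_pred iQ Psi.
Proof. by apply/asboolP. Qed.
Definition pv_detV : P := PVRing pv_detV_subproof.

Lemma pv_ring_ind (H : P -> Prop) :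
  H 1 -> (forall x y, H x -> H y -> H (x - y)) ->
  (forall x y, H x -> H y -> H (x * y)) ->
  (forall q, H (pv_of_base iQ Psi q)) -> (forall i j, H (pv_mx iQ Psi i j)) ->
  H pv_detV -> forall x, H x.
Proof.
move=> H1 HB HM HQ HPsi HdetV [z zP].
have [h Hz] : exists h : z \in pv_pred iQ Psi, H (PVRing h).
  have /asboolP/(_ [set w | exists h : w \in pv_pred iQ Psi, H (PVRing h)]) := zP.
  apply=> [|y w [hy Hy] [hw Hw]|y w [hy Hy] [hw Hw]|q|i j|].
  - by exists (valP (1 : P)); move: H1; congr H; apply: pv_val_inj.
  - have h : y - w \in pv_pred iQ Psi by exact: (valP (PVRing hy - PVRing hw)).
    by exists h; move: (HB _ _ Hy Hw); congr H; apply: pv_val_inj.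
  - have h : y * w \in pv_pred iQ Psi by exact: (valP (PVRing hy * PVRing hw)).
    by exists h; move: (HM _ _ Hy Hw); congr H; apply: pv_val_inj.
  - by exists (valP (pv_of_base iQ Psi q)); move: (HQ q); congr H; apply: pv_val_inj.
  - exists (pv_mx_subproof iQ Psi i j); move: (HPsi i j); congr H.
    by apply: pv_val_inj; rewrite mxE.
  - by exists pv_detV_subproof.
by move: Hz; congr H; apply: pv_val_inj.
Qed.

Lemma pv_detVP : \det Psi != 0 -> \det (pv_mx iQ Psi) * pv_detV = 1.
Proof.
move=> d0; apply: pv_val_inj; rewrite rmorphM /= -det_map_mx.
have -> : map_mx (@pv_val Q LL iQ r Psi) (pv_mx iQ Psi) = Psi.
  by apply/matrixP => i j; rewrite !mxE.
by rewrite divff.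
Qed.

Lemma pv_rmorph_ext (V : comPzRingType) (h h' : {rmorphism P -> V}) :
  \det Psi != 0 -> (forall q, h (pv_of_base iQ Psi q) = h' (pv_of_base iQ Psi q)) ->
  map_mx h (pv_mx iQ Psi) = map_mx h' (pv_mx iQ Psi) -> forall x, h x = h' x.
Proof.
move=> d0 hq hM; elim/pv_ring_ind => [|x y hx hy|x y hx hy|q|i j|].
- by rewrite !rmorph1.
- by rewrite !rmorphB hx hy.
- by rewrite !rmorphM hx hy.
- exact: hq.
- by have /matrixP/(_ i j) := hM; rewrite !mxE.
have e : h (\det (pv_mx iQ Psi)) = h' (\det (pv_mx iQ Psi)) by rewrite -!det_map_mx hM.
rewrite -[LHS]mulr1 -(rmorph1 h') -(pv_detVP d0) rmorphM mulrA -e -rmorphM.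
by rewrite (mulrC pv_detV) pv_detVP// rmorph1 mul1r.
Qed.

End PicardVessiotRing.

Section TensorLift.
Context (S : Type) (R R' V : comPzRingType) (f : S -> R) (g : S -> R').
Local Notation T := (talg f g).

Fact tensr_zmod : zmod_morphism (fun y : R' => tensor 1 y : T).
Proof. by move=> x y; apply/eqP; rewrite -subr_eq opprK -tensorDr subrK. Qed.
Fact tensr_monoid : monoid_morphism (fun y : R' => tensor 1 y : T).
Proof. by split=> // x y; rewrite mul_tensor mulr1. Qed.
Definition tensr (y : R') : T := tensor 1 y.
HB.instance Definition _ := GRing.isZmodMorphism.Build R' T tensr tensr_zmod.
HB.instance Definition _ := GRing.isMonoidMorphism.Build R' T tensr tensr_monoid.

Lemma tensor_tensl_tensr x y : tensor x y = tensl f g x * tensr y.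
Proof. by rewrite mul_tensor mulr1 mul1r. Qed.

Lemma talg_rmorph_ext (h h' : {rmorphism T -> V}) :
  (forall x, h (tensl f g x) = h' (tensl f g x)) ->
  (forall y, h (tensr y) = h' (tensr y)) -> forall t, h t = h' t.
Proof.
move=> hl hr; apply: (@talg_ext _ _ _ _ _ _ h h') => x y.
by rewrite tensor_tensl_tensr [LHS]rmorphM [RHS]rmorphM hl hr.
Qed.

Context (u : {rmorphism R -> V}) (v : {rmorphism R' -> V}).

Definition talg_lift of (forall s, u (f s) = v (g s)) : T -> V :=
  tens_lift (fun x y => u x * v y).

Context (uv : forall s, u (f s) = v (g s)).
Local Notation h := (talg_lift uv).

Lemma talg_lift_balanced : balanced (scal_by f) (scal_by g) (fun x y => u x * v y).
Proof.
split=> [x x' y|x y y'|s x y]; rewrite ?rmorphD ?mulrDl ?mulrDr//.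
by rewrite /scal_by !rmorphM uv mulrAC mulrC mulrA mulrAC mulrC mulrA.
Qed.

Lemma talg_lift_tensor x y : h (tensor x y) = u x * v y.
Proof. exact: (tens_lift_tensor talg_lift_balanced). Qed.

Fact talg_lift_zmod : zmod_morphism h.
Proof.
by move=> x y; rewrite /talg_lift (tens_liftD talg_lift_balanced)
                       (tens_liftN talg_lift_balanced).
Qed.
HB.instance Definition _ := GRing.isZmodMorphism.Build T V h talg_lift_zmod.

Fact talg_lift_monoid : monoid_morphism h.
Proof.
have hD x y : h (x + y) = h x + h y by exact: (tens_liftD talg_lift_balanced).
have h0 : h 0 = 0 by exact: (tens_lift0 talg_lift_balanced).
split=> [|a b]; first by rewrite talg_lift_tensor !rmorph1 mulr1.
elim/tens_ind: a => [|x y a IH]; first by rewrite mul0r h0 mul0r.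
rewrite mulrDl !hD IH mulrDl; congr (_ + _) => {a IH}.
elim/tens_ind: b => [|x' y' b IH]; first by rewrite mulr0 h0 mulr0.
rewrite mulrDr !hD IH mulrDr; congr (_ + _).
by rewrite mul_tensor !talg_lift_tensor !rmorphM mulrACA.
Qed.
HB.instance Definition _ := GRing.isMonoidMorphism.Build T V h talg_lift_monoid.

End TensorLift.

Section GaloisPoints.
Context (K Q LL B : fieldType) (iKQ : K -> Q) (iQ : {rmorphism Q -> LL}) (iB : K -> B).
Context (A AL TL Ap Us Om : comPzRingType).
Context (aK : A -> K) (aQ : {rmorphism A -> Q}) (aT : {rmorphism A -> TL}).
Context (aAp : {rmorphism A -> Ap}) (fB : {rmorphism Ap -> B}).
Context (vT : {rmorphism TL -> LL}) (iota : {rmorphism TL -> Om}).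
Context (cst : {rmorphism Ap -> Om}) (sU : {rmorphism Us -> Om}).
Context (lQ : {rmorphism AL -> Q}) (lT : {rmorphism AL -> TL}) (lU : {rmorphism AL -> Us}).
Hypothesis aKQ : forall a, iKQ (aK a) = aQ a.
Hypothesis aKB : forall a, iB (aK a) = fB (aAp a).
Hypothesis aQ0 : forall a, a != 0 -> aQ a != 0.
Hypothesis aTE : forall a, vT (aT a) = iQ (aQ a).
Hypothesis aOm : forall a, iota (aT a) = cst (aAp a).
Hypothesis vT_inj : injective vT.
Hypothesis sU_inj : injective sU.
Hypothesis lTE : forall d, vT (lT d) = iQ (lQ d).
Hypothesis lUE : forall d, iota (lT d) = sU (lU d).
Hypothesis lQP : forall x, exists n d, lQ d != 0 /\ x = lQ n / lQ d.
Hypothesis disjoint : forall n (t : 'I_n -> TL) (b : 'I_n -> Ap),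
  \sum_i iota (t i) * cst (b i) = 0 -> (exists i, t i != 0) ->
  exists a : 'I_n -> A, (exists i, a i != 0) /\ \sum_i aAp (a i) * b i = 0.
Context (r : nat) (PsiT : 'M[TL]_r).
Let Psi := map_mx vT PsiT.
Local Notation P := (pv_ring iQ Psi).
Local Notation base := (pv_of_base iQ Psi).
Local Notation PB := (talg (base \o iKQ) iB).

Let tens (x : P) (b : B) : PB := tensor x b.

Let tensM x b x' b' : tens x b * tens x' b' = tens (x * x') (b * b').
Proof. exact: mul_tensor. Qed.

Let tens0l b : tens 0 b = 0.
Proof. by apply: (addrI (tens 0 b)); rewrite -[LHS]tensorDl !addr0. Qed.

Let tensDr x b c : tens x (b + c) = tens x b + tens x c.
Proof. exact: tensorDr. Qed.

Let tensBl x y b : tens (x - y) b = tens x b - tens y b.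
Proof. exact: tensorBl. Qed.

Let tens_balA a x b : tens (base (aQ a) * x) b = tens x (fB (aAp a) * b).
Proof. by rewrite -aKQ -aKB; exact: (@tensor_bal K P B (scal_by (base \o iKQ)) (scal_by iB) (aK a) x b). Qed.

Let tens_unit q b : q != 0 -> b != 0 -> tens (base q^-1) b^-1 * tens (base q) b = 1.
Proof. by move=> q0 b0; rewrite tensM -rmorphM !mulVf// rmorph1. Qed.

Lemma tensor_relation n (x : 'I_n -> P) (t : 'I_n -> TL) (b : 'I_n -> Ap) :
  (forall i, pv_val (x i) = vT (t i)) -> \sum_i iota (t i) * cst (b i) = 0 ->
  \sum_i tens (x i) (fB (b i)) = 0.
Proof.
elim: n x t b => [|n IH] x t b xt rel; first by rewrite big_ord0.
have [ex|all0] := pselect (exists i, t i != 0); last first.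
  rewrite big1// => i _; have -> : x i = 0; last exact: tens0l.
  apply: pv_val_inj; rewrite xt rmorph0.
  have /eqP -> : t i == 0 by apply: contra_notT all0; exists i.
  exact: rmorph0.
have [a [[j aj] arel]] := disjoint rel ex.
have aj' := aQ0 aj.
set S := \sum_i _.
suff S0 : tens (base (aQ (a j))) 1 * S = 0.
  rewrite -[S]mul1r -(tens_unit aj' (oner_neq0 B)) -mulrA S0 mulr0.
  by [].
pose y k := base (aQ (a j)) * x (lift j k) - base (aQ (a (lift j k))) * x j.
pose u k := aT (a j) * t (lift j k) - aT (a (lift j k)) * t j.
have IHy := IH y u (fun k => b (lift j k)).
have -> : tens (base (aQ (a j))) 1 * S = \sum_k tens (y k) (fB (b (lift j k))).
  rewrite /S mulr_sumr (eq_bigr (fun i => tens (base (aQ (a j)) * x i) (fB (b i)))); last first.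
    by move=> i _; rewrite tensM mul1r.
  rewrite (bigD1_ord j)//= tens_balA -rmorphM.
  have -> : aAp (a j) * b j = - \sum_k aAp (a (lift j k)) * b (lift j k).
    by move: arel; rewrite (bigD1_ord j)//= => /eqP; rewrite addr_eq0 => /eqP.
  have tsum (z : P) (c : 'I_n -> Ap) :
      tens z (fB (- \sum_k c k)) = - \sum_k tens z (fB (c k)).
    have tD : {morph (fun w => tens z (fB w)) : v w / v + w}.
      by move=> v w; rewrite rmorphD tensDr.
    have t0 : tens z (fB 0) = 0.
      by apply: (addrI (tens z (fB 0))); rewrite -tD !addr0.
    rewrite -(big_morph (fun w => tens z (fB w)) tD t0).
    apply/eqP; rewrite -addr_eq0; apply/eqP.
    by rewrite -[LHS]tD addNr t0.
  rewrite tsum -sumrN -big_split; apply: eq_bigr => k _.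
  by rewrite /= rmorphM -tens_balA /y tensBl addrC.
apply: IHy => [k|].
  by rewrite /y /u !rmorphB !rmorphM /= !aTE !xt.
under eq_bigr => k _ do rewrite /u rmorphB !rmorphM !aOm mulrBl.
rewrite sumrB.
have e1 : \sum_k cst (aAp (a j)) * iota (t (lift j k)) * cst (b (lift j k)) =
    - (cst (aAp (a j)) * (iota (t j) * cst (b j))).
  under eq_bigr => k _ do rewrite -mulrA.
  rewrite -mulr_sumr; move: rel; rewrite (bigD1_ord j)//= addrC => /eqP.
  by rewrite addr_eq0 => /eqP ->; rewrite mulrN.
have e2 : \sum_k cst (aAp (a (lift j k))) * iota (t j) * cst (b (lift j k)) =
    - (iota (t j) * (cst (aAp (a j)) * cst (b j))).
  under eq_bigr => k _ do rewrite (mulrC (cst _) (iota _)) -mulrA -rmorphM.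
  rewrite -mulr_sumr -rmorph_sum; move: arel; rewrite (bigD1_ord j)//= addrC => /eqP.
  by rewrite addr_eq0 => /eqP ->; rewrite rmorphN mulrN -rmorphM.
by rewrite e1 e2 mulrCA subrr.
Qed.

(* The evaluations of x ⊗ b in PB and in (A ⊗ C)_p, for x in P and T_(p) and b in
   A_p, combined into one relation. *)
Inductive Ev : PB -> Om -> Prop :=
| Ev_gen x t b : pv_val x = vT t -> Ev (tens x (fB b)) (iota t * cst b)
| Ev_zero : Ev 0 0
| Ev_add y y' w w' : Ev y w -> Ev y' w' -> Ev (y + y') (w + w').

Lemma Ev_opp y w : Ev y w -> Ev (- y) (- w).
Proof.
elim=> [x t b xt||y1 y2 w1 w2 _ IH1 _ IH2]; rewrite ?oppr0 ?opprD.
- have -> : - tens x (fB b) = tens (- x) (fB b).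
    by rewrite -[in RHS]sub0r tensBl tens0l sub0r.
  rewrite -mulNr -rmorphN; apply: Ev_gen.
  by rewrite !rmorphN /= xt.
- exact: Ev_zero.
- exact: Ev_add.
Qed.

Lemma Ev_mul y y' w w' : Ev y w -> Ev y' w' -> Ev (y * y') (w * w').
Proof.
elim=> [x t b xt||y1 y2 w1 w2 _ IH1 _ IH2] Ey'; rewrite ?mul0r ?mulrDl.
- elim: Ey' => [x' t' b' xt'||y1 y2 w1 w2 _ IH1 _ IH2]; rewrite ?mulr0 ?mulrDr.
  + rewrite tensM mulrACA -!rmorphM; apply: Ev_gen.
    by rewrite !rmorphM /= xt xt'.
  + exact: Ev_zero.
  + exact: Ev_add.
- exact: Ev_zero.
- by apply: Ev_add; auto.
Qed.

Lemma Ev_sum n (y : 'I_n -> PB) (w : 'I_n -> Om) :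
  (forall i, Ev (y i) (w i)) -> Ev (\sum_i y i) (\sum_i w i).
Proof.
move=> yw; elim: n y w yw => [|n IH] y w yw; first by rewrite !big_ord0; exact: Ev_zero.
by rewrite !big_ord_recl; apply: Ev_add => //; apply: IH.
Qed.

Lemma Ev_eq0 y : Ev y 0 -> y = 0.
Proof.
suff H w : Ev y w -> exists n (x : 'I_n -> P) (t : 'I_n -> TL) (b : 'I_n -> Ap),
    [/\ forall i, pv_val (x i) = vT (t i), y = \sum_i tens (x i) (fB (b i)) &
        w = \sum_i iota (t i) * cst (b i)].
  move=> /H[n [x [t [b [xt -> e]]]]]; exact: (tensor_relation xt (esym e)).
elim=> [x t b xt||y1 y2 w1 w2 _ [n1 [x1 [t1 [b1 [e1 -> ->]]]]] _ [n2 [x2 [t2 [b2 [e2 -> ->]]]]]].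
- by exists 1%N, (fun=> x), (fun=> t), (fun=> b); rewrite !big_ord1.
- by exists 0%N, (fun=> 0), (fun=> 0), (fun=> 0); split=> [[]//||]; rewrite big_ord0.
- pose glue T (f1 : 'I_n1 -> T) (f2 : 'I_n2 -> T) i :=
    match split i with inl k => f1 k | inr k => f2 k end.
  have gl T f1 f2 k : @glue T f1 f2 (lshift n2 k) = f1 k.
    by rewrite /glue (unsplitK (inl k)).
  have gr T f1 f2 k : @glue T f1 f2 (rshift n1 k) = f2 k.
    by rewrite /glue (unsplitK (inr k)).
  exists (n1 + n2)%N, (glue _ x1 x2), (glue _ t1 t2), (glue _ b1 b2); split.
  + by move=> i; rewrite /glue; case: split.
  + rewrite big_split_ord; congr (_ + _); apply: eq_bigr => k _; by rewrite ?gl ?gr.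
  + rewrite big_split_ord; congr (_ + _); apply: eq_bigr => k _; by rewrite ?gl ?gr.
Qed.

Section Beta.
Context (g : {rmorphism Us -> Us}) (gl : forall d, g (lU d) = lU d).
Context (YT : 'M[TL]_r) (U U' : 'M[Us]_r) (D D' : 'M[Ap]_r).
Hypothesis YPsi : mx_inverse YT PsiT.
Hypothesis UU' : mx_inverse U U'.
Hypothesis UE : map_mx sU U = map_mx iota YT.
Hypothesis U'E : map_mx sU U' = map_mx iota PsiT.
Hypothesis DD' : mx_inverse D D'.
Hypothesis DE : map_mx cst D = map_mx iota YT *m map_mx sU (map_mx g U').

(* x is sent to y when, denominators being cleared, x lies in TL, is the image of
   some u with coefficients in the separable closure, and y evaluates to g u. *)
Definition Inv (x : P) (y : PB) := exists d s t u,
  [/\ lQ d != 0, fB s != 0, pv_val (base (lQ d) * x) = vT t, iota t = sU u &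
      Ev (tens (base (lQ d)) (fB s) * y) (cst s * sU (g u))].

Lemma Inv_sub x x' y y' : Inv x y -> Inv x' y' -> Inv (x - x') (y - y').
Proof.
move=> [d [s [t [u [d0 s0 xt tu yw]]]]] [d' [s' [t' [u' [d0' s0' xt' tu' yw']]]]].
exists (d * d'), (s * s'), (lT d' * t - lT d * t'), (lU d' * u - lU d * u'); split.
- by rewrite rmorphM mulf_neq0.
- by rewrite rmorphM mulf_neq0.
- rewrite !rmorphB !rmorphM -xt -xt' !lTE !rmorphM /= mulrBr.
  by congr (_ - _); [rewrite mulrCA mulrA|rewrite mulrA].
- by rewrite !rmorphB !rmorphM tu tu' !lUE.
have ev1 : Ev (tens (base (lQ d')) (fB s')) (cst s' * sU (lU d')).
  by rewrite mulrC -lUE; apply: Ev_gen; rewrite lTE.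
have ev2 : Ev (tens (base (lQ d)) (fB s)) (cst s * sU (lU d)).
  by rewrite mulrC -lUE; apply: Ev_gen; rewrite lTE.
have := Ev_add (Ev_mul ev1 yw) (Ev_opp (Ev_mul ev2 yw')).
rewrite !rmorphB !rmorphM /= !gl -tensM mulrBr.
set a := tens (base (lQ d)) (fB s); set a' := tens (base (lQ d')) (fB s').
have -> : a * a' * y - a * a' * y' = a' * (a * y) - a * (a' * y').
  by rewrite (mulrC a a') -!mulrA; congr (_ - _); rewrite mulrCA.
congr Ev; rewrite mulrBr; congr (_ - _).
  by rewrite (mulrC (cst s) (cst s')) mulrACA.
by rewrite mulrACA.
Qed.

Lemma Inv_mul x x' y y' : Inv x y -> Inv x' y' -> Inv (x * x') (y * y').
Proof.
move=> [d [s [t [u [d0 s0 xt tu yw]]]]] [d' [s' [t' [u' [d0' s0' xt' tu' yw']]]]].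
exists (d * d'), (s * s'), (t * t'), (u * u'); split.
- by rewrite rmorphM mulf_neq0.
- by rewrite rmorphM mulf_neq0.
- by rewrite [RHS]rmorphM -xt -xt' -rmorphM; congr pv_val; rewrite !rmorphM mulrACA.
- by rewrite !rmorphM tu tu'.
have := Ev_mul yw yw'.
rewrite !rmorphM /= -tensM; congr Ev; exact: mulrACA.
Qed.

Lemma Inv_int x y t u : pv_val x = vT t -> iota t = sU u -> Ev y (sU (g u)) -> Inv x y.
Proof.
move=> xt tu yw; exists 1, 1, t, u; rewrite !rmorph1 !mul1r.
split=> //; rewrite ?oner_neq0//.
Qed.

Lemma Inv_base q : Inv (base q) (tens (base q) 1).
Proof.
have [n [d [d0 ->]]] := lQP q.
exists d, 1, (lT n), (lU n); split=> //.
- by rewrite rmorph1 oner_neq0.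
- by rewrite -rmorphM mulrC divfK//= lTE.
rewrite tensM rmorph1 mulr1 -rmorphM mulrCA divff// mulr1 gl -lUE.
rewrite (rmorph1 cst) mul1r.
have -> : iota (lT n) = iota (lT n) * cst 1 by rewrite rmorph1 mulr1.
have <- : fB 1 = 1 by exact: rmorph1.
by apply: Ev_gen; rewrite lTE.
Qed.

Lemma Inv_mx i j : Inv (pv_mx iQ Psi i j)
  (\sum_l tens (pv_mx iQ Psi i l) (fB (D l j))).
Proof.
apply: (@Inv_int _ _ (PsiT i j) (U' i j)).
- by rewrite mxE /= /Psi mxE.
- by have /matrixP/(_ i j) := U'E; rewrite !mxE.
have -> : sU (g (U' i j)) = \sum_l iota (PsiT i l) * cst (D l j).
  have [_ PY] := mx_inverse_map iota YPsi.
  have : map_mx iota PsiT *m map_mx cst D = map_mx sU (map_mx g U').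
    by rewrite DE mulmxA PY mul1mx.
  move=> /matrixP/(_ i j); rewrite [RHS]mxE [in RHS]mxE => <-.
  by rewrite mxE; apply: eq_bigr => l _; rewrite !mxE.
by apply: Ev_sum => l; apply: Ev_gen; rewrite mxE /= /Psi mxE.
Qed.

Lemma det_Psi0 : \det Psi != 0.
Proof. exact: det_map_neq0 YPsi. Qed.

Lemma Inv_detV : Inv (pv_detV iQ Psi) (tens (pv_detV iQ Psi) (fB (\det D'))).
Proof.
apply: (@Inv_int _ _ (\det YT) (\det U)).
- have [YP _] := mx_inverse_map vT YPsi.
  apply: (mulIf det_Psi0); rewrite mulVf ?det_Psi0// -det_map_mx -det_mulmx.
  by rewrite YP det1.
- by rewrite -!det_map_mx UE.
have -> : sU (g (\det U)) = iota (\det YT) * cst (\det D').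
  rewrite -!det_map_mx.
  have [_ g'] := mx_inverse_map sU (mx_inverse_map g UU').
  have [D1 D2] := mx_inverse_map cst DD'.
  have [Y1 Y2] := mx_inverse_map iota YPsi.
  have e : map_mx cst D *m map_mx sU (map_mx g U) = map_mx iota YT.
    by rewrite DE -mulmxA g' mulmx1.
  rewrite -e det_mulmx mulrAC -det_mulmx D1 det1 mul1r.
  by [].
apply: Ev_gen.
have [YP _] := mx_inverse_map vT YPsi.
apply: (mulIf det_Psi0); rewrite mulVf ?det_Psi0// -det_map_mx -det_mulmx.
by rewrite YP det1.
Qed.

Lemma Inv_total x : exists y, Inv x y.
Proof.
elim/pv_ring_ind: x => [|x x' [y xy] [y' xy']|x x' [y xy] [y' xy']|q|i j|].
- by exists (tens (base 1) 1); rewrite -(rmorph1 base); exact: Inv_base.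
- by exists (y - y'); exact: Inv_sub.
- by exists (y * y'); exact: Inv_mul.
- by exists (tens (base q) 1); exact: Inv_base.
- by exists (\sum_l tens (pv_mx iQ Psi i l) (fB (D l j))); exact: Inv_mx.
- by exists (tens (pv_detV iQ Psi) (fB (\det D'))); exact: Inv_detV.
Qed.

Lemma Inv_fun x y y' : Inv x y -> Inv x y' -> y = y'.
Proof.
move=> xy xy'; apply/eqP; rewrite -subr_eq0; apply/eqP.
have := Inv_sub xy xy'; rewrite subrr => -[d [s [t [u [d0 s0 xt tu yw]]]]].
have t0 : t = 0 by apply: vT_inj; rewrite -xt mulr0 !rmorph0.
have u0 : u = 0 by apply: sU_inj; rewrite -tu t0 !rmorph0.
move: yw; rewrite u0 !rmorph0 mulr0 => /Ev_eq0 e.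
by rewrite -[_ - _]mul1r -(tens_unit d0 s0) -mulrA e mulr0.
Qed.

Definition pv_twist (x : P) : PB := sval (cid (Inv_total x)).

Lemma pv_twistP x : Inv x (pv_twist x).
Proof. by rewrite /pv_twist; case: cid. Qed.

Lemma pv_twistE x y : Inv x y -> pv_twist x = y.
Proof. exact: (Inv_fun (pv_twistP x)). Qed.

Fact pv_twist_zmod : zmod_morphism pv_twist.
Proof. by move=> x y; apply: pv_twistE; apply: Inv_sub; exact: pv_twistP. Qed.
Fact pv_twist_monoid : monoid_morphism pv_twist.
Proof.
split=> [|x y]; last by apply: pv_twistE; apply: Inv_mul; exact: pv_twistP.
by apply: pv_twistE; have := Inv_base 1; rewrite rmorph1.
Qed.

HB.instance Definition _ := GRing.isZmodMorphism.Build P PB pv_twist pv_twist_zmod.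
HB.instance Definition _ := GRing.isMonoidMorphism.Build P PB pv_twist pv_twist_monoid.

Lemma pv_twist_base q : pv_twist (base q) = tens (base q) 1.
Proof. exact/pv_twistE/Inv_base. Qed.

Lemma twisted_automorphism : exists alpha : {rmorphism PB -> PB},
  [/\ forall b, alpha (tensr _ _ b) = tensr _ _ b,
      forall q, alpha (tensl _ _ (base q)) = tensl _ _ (base q) &
      map_mx alpha (map_mx (tensl _ _) (pv_mx iQ Psi)) =
      map_mx (tensl _ _) (pv_mx iQ Psi) *m map_mx (tensr _ _) (map_mx fB D)].
Proof.
have uv k : pv_twist ((base \o iKQ) k) = tensr (base \o iKQ) iB (iB k).
  rewrite pv_twist_base /tensr.
  have := @tensor_bal K P B (scal_by (base \o iKQ)) (scal_by iB) k 1 1.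
  by rewrite /scal_by !mulr1.
exists (talg_lift uv); split=> [b|q|].
- by rewrite /= talg_lift_tensor rmorph1 mul1r.
- by rewrite /= talg_lift_tensor rmorph1 mulr1 /= pv_twist_base.
apply/matrixP => i j; rewrite mxE.
have -> : map_mx (tensl (base \o iKQ) iB) (pv_mx iQ Psi) i j = tensl _ _ (pv_mx iQ Psi i j).
  by rewrite mxE.
rewrite /= talg_lift_tensor rmorph1 mulr1 /= (pv_twistE (Inv_mx i j)) mxE; apply: eq_bigr => l _.
by rewrite [LHS]tensor_tensl_tensr; congr (_ * _); rewrite [RHS]mxE// mxE.
Qed.

End Beta.

Section Automorphism.
Context (tau : {rmorphism LL -> LL}) (tauQ : {rmorphism Q -> Q}).
Hypothesis tau_base : forall q, tau (iQ q) = iQ (tauQ q).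
Hypothesis tau_const : forall k, tauQ (iKQ k) = iKQ k.
Context (Theta : 'M[Q]_r).
Hypothesis tau_Psi : map_mx tau Psi = map_mx iQ Theta *m Psi.
Hypothesis Psi0 : \det Psi != 0.
Local Notation M := (map_mx (tensl (base \o iKQ) iB) (pv_mx iQ Psi)).
Local Notation tauP := (@pv_tau Q LL iQ tau r Psi).

Lemma pv_val_mx i j : pv_val (pv_mx iQ Psi i j) = Psi i j.
Proof. by rewrite mxE. Qed.

Lemma tau_Psi_entry i j : tau (Psi i j) = \sum_l iQ (Theta i l) * Psi l j.
Proof.
have /matrixP/(_ i j) := tau_Psi; rewrite [LHS]mxE [RHS]mxE => ->.
by apply: eq_bigr => l _; rewrite [map_mx iQ _ _ _]mxE.
Qed.

Lemma pv_tauE x : pv_val (tauP x) = tau (pv_val x).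
Proof.
rewrite /pv_tau -[LHS]/(val _) insubdK//.
elim/pv_ring_ind: x => [|x y hx hy|x y hx hy|q|i j|].
- by rewrite !rmorph1; exact: (valP (1 : P)).
- rewrite !rmorphB; exact: (valP (PVRing hx - PVRing hy)).
- rewrite !rmorphM; exact: (valP (PVRing hx * PVRing hy)).
- by rewrite /= tau_base; exact: (valP (base (tauQ q))).
- have -> : tau (pv_val (pv_mx iQ Psi i j)) =
      pv_val (\sum_l base (Theta i l) * pv_mx iQ Psi l j).
    rewrite pv_val_mx tau_Psi_entry rmorph_sum; apply: eq_bigr => l _.
    by rewrite rmorphM /= pv_val_mx.
  exact: valP.
- have dTheta : \det Theta != 0.
    have e : tau (\det Psi) = iQ (\det Theta) * \det Psi.
      by rewrite -!det_map_mx tau_Psi det_mulmx.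
    have : tau (\det Psi) != 0 by rewrite fmorph_eq0.
    by rewrite e mulf_eq0 negb_or fmorph_eq0 => /andP[].
  have -> : tau (pv_val (pv_detV iQ Psi)) = pv_val (base (\det Theta)^-1 * pv_detV iQ Psi).
    rewrite rmorphM /= !fmorphV -det_map_mx tau_Psi det_mulmx det_map_mx.
    by rewrite invfM.
  exact: valP.
Qed.

Fact pv_tau_zmod : zmod_morphism tauP.
Proof. by move=> x y; apply: pv_val_inj; rewrite pv_tauE !rmorphB /= !pv_tauE. Qed.
Fact pv_tau_monoid : monoid_morphism tauP.
Proof.
split=> [|x y]; apply: pv_val_inj; first by rewrite pv_tauE !rmorph1.
by rewrite pv_tauE !rmorphM /= !pv_tauE.
Qed.
Let tauP' : P -> P := tauP.
HB.instance Definition _ := GRing.isZmodMorphism.Build P P tauP' pv_tau_zmod.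
HB.instance Definition _ := GRing.isMonoidMorphism.Build P P tauP' pv_tau_monoid.

Lemma pv_tau_base q : tauP (base q) = base (tauQ q).
Proof. by apply: pv_val_inj; rewrite pv_tauE /= tau_base. Qed.

Lemma pv_tau_const k : tauP' ((base \o iKQ) k) = (base \o iKQ) k.
Proof. by rewrite /tauP' /= pv_tau_base tau_const. Qed.

Lemma pv_tau_mx : map_mx tauP' (pv_mx iQ Psi) = map_mx base Theta *m pv_mx iQ Psi.
Proof.
apply/matrixP => i j; apply: pv_val_inj; rewrite mxE pv_tauE pv_val_mx tau_Psi_entry.
rewrite mxE rmorph_sum; apply: eq_bigr => l _.
by rewrite rmorphM /= pv_val_mx [map_mx base _ _ _]mxE.
Qed.

Lemma PB_rmorph_ext (h h' : {rmorphism PB -> PB}) :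
  (forall b, h (tensr _ _ b) = h' (tensr _ _ b)) ->
  (forall q, h (tensl _ _ (base q)) = h' (tensl _ _ (base q))) ->
  map_mx h M = map_mx h' M -> forall t, h t = h' t.
Proof.
move=> hr hq hM; apply: talg_rmorph_ext => // x.
apply: (pv_rmorph_ext (h := h \o tensl _ _) (h' := h' \o tensl _ _)) => //.
transitivity (map_mx h M); first exact: map_mx_comp.
by rewrite hM; symmetry; exact: map_mx_comp.
Qed.

Theorem twist_in_galois_group (g g' : {rmorphism Us -> Us})
    (gl : forall d, g (lU d) = lU d) (gl' : forall d, g' (lU d) = lU d)
    (YT : 'M[TL]_r) (U U' : 'M[Us]_r) (D D' : 'M[Ap]_r)
    (YPsi : mx_inverse YT PsiT) (UU' : mx_inverse U U')
    (UE : map_mx sU U = map_mx iota YT) (U'E : map_mx sU U' = map_mx iota PsiT)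
    (DD' : mx_inverse D D')
    (DE : map_mx cst D = map_mx iota YT *m map_mx sU (map_mx g U'))
    (D'E : map_mx cst D' = map_mx iota YT *m map_mx sU (map_mx g' U')) :
  in_difference_galois_group iKQ iQ tau Psi iB (map_mx fB D).
Proof.
have D'D : mx_inverse D' D by case: DD'.
have [al [alr alq alM]] := twisted_automorphism gl YPsi UU' UE U'E DD' DE.
have [be [ber beq beM]] := twisted_automorphism gl' YPsi UU' UE U'E D'D D'E.
split; first by exists (map_mx fB D'); exact: mx_inverse_map.
have canP (a b : {rmorphism PB -> PB}) (C C' : 'M[Ap]_r) :
    (forall b, a (tensr _ _ b) = tensr _ _ b) ->
    (forall q, a (tensl _ _ (base q)) = tensl _ _ (base q)) ->
    map_mx a M = M *m map_mx (tensr _ _) (map_mx fB C) ->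
    (forall c, b (tensr _ _ c) = tensr _ _ c) ->
    (forall q, b (tensl _ _ (base q)) = tensl _ _ (base q)) ->
    map_mx b M = M *m map_mx (tensr _ _) (map_mx fB C') ->
    C' *m C = 1%:M -> cancel a b.
  move=> ar aq aM br bq bM CC t.
  apply: (PB_rmorph_ext (h := b \o a) (h' := idfun)) => [c|q|].
  - by rewrite /= ar br.
  - by rewrite /= aq bq.
  rewrite map_mx_comp aM map_mxM bM.
  have -> : map_mx b (map_mx (tensr _ _) (map_mx fB C)) = map_mx (tensr _ _) (map_mx fB C).
    by apply/matrixP => i j; rewrite !mxE br.
  rewrite -mulmxA -!map_mxM CC !map_mx1 mulmx1.
  by apply/matrixP => i j; rewrite [RHS]mxE.
exists al; split.
- by exists be; [exact: canP alr alq alM ber beq beM DD'.2|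
    exact: canP ber beq beM alr alq alM DD'.1].
- move=> q b; rewrite tensor_tensl_tensr rmorphM.
  by rewrite -/(pv_of_base iQ Psi q) alq alr.
- pose tauPB : {rmorphism PB -> PB} :=
    talg_map (u := tauP') (v := idfun) pv_tau_const (fun k => erefl (iB k)).
  have tl x : tauPB (tensl _ _ x) = tensl _ _ (tauP' x) by exact: talg_map_tensor.
  have tr b : tauPB (tensr _ _ b) = tensr _ _ b.
    by apply: (etrans (talg_map_tensor _ _ _ _)); rewrite rmorph1.
  move=> x; apply: (PB_rmorph_ext (h := al \o tauPB) (h' := tauPB \o al)) => [c|q|].
  + by rewrite /= tr alr tr.
  + by rewrite /= alq tl /tauP' pv_tau_base alq.
  have tM : map_mx tauPB M = map_mx (tensl _ _) (map_mx base Theta) *m M.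
    rewrite -map_mxM -pv_tau_mx; apply/matrixP => i j.
    have Mij : M i j = tensl _ _ (pv_mx iQ Psi i j) by rewrite mxE.
    rewrite [LHS]mxE Mij tl [RHS]mxE; congr tensl.
    by rewrite [RHS]mxE.
  rewrite [LHS]map_mx_comp [RHS]map_mx_comp alM tM map_mxM alM [RHS]map_mxM tM mulmxA.
  congr (_ *m _ *m _); apply/matrixP => i j; rewrite !mxE; [exact: alq|symmetry; exact: tr].
- apply: etrans alM; apply/matrixP => i j.
  have Mij : M i j = tensl _ _ (pv_mx iQ Psi i j) by rewrite mxE.
  by rewrite [RHS]mxE Mij [LHS]mxE.
Qed.

End Automorphism.
End GaloisPoints.

Lemma map_mx_square (A B B' C : Type) (f : A -> B) (g : B -> C) (f' : A -> B')
    (g' : B' -> C) m n (M : 'M[A]_(m, n)) : (forall x, g (f x) = g' (f' x)) ->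
  map_mx g (map_mx f M) = map_mx g' (map_mx f' M).
Proof. by move=> gf; apply/matrixP => i j; rewrite !mxE. Qed.

Lemma rmorph_inverse (E : fieldType) (g : {rmorphism E -> E}) : bijective g ->
  exists g' : {rmorphism E -> E}, cancel g g' /\ cancel g' g.
Proof.
move=> [h gK hK].
have hB : zmod_morphism h by move=> x y; apply: (can_inj gK); rewrite rmorphB !hK.
have hM : monoid_morphism h.
  by split=> [|x y]; apply: (can_inj gK); rewrite ?rmorph1 ?rmorphM !hK.
pose g' : {rmorphism E -> E} := HB.pack h
  (GRing.isZmodMorphism.Build E E h hB) (GRing.isMonoidMorphism.Build E E h hM).
by exists g'.
Qed.

Lemma padicT_map_to (F : finFieldType) (K : fieldType) (iF : {rmorphism F -> K})
    (Oinf : set K) (p : set (ringA iF Oinf)) (E E' : comPzRingType) (iE : F -> E)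
    (iE' : F -> E') (u : {rmorphism E -> E'}) (uE : forall c, u (iE c) = iE' c)
    (t : tensA iF Oinf iE) :
  padicT_map p uE (tensA_to_padicT p t) = tensA_to_padicT p (tensA_map uE t).
Proof. by apply: plimP => n; exact: residueT_map_to. Qed.

Lemma tensA_map_comp (F : finFieldType) (K : fieldType) (iF : {rmorphism F -> K})
    (Oinf : set K) (E1 E2 E3 : comPzRingType) (i1 : F -> E1) (i2 : F -> E2)
    (i3 : F -> E3) (u : {rmorphism E1 -> E2}) (w : {rmorphism E2 -> E3})
    (v : {rmorphism E1 -> E3}) (uE : forall c, u (i1 c) = i2 c)
    (wE : forall c, w (i2 c) = i3 c) (vE : forall c, v (i1 c) = i3 c) :
  (forall x, w (u x) = v x) ->
  forall t : tensA iF Oinf i1, tensA_map wE (tensA_map uE t) = tensA_map vE t.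
Proof.
move=> wu; apply: (@talg_ext _ _ _ _ _ _
  (tensA_map wE \o tensA_map (Oinf := Oinf) uE) (tensA_map vE)) => a x.
by rewrite /= !tensA_map_tensor wu.
Qed.

Section PointsOverKp.
Context (R : realType) (F : finFieldType) (K : fieldType).
Context (iF : {rmorphism F -> K}) (hK : function_field iF) (Oinf : set K).
Context (L Cinf : fieldType).
Context (ell : {rmorphism K -> L}) (iLC : {rmorphism L -> Cinf}).
Context (abs : Cinf -> R) (hCinf : is_Cinf (iLC \o ell) Oinf abs).
Local Notation A := (ringA iF Oinf).
Local Notation iL := (ell \o iF).
Local Notation iC := (iLC \o iL).
Local Notation AL := (tensA iF Oinf iL).
Local Notation AC := (tensA iF Oinf iC).
Context (Q : frac_field AL) (p : set A) (hp : prime_ideal p).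
Context (hp0 : exists2 a, p a & a != 0).
Context (T : gauss_completion iF Oinf iC abs) (LL : frac_field T).
Context (iota : {rmorphism tate_loc LL p -> padicT p iC}).
Context (hiota : natural_embedding iota).
Context (Kp : frac_field (padicA p)).
Local Notation tg := (to_gauss T).
Local Notation toT := (to_semiloc LL (to_gauss T @` ideal_tensA iC p)).
Local Notation cst := (@padicA_to_padicT F K iF Oinf p Cinf iC).

Let iC' : {rmorphism F -> Cinf} := iLC \o (ell \o iF).
Let iL' : {rmorphism F -> L} := ell \o iF.

Lemma to_gauss_tensl_inj : injective (fun a : A => tg (tensor a 1)).
Proof.
move=> a b ab; apply/eqP; rewrite -subr_eq0; apply: contraT => nz.
have := gauss_norm_tensorE (iC := iC') (Cinf_abs_ge0 hCinf) T 1 nz.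
have -> : tg (tensor (a - b) 1) = 0.
  rewrite -(subrr (tg (tensor b 1))) -{1}ab -rmorphB; congr (tg _).
  exact: (rmorphB (tensl constA iC)).
rewrite gauss_norm_0 => /esym; rewrite (abs1 (Cinf_abs0 hCinf) (Cinf_absM hCinf)).
by move=> /eqP; rewrite oner_eq0.
Qed.

Lemma iota_const (a : A) : iota (toT (tg (tensor a 1))) = cst (to_padicA p a).
Proof. by rewrite hiota.2 tensA_to_padicT_const. Qed.

Lemma to_padicA_inj : injective (to_padicA p).
Proof.
move=> a b ab; apply: to_gauss_tensl_inj.
have : toT (tg (tensor a 1)) = toT (tg (tensor b 1)).
  by apply: hiota.1; rewrite !iota_const ab.
by move=> /(congr1 (@semiloc_val _ _ _)) /=; exact: to_frac_inj.
Qed.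

Lemma tensl_AL_inj : injective (tensl constA iL : A -> AL).
Proof.
move=> a b ab; apply: to_gauss_tensl_inj => /=.
have e c : tg (tensor c 1) = tg (tens_incl iLC (tensl constA iL c)).
  by rewrite tens_incl_tensor rmorph1.
by rewrite !e ab.
Qed.

Lemma const_fracE (a : A) : const_frac Q (ringA_val a) = to_frac Q (tensor a 1).
Proof.
pose g : {rmorphism A -> Q} := to_frac Q \o tensl constA iL.
rewrite -[LHS]/(frac_ext (@ringA_val F K iF Oinf) g (ringA_val a)).
rewrite -[ringA_val a]divr1 -(rmorph1 (@ringA_val F K iF Oinf)).
rewrite (@frac_extE _ _ _ (@ringA_val F K iF Oinf) g) ?rmorph1 ?divr1//.
- exact: ringA_val_inj.
- by move=> x y /to_frac_inj /tensl_AL_inj.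
- exact: oner_neq0.
Qed.

Lemma const_padicE (a : A) : const_padic Kp (ringA_val a) = to_frac Kp (to_padicA p a).
Proof.
pose g : {rmorphism A -> Kp} := to_frac Kp \o to_padicA p.
rewrite -[LHS]/(frac_ext (@ringA_val F K iF Oinf) g (ringA_val a)).
rewrite -[ringA_val a]divr1 -(rmorph1 (@ringA_val F K iF Oinf)).
rewrite (@frac_extE _ _ _ (@ringA_val F K iF Oinf) g) ?rmorph1 ?divr1//.
- exact: ringA_val_inj.
- by move=> x y /to_frac_inj /to_padicA_inj.
- exact: oner_neq0.
Qed.

Lemma const_frac_tau (k : K) :
  frac_map Q (tensA_tau_inj hCinf T) (const_frac Q k) = const_frac Q k.
Proof.
rewrite /const_frac /frac_ext; set ab := xget _ _.
rewrite fmorph_div /= !frac_mapE.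
have e (a : A) : tensA_tau (tensor a 1 : AL) = tensor a 1.
  by rewrite (tensA_tau_tensor iL') expr1n.
by congr (to_frac Q _ / to_frac Q _); exact: e.
Qed.

Lemma tate_loc_disjoint n (t : 'I_n -> tate_loc LL p) (b : 'I_n -> padicA p) :
  \sum_i iota (t i) * cst (b i) = 0 -> (exists i, t i != 0) ->
  exists a : 'I_n -> A, (exists i, a i != 0) /\ \sum_i to_padicA p (a i) * b i = 0.
Proof.
move=> rel [i0 ti0].
have /choice[f fP] : forall i, exists fg : T * T,
    to_frac LL fg.2 != 0 /\ semiloc_val (t i) = to_frac LL fg.1 / to_frac LL fg.2.
  by move=> i; have [x [y H]] := to_fracP (semiloc_val (t i)); exists (x, y).
pose G := \prod_i (f i).2.
have G0 : to_frac LL G != 0.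
  by rewrite rmorph_prod; apply/prodf_neq0 => i _; case: (fP i).
pose h i := (f i).1 * \prod_(j | j != i) (f j).2.
have hE i : toT (h i) = toT G * t i.
  have [fi0 ti] := fP i; apply: semiloc_inj.
  rewrite [RHS]rmorphM /= ti /h /G [in RHS](bigD1 i)//= !(rmorphM (to_frac LL)) /=.
  by rewrite [RHS]mulrAC [X in _ = X * _]mulrCA divff// mulr1.
apply: (@tate_padic_disjoint _ _ _ _ hK _ _ _ _ _ _ hCinf p hp hp0 T LL iota hiota n h).
  under eq_bigr => i _ do rewrite hE rmorphM -mulrA.
  by rewrite -mulr_sumr rel mulr0.
exists i0; apply: contra_neq ti0 => h0; apply: semiloc_inj; apply: (mulfI G0).
have e : to_frac LL (h i0) = to_frac LL G * semiloc_val (t i0).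
  exact (congr1 (@semiloc_val _ LL _) (hE i0)).
by rewrite -e h0 !rmorph0 mulr0.
Qed.

End PointsOverKp.

Theorem theorem9p10 (R : realType)
    (F : finFieldType) (K : fieldType) (iF : {rmorphism F -> K})
    (hK : function_field iF) (Oinf : set K) (hOinf : closed_point iF Oinf)
    (L Cinf : fieldType)
    (ell : {rmorphism K -> L}) (iLC : {rmorphism L -> Cinf})
    (abs : Cinf -> R) (hCinf : is_Cinf (iLC \o ell) Oinf abs)
    (Ls : sep_closure iLC)
    (E : anderson_module iF Oinf ell) (hE : uniformizable E abs iLC)
    (Q : frac_field (tensA iF Oinf (ell \o iF)))
    (r : nat) (hr : motive_rank E Q r)
    (p : set (ringA iF Oinf)) (hp : prime_ideal p)
    (hp0 : exists2 a, p a & a != 0)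
    (hfree : free_fg (motive_loc E Q p))
    (m : 'I_r -> motive_loc E Q p) (hm : is_basis m)
    (Theta : 'M[semiloc Q (ideal_tensA (ell \o iF) p)]_r)
    (hTheta : forall i, motive_loc_tau (m i) = \sum_j Theta i j *: m j)
    (T : gauss_completion iF Oinf (iLC \o (ell \o iF)) abs) (LL : frac_field T)
    (iota : {rmorphism tate_loc LL p -> padicT p (iLC \o (ell \o iF))})
    (hiota : natural_embedding iota)
    (Upsilon Psi : 'M[tate_loc LL p]_r) (hPsi : mx_inverse Upsilon Psi)
    (hUpsilon : rigid_trivialization m Upsilon)
    (Kp : frac_field (padicA p))
    (gamma : galois_group Ls) :
  exists U : 'M[padicT p (sep_in Ls \o (ell \o iF))]_r,
    map_mx (padic_sep_incl p Ls) U = map_mx iota Upsilon /\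
  exists (V W : 'M[padicT p (iLC \o (ell \o iF))]_r) (D : 'M[padicA p]_r),
    [/\ V = map_mx (padic_sep_incl p Ls)
              (map_mx (padic_gal gamma) U),
        mx_inverse V W,
        exists D', mx_inverse D D',
        map_mx (padicA_to_padicT (iLC \o (ell \o iF))) D =
          map_mx iota Upsilon *m W &
        in_difference_galois_group (const_frac Q) (frac_tate Q LL)
          (frac_endo (gauss_tau T)) (map_mx semiloc_val Psi)
          (const_padic Kp) (map_mx (to_frac Kp) D)].
Proof.
have YTheta := rigid_matrix hCinf hm hTheta hUpsilon.
have [U [U' [UU' UE U'E]]] := sep_matrix hK hp hp0 hiota Ls YTheta hPsi.
have [D [D' [DD' DE D'E]]] :=
  galois_cocycle hK hp hp0 hiota YTheta hPsi (gal_fix gamma) UU' UE.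
pose sU : {rmorphism padicT p (sep_in Ls \o (ell \o iF)) -> _} :=
  @padic_sep_incl F K iF Oinf L Cinf ell iLC p Ls.
pose gal : {rmorphism padicT p (sep_in Ls \o (ell \o iF)) ->
    padicT p (sep_in Ls \o (ell \o iF))} :=
  padicT_map p (u := gamma) (fun c => gal_fix gamma (ell (iF c))).
exists U; split; first exact: UE.
exists (map_mx sU (map_mx gal U)), (map_mx sU (map_mx gal U')), D; split.
- by [].
- exact/mx_inverse_map/mx_inverse_map.
- by exists D'.
- exact: DE.
have [g' [gK g'K]] := rmorph_inverse (gal_bij gamma).
have g'fix x : g' (sep_in Ls x) = sep_in Ls x by rewrite -{1}(gal_fix gamma x) gK.
pose gal' : {rmorphism padicT p (sep_in Ls \o (ell \o iF)) ->
    padicT p (sep_in Ls \o (ell \o iF))} :=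
  padicT_map p (u := g') (fun c => g'fix (ell (iF c))).
have sU_inj : injective sU by exact: (@sep_incl_inj F K iF hK Oinf L Cinf ell iLC p hp hp0 Ls).
have galK x : gal' (gal x) = x.
  pose sE c : sep_out Ls ((sep_in Ls \o (ell \o iF)) c) = (iLC \o (ell \o iF)) c :=
    sep_comp Ls (ell (iF c)).
  have id_sE c : idfun ((sep_in Ls \o (ell \o iF)) c) = (sep_in Ls \o (ell \o iF)) c.
    by [].
  rewrite [LHS](padicT_map_comp (v := idfun) _ _ id_sE gK); apply: sU_inj.
  exact: (padicT_map_comp (v := sep_out Ls) id_sE sE sE (fun=> erefl)).
pose sIn : {rmorphism tensA iF Oinf (ell \o iF) -> tensA iF Oinf (sep_in Ls \o (ell \o iF))} :=
  tensA_map (u := sep_in Ls) (fun c => erefl).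
pose lU : {rmorphism tensA iF Oinf (ell \o iF) -> padicT p (sep_in Ls \o (ell \o iF))} :=
  @tensA_to_padicT F K iF Oinf p Ls (sep_in Ls \o (ell \o iF)) \o sIn.
pose toT : {rmorphism T -> tate_loc LL p} := to_semiloc LL (to_gauss T @` ideal_tensA (iLC \o (ell \o iF)) p).
pose X := to_gauss T @` ideal_tensA (iLC \o (ell \o iF)) p.
pose gt_inj : injective (gauss_tau T) := 
  @gauss_tau_inj R F K iF Oinf Cinf (iLC \o (ell \o iF)) abs
    (Cinf_abs_ge0 hCinf) (Cinf_abs0 hCinf) (Cinf_absM hCinf) T.
pose t_inj : injective (to_gauss T \o tens_incl iLC) :=
  @tate_incl_inj R F K iF Oinf L Cinf ell iLC abs hCinf T.
suff H : in_difference_galois_group (const_frac Q) (frac_map LL t_inj)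
  (frac_map LL gt_inj) (map_mx (@semiloc_val _ LL X) Psi)
          (const_padic Kp) (map_mx (to_frac Kp) D) by exact: H.
apply: (@twist_in_galois_group K Q LL Kp (const_frac Q)
  (frac_map LL t_inj) (const_padic Kp)
  (ringA iF Oinf) (tensA iF Oinf (ell \o iF)) (tate_loc LL p) (padicA p)
  (padicT p (sep_in Ls \o (ell \o iF))) (padicT p (iLC \o (ell \o iF)))
  (@ringA_val F K iF Oinf) (to_frac Q \o tensl constA (ell \o iF))
  (toT \o to_gauss T \o tensl constA (iLC \o (ell \o iF)))
  (to_padicA p) (to_frac Kp) (@semiloc_val _ LL X) iota
  (@padicA_to_padicT F K iF Oinf p Cinf (iLC \o (ell \o iF))) sU
  (to_frac Q) (toT \o to_gauss T \o tens_incl iLC) lU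
  _ _ _ _ _ (@semiloc_inj _ LL X) sU_inj _ _ _ _
  r Psi (frac_map LL gt_inj)
  (frac_map Q (tensA_tau_inj hCinf T)) _ _ (map_mx semiloc_val Theta) _ _
  gal gal' _ _ Upsilon U U' D D' hPsi UU' UE U'E DD' DE _).
- exact: (const_fracE hCinf Q T).
- exact: (const_padicE hCinf hiota).
- move=> a; apply: contra_neq; rewrite -(rmorph0 (to_frac Q \o tensl constA (ell \o iF))).
  by move=> /to_frac_inj /(tensl_AL_inj hCinf T).
- by move=> a; rewrite /= frac_mapE /= tens_incl_tensor rmorph1.
- exact: (iota_const hiota).
- by move=> d; rewrite /= frac_mapE.
- move=> d; rewrite /= hiota.2; symmetry.
  apply: (etrans (padicT_map_to p _ _)); congr tensA_to_padicT.
  by apply: tensA_map_comp => x; exact: sep_comp.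
- exact: to_fracP.
- exact: (tate_loc_disjoint hK hCinf hp hp0 hiota).
- by move=> q; exact: esym (frac_map_incl hCinf LL q).
- exact: (const_frac_tau hCinf Q T).
- have tauPsi := trivialization_inverse YTheta hPsi.
  have := congr1 (map_mx (@semiloc_val _ LL X)) tauPsi; rewrite [RHS]map_mxM => e.
  apply: etrans (etrans e _); first by apply: map_mx_square => x; symmetry; exact: semiloc_mapE.
  by congr (_ *m _); apply: map_mx_square => x; exact: semiloc_mapE.
- exact: det_map_neq0 hPsi.
- move=> d; apply: (etrans (padicT_map_to p _ _)); congr tensA_to_padicT.
  by apply: tensA_map_comp => x; exact: gal_fix.
- move=> d; apply: (etrans (padicT_map_to p _ _)); congr tensA_to_padicT.
  by apply: tensA_map_comp => x; exact: g'fix.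
pose cS := @padicA_to_padicT F K iF Oinf p Ls (sep_in Ls \o (ell \o iF)).
have sU_matrix_inj (M N : 'M[padicT p (sep_in Ls \o (ell \o iF))]_r) :
    map_mx sU M = map_mx sU N -> M = N.
  move=> MN; apply/matrixP => i j; apply: sU_inj.
  by have /matrixP/(_ i j) := MN; rewrite [LHS]mxE [RHS]mxE.
have cD' : map_mx sU (map_mx cS D') =
    map_mx (padicA_to_padicT (iLC \o (ell \o iF))) D'.
  by apply/matrixP => i j; rewrite !mxE; exact: padicT_map_const.
have ND' : map_mx cS D' = map_mx gal U *m U'.
  by apply: sU_matrix_inj; rewrite cD' map_mxM U'E; exact: D'E.
have ND'2 : map_mx cS D' = U *m map_mx gal' U'.
  have -> : map_mx cS D' = map_mx gal' (map_mx cS D').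
    by apply/matrixP => i j; rewrite !mxE; symmetry; exact: padicT_map_const.
  rewrite ND' map_mxM; congr (_ *m _).
  by apply/matrixP => i j; rewrite mxE [map_mx gal U i j]mxE galK.
apply: etrans (esym cD') _; rewrite ND'2; apply: etrans (map_mxM _ _ _) _.
by congr (_ *m _); exact: UE.
Qed.
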